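(* Let $Q(x,y)=rx^2+sxy+ty^2$ be a primitive indefinite integral binary quadratic form of nonsquare discriminant. For every $\mu_Q$-continuity set $W\subseteq[\gamma_Q]_1$, \[\lim_{X\to\infty}\frac{N^{\mathrm{Or}}_{\mathrm{rings}}(Q;X,W)}{N^{\mathrm{Or}}_{\mathrm{rings}}(Q;X)}=\frac{\mu_Q(W)}{\mu_Q([\gamma_Q]_1)},\] where $N^{\mathrm{Or}}_{\mathrm{rings}}(Q;X,W)$ is the number of isomorphism classes of oriented complex cubic orders $R$ with $[T_R^{\perp\prime}]_1=[Q]_1$, $|\Delta(R)|<X$ and $[\mathrm{sh}(R)]_1\in W$, and $N^{\mathrm{Or}}_{\mathrm{rings}}(Q;X)=N^{\mathrm{Or}}_{\mathrm{rings}}(Q;X,[\gamma_Q]_1)$.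
   Context: A complex cubic order is an order in a cubic field with one real and two complex embeddings $\sigma_1,\sigma_2,\sigma_3$. An oriented cubic ring is a pair $(R,\delta)$ with $\delta:\wedge^3R\cong\mathbf{Z}$; isomorphisms must respect $\delta$. For such $R$ choose a $\mathbf{Z}$-basis $1,\alpha_1,\alpha_2$ with $\delta(1\wedge\alpha_1\wedge\alpha_2)=1$, put $\alpha^\perp=3\alpha-\mathrm{Tr}(\alpha)$, $T(x,y)=\mathrm{Tr}((x\alpha_1^\perp+y\alpha_2^\perp)^2)$, $M(x,y)=\sum_i|\sigma_i(x\alpha_1^\perp+y\alpha_2^\perp)|^2$. $T_R^{\perp\prime}$ is $T$ divided by the gcd of its coefficients and $[\cdot]_1$ denotes the $\mathrm{SL}_2(\mathbf{Z})$-equivalence class (action $(g\cdot Q)(x,y)=Q((x,y)g)$). For positive definite $rx^2+sxy+ty^2$, $z=\frac{s}{2r}+i\frac{\sqrt{4rt-s^2}}{2r}$; $[\mathrm{sh}(R)]_1$ is the image of $z(M)$ in $\mathrm{SL}_2(\mathbf{Z})\backslash\mathfrak{H}$ (Möbius action). $\gamma_Q\subset\mathfrak{H}$ is the hyperbolic geodesic joining the two points of $\mathbf{R}\cup\{\infty\}$ at which $Q$ vanishes ($[u:v]\mapsto u/v$); $[\gamma_Q]_1$ is its image in $\mathrm{SL}_2(\mathbf{Z})\backslash\mathfrak{H}$, with measure $\mu_Q$ induced by hyperbolic arc length. A $\mu_Q$-continuity set is a measurable set whose boundary has $\mu_Q$-measure $0$.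
   Formalization: The endpoints of γ_Q are taken as −u/v for the zeros [u:v] of Q instead of u/v; with u/v and the given z(M), shapes lie on the mirror-image geodesic and the claim fails, e.g. for Q=3x²+2xy−26y². *)

(* Defs.v *)
From HB Require Import structures.
From mathcomp Require Import all_boot all_order all_algebra all_field.
From mathcomp Require Import complex generic_quotient.
From mathcomp Require Import all_classical all_reals all_analysis.
From mathcomp Require Import ring.
Import Order.TTheory GRing.Theory Num.Theory numFieldNormedType.Exports.

Set Implicit Arguments.
Unset Strict Implicit.
Unset Printing Implicit Defensive.

Local Open Scope quotient_scope.
Local Open Scope classical_set_scope.
Local Open Scope ring_scope.

Record bqf (A : Type) := BQF { bqf_r : A; bqf_s : A; bqf_t : A }.

Definition bqf_eval (A : comNzRingType) (Q : bqf A) (v : 'rV[A]_2) : A :=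
  bqf_r Q * v 0 0 ^+ 2 + bqf_s Q * v 0 0 * v 0 1 + bqf_t Q * v 0 1 ^+ 2.

Definition bqf_disc (A : comNzRingType) (Q : bqf A) : A :=
  bqf_s Q ^+ 2 - 4 * bqf_r Q * bqf_t Q.

(* The coefficients of the quadratic form given by the function f. *)
Definition bqf_of (A : zmodType) (f : int -> int -> A) : bqf A :=
  BQF (f 1 0) (f 1 1 - f 1 0 - f 0 1) (f 0 1).

Definition bqf_content (Q : bqf int) : int :=
  gcdz (bqf_r Q) (gcdz (bqf_s Q) (bqf_t Q)).

Definition bqf_primitive (Q : bqf int) : Prop := bqf_content Q = 1.

Definition bqf_primitive_part (Q : bqf int) : bqf int :=
  BQF (bqf_r Q %/ bqf_content Q)%Z (bqf_s Q %/ bqf_content Q)%Z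
      (bqf_t Q %/ bqf_content Q)%Z.

Definition bqf_indefinite (Q : bqf int) : Prop :=
  (exists v, 0 < bqf_eval Q v) /\ (exists v, bqf_eval Q v < 0).

(* SL_2(Z)-equivalence, for the action (g . Q)(x, y) = Q((x, y) g). *)
Definition bqf_equiv (Q Q' : bqf int) : Prop :=
  exists2 g : 'M[int]_2, \det g = 1 &
    forall v, bqf_eval Q' v = bqf_eval Q (v *m g).

Definition half_plane (R : realType) : set R[i]^o := [set z | 0 < complex.Im z].
Arguments half_plane R : clear implicits.

Definition mobius (R : realType) (g : 'M[int]_2) (z : R[i]) : R[i] :=
  ((g 0 0)%:~R * z + (g 0 1)%:~R) / ((g 1 0)%:~R * z + (g 1 1)%:~R).

Definition modular_rel (R : realType) (z w : set_type (half_plane R)) : bool :=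
  `[< exists2 g : 'M[int]_2, \det g = 1 & \val w = mobius g (\val z) >].

Section ModularRelation.
Variable R : realType.
Implicit Types (g h : 'M[int]_2) (z w : set_type (half_plane R)).

Lemma det_mx22E g : \det g = g 0 0 * g 1 1 - g 0 1 * g 1 0.
Proof.
rewrite (expand_det_row _ 0) !big_ord_recl big_ord0 addr0 /cofactor !det_mx11 !mxE.
rewrite /= expr0 mul1r expr1 mulN1r mulrN.
by congr (_ * g _ _ - g _ _ * g _ _); apply/val_inj.
Qed.

Lemma mobius_den_neq0 g z : \det g = 1 ->
  (g 1 0)%:~R * (\val z : R[i]) + (g 1 1)%:~R != 0.
Proof.
move=> dg; case: z => [[a b] zH] /=.
have b0 : 0 < b by move: zH; rewrite inE.
have castE (n : int) : n%:~R = (n%:~R : R)%:C%C by rewrite rmorph_int.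
rewrite !castE; apply/eqP => /eqP; rewrite eq_complex /= => /andP[/eqP h1 /eqP h2].
move: h1 h2; rewrite !mul0r !addr0 subr0 => h1 /eqP.
rewrite mulf_eq0 (gt_eqF b0) orbF intr_eq0 => /eqP c0.
move: h1; rewrite c0 mul0r add0r => /eqP; rewrite intr_eq0 => /eqP d0.
by move: dg; rewrite det_mx22E c0 d0 !mulr0 subr0.
Qed.

Lemma mobiusM g h z w : \det g = 1 -> \det h = 1 -> \val w = mobius h (\val z) ->
  mobius (g *m h) (\val z) = mobius g (\val w).
Proof.
move=> dg dh wz.
have D1 := mobius_den_neq0 z dh; have D2 := mobius_den_neq0 w dg.
have dgh : \det (g *m h) = 1 by rewrite det_mulmx dg dh mulr1.
have D3 := mobius_den_neq0 z dgh.
move: D2 D3; rewrite wz /mobius !mxE !big_ord_recl !big_ord0 !addr0.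
have -> : lift ord0 (ord0 : 'I_1) = 1 :> 'I_2 by apply/val_inj.
rewrite !rmorphD !rmorphM /=.
move: (g 0 0)%:~R (g 0 1)%:~R (g 1 0)%:~R (g 1 1)%:~R D1.
move: (h 0 0)%:~R (h 0 1)%:~R (h 1 0)%:~R (h 1 1)%:~R.
move=> a b c d e f k l D1 D2 D3.
field.
by apply/andP; split; [|apply: contra D3 => /eqP E; apply/eqP; rewrite -[RHS]E; ring].
Qed.

Lemma mobius1 (x : R[i]) : mobius 1%:M x = x.
Proof. by rewrite /mobius !mxE /= mul1r mul0r addr0 add0r divr1. Qed.

Lemma modular_rel_refl : reflexive (@modular_rel R).
Proof. by move=> z; apply/asboolP; exists 1%:M; rewrite ?det1 ?mobius1. Qed.

Lemma modular_rel_sym : symmetric (@modular_rel R).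
Proof.
suff sub z w : modular_rel z w -> modular_rel w z.
  by move=> z w; apply/idP/idP; exact: sub.
move=> /asboolP[g dg wz]; apply/asboolP; exists (\adj g).
  by rewrite -[LHS]mulr1 -[X in _ * X]dg -det_mulmx mul_adj_mx dg det1.
rewrite -(@mobiusM _ g z) ?mul_adj_mx ?dg ?mobius1//.
by rewrite -[LHS]mulr1 -[X in _ * X]dg -det_mulmx mul_adj_mx dg det1.
Qed.

Lemma modular_rel_trans : transitive (@modular_rel R).
Proof.
move=> y x z /asboolP[g dg yx] /asboolP[h dh zy]; apply/asboolP.
exists (h *m g); first by rewrite det_mulmx dg dh mulr1.
by rewrite (mobiusM dh dg yx).
Qed.

End ModularRelation.

Canonical modular_equiv (R : realType) : equiv_rel (set_type (half_plane R)) :=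
  EquivRel (@modular_rel R) (@modular_rel_refl R) (@modular_rel_sym R)
    (@modular_rel_trans R).

Definition modular_surface (R : realType) : topologicalType :=
  quotient_topology {eq_quot (modular_equiv R)}.

Lemma half_plane_i (R : realType) : (Complex 0 1 : R[i]^o) \in half_plane R.
Proof. by rewrite inE /half_plane /= ltr01. Qed.

(* The class of z in SL_2(Z)\H; junk (the class of i) if z is not in H. *)
Definition modular_class (R : realType) (z : R[i]) : modular_surface R :=
  \pi_(quotient_topology {eq_quot (modular_equiv R)})
    (insubd (SigSub (half_plane_i R) : set_type (half_plane R)) z).

(* For Q positive definite, z(Q) is the point of H with
   Q(x, y) = r (x + z y) (x + conj(z) y). *)
Definition bqf_point (R : realType) (Q : bqf R) : R[i] :=
  Complex (bqf_s Q / (2 * bqf_r Q))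
    (Num.sqrt (4 * bqf_r Q * bqf_t Q - bqf_s Q ^+ 2) / (2 * bqf_r Q)).

(* For a < b, the geodesic of H from a (at t = -oo) to b (at t = +oo),
   parametrized by hyperbolic arc length: the image of t |-> i e^t under the
   Moebius map w |-> (b w + a) / (w + 1), whose determinant is b - a > 0. *)
Definition geodesic (R : realType) (a b t : R) : R[i] :=
  Complex a (b * expR t) / Complex 1 (expR t).

(* gamma_Q, parametrized by arc length. Its endpoints are the reals theta with
   Q(x, y) = r (x + theta y) (x + theta' y), so that forms are factored as in
   [bqf_point]; a zero [u : v] of Q is thus sent to - u / v. With u / v instead,
   shapes of rings with trace form Q would lie on the image of this geodesic
   under z |-> - conj(z), which in SL_2(Z)\H differs in general from gamma_Q
   (for instance for Q = 3 x^2 + 2 x y - 26 y^2).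
   If the discriminant is positive and not a square then r != 0, so that both
   endpoints are indeed real numbers. *)
Definition gamma (R : realType) (Q : bqf int) (t : R) : R[i] :=
  let r := (bqf_r Q)%:~R in
  let c := (bqf_s Q)%:~R / (2 * r) in
  let rho := Num.sqrt (bqf_disc Q)%:~R / (2 * `|r|) in
  geodesic (c - rho) (c + rho) t.

Definition gamma_class (R : realType) (Q : bqf int) : set (modular_surface R) :=
  [set modular_class (gamma Q t) | t in [set: R]].
Arguments gamma_class : clear implicits.

(* The length of the closed geodesic: the least l > 0 such that translation by
   l along gamma_Q is induced by an element of SL_2(Z). *)
Definition gamma_period (R : realType) (Q : bqf int) : R :=
  inf [set l : R | 0 < l /\ exists2 g : 'M[int]_2, \det g = 1 &
                     forall t : R, gamma Q (t + l) = mobius g (gamma Q t)].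

(* Arc length on [gamma_Q]_1: the push-forward of arc length on one period of
   gamma_Q. (If some element of SL_2(Z) reverses gamma_Q, its image is run
   through twice in one period, so that mu_Q is twice the arc length of subsets
   of the image; this constant cancels in ratios.) *)
Definition mu (R : realType) (Q : bqf int) (W : set (modular_surface R)) : \bar R :=
  lebesgue_measure
    [set t : R | 0 <= t < gamma_period R Q /\ W (modular_class (gamma Q t))].

(* The boundary is taken in the subspace G: in SL_2(Z)\H, [gamma_Q]_1 is closed
   with empty interior, so that W itself would lie in its own boundary. *)
Definition rel_boundary (T : topologicalType) (G W : set T) : set T :=
  closure W `&` closure (G `\` W) `&` G.

(* The Borel subsets of [gamma_Q]_1 are the Borel subsets of SL_2(Z)\H that it
   contains, as it is closed. *)
Definition continuity_set (R : realType) (Q : bqf int)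
    (W : set (modular_surface R)) : Prop :=
  [/\ W `<=` gamma_class R Q, <<s [set U | open U] >> W &
      mu Q (rel_boundary (gamma_class R Q) W) = 0%E].

Definition Zbasis (A : zmodType) (b : 'I_3 -> A) : Prop :=
  forall x, exists! c : 'rV[int]_3, x = \sum_i b i *~ c 0 i.

(* Alternating trilinear maps A^3 -> Z, i.e., linear maps from the third
   exterior power of A to Z. *)
Record alternating_trilinear (A : zmodType) (d : A -> A -> A -> int) : Prop := {
  alt_add1 : forall x x' y z, d (x + x') y z = d x y z + d x' y z;
  alt_add2 : forall x y y' z, d x (y + y') z = d x y z + d x y' z;
  alt_add3 : forall x y z z', d x y (z + z') = d x y z + d x y z';
  alt_12 : forall x y, d x x y = 0;
  alt_13 : forall x y, d x y x = 0;
  alt_23 : forall x y, d y x x = 0 }.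

(* The third exterior power of a free module of rank 3 is free of rank 1, hence
   a linear map from it to Z is an isomorphism iff it takes the value 1. *)
Record oriented_cubic_ring := OrientedCubicRing {
  cubic_ring :> comNzRingType;
  cubic_ring_free : exists b : 'I_3 -> cubic_ring, Zbasis b;
  orientation : cubic_ring -> cubic_ring -> cubic_ring -> int;
  orientation_alt : alternating_trilinear orientation;
  orientation_iso : exists x y z, orientation x y z = 1 }.

Definition oriented_isomorphic (A B : oriented_cubic_ring) : Prop :=
  exists2 f : {rmorphism A -> B}, bijective f &
    forall x y z, orientation (f x) (f y) (f z) = orientation x y z.

Section Basis.
Variables (A : comNzRingType) (b : 'I_3 -> A).

(* The matrix of multiplication by x in the Z-basis b. *)
Definition mul_matrix (x : A) : 'M[int]_3 :=
  xget 0 [set m : 'M[int]_3 | forall i, b i * x = \sum_j b j *~ m i j].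

Definition trace (x : A) : int := \tr (mul_matrix x).

Definition ring_disc : int := \det (\matrix_(i, j) trace (b i * b j)).

Definition perp (x : A) : A := x *+ 3 - (trace x)%:~R.

Definition perp_comb (x y : int) : A := perp (b 1) *~ x + perp (b 2) *~ y.

Definition trace_form : bqf int :=
  bqf_of (fun x y => trace (perp_comb x y ^+ 2)).

Definition minkowski_form (R : realType) (sigma : 'I_3 -> A -> R[i]) : bqf R :=
  bqf_of (fun x y =>
    \sum_i ComplexField.Normc.normc (sigma i (perp_comb x y)) ^+ 2).

End Basis.

(* A is identified by [cc_incl] with an order in the complex cubic field
   [cc_field]: it has rank 3, so that injectivity suffices. A field of degree 3
   over Q has exactly 3 complex embeddings, so [cc_emb] lists them all. *)
Record complex_cubic_order (R : realType) (A : oriented_cubic_ring) := {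
  cc_field : fieldExtType rat;
  cc_dim : \dim {: cc_field} = 3%N;
  cc_incl : {rmorphism A -> cc_field};
  cc_incl_inj : injective cc_incl;
  cc_emb : 'I_3 -> {rmorphism cc_field -> R[i]};
  cc_emb_distinct : forall i j, cc_emb i =1 cc_emb j -> i = j;
  cc_emb_real : forall x, complex.Im (cc_emb 0 x) = 0;
  cc_emb_complex : forall i, i != 0 -> exists x, complex.Im (cc_emb i x) != 0;
  cc_basis : 'I_3 -> A;
  cc_basisP : Zbasis cc_basis;
  cc_basis0 : cc_basis 0 = 1;
  cc_basis_oriented :
    orientation (cc_basis 0) (cc_basis 1) (cc_basis 2) = 1 }.

Section Invariants.
Variables (R : realType) (A : oriented_cubic_ring) (D : complex_cubic_order R A).

Definition cc_disc : int := ring_disc (cc_basis D).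

Definition cc_trace_form : bqf int :=
  bqf_primitive_part (trace_form (cc_basis D)).

Definition cc_shape : modular_surface R :=
  modular_class (bqf_point
    (minkowski_form (cc_basis D) (fun i x => cc_emb D i (cc_incl D x)))).

End Invariants.

(* The number of classes of elements satisfying P for the equivalence relation
   E, with value 0 if there are infinitely many. (A limit 1 for W = [gamma_Q]_1
   rules this out for the counts below.) *)
Definition num_classes (T : Type) (E : T -> T -> Prop) (P : T -> Prop) : nat :=
  xget 0%N [set n : nat | exists s : 'I_n -> T,
    [/\ forall i, P (s i), forall i j, E (s i) (s j) -> i = j &
        forall x, P x -> exists i, E x (s i)]].

(* Discriminant, trace form and shape do not depend on the choices in D. *)
Definition N_rings (R : realType) (Q : bqf int) (X : R)
    (W : set (modular_surface R)) : nat :=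
  num_classes oriented_isomorphic (fun A : oriented_cubic_ring =>
    exists D : complex_cubic_order R A,
      [/\ bqf_equiv Q (cc_trace_form D), `|cc_disc D|%:~R < X & W (cc_shape D)]).

(* Main.v *)
(* Orders correspond to integral binary cubic forms f, the trace form being 6
   times the Hessian of f; so one counts classes of irreducible f with Hessian
   n Q, n > 0. These f are of the form A (x + th y)^3 + B (x + th' y)^3, where
   Q = r (x + th y)(x + th' y), and they fill a lattice of rank 2; by Cardano's
   formulas the shape of the order is the class of the point of gamma_Q at time
   log |B / A| / 3, where th < th'. SL_2(Z)-equivalence of
   such forms amounts to f |-> - f and to translations of the time by multiples
   of the period of gamma_Q, which is positive by Pell's equation. As n is
   quadratic in f, the forms with n < Y and time in an interval are the lattice
   points of a sector dilated by sqrt Y; in the coordinates (A, B) the density of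
   these sectors does not depend on the time, so that their number is
   asymptotically proportional to Y and to the length of the interval.
   The reducible forms are negligible: a rational zero (u, v) of f satisfies
   |Q(u, v)|^3 <= D^4 n, so that there are O(Y^(5/6)) of them. Finally a continuity
   set is approximated from inside and from outside by finite unions of
   intervals of time. *)
Require Import Defs.
From HB Require Import structures.
From mathcomp Require Import all_boot all_order all_algebra all_field.
From mathcomp Require Import complex generic_quotient.
From mathcomp Require Import all_classical all_reals all_analysis measurable_realfun.
From mathcomp Require Import ring lra zify.
Import Order.TTheory GRing.Theory Num.Theory numFieldNormedType.Exports.

Set Implicit Arguments.
Unset Strict Implicit.
Unset Printing Implicit Defensive.

Local Open Scope classical_set_scope.
Local Open Scope ring_scope.

(** * Binary cubic forms and cubic rings *)

(** That the Hessian of f be a multiple of [Q] is a linear condition on f ([apolar]), which is where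
    the lattice comes from. Times modulo the period p are represented in [p, 2p) and not in [0, p):
    the leading coefficient a vanishes only where the two cofactors agree, hence at time 0, so that
    on [p, 2p) and with a > 0 the forms of value below Y stay in a box of side O(sqrt Y), between
    lines of bounded slope. The sector of a short interval of times is caught between two triangles
    with vertex at the origin and the same sides; their points are counted row by row with error
    O(sqrt Y), and the ratio of the triangles tends to 1, uniformly on [p, 2p), as the interval
    shrinks. The number of intervals is therefore fixed before Y grows. The exponent 5/6 is 2/6 +
    3/6: each coordinate of a zero has O(Y^(1/6)) possible values, and a given zero belongs to at
    most one form in each of O(sqrt Y) rows. As [num_classes] is 0 for infinitely many classes, a
    count is always obtained from an explicit enumeration by a finite box. *)

Record bcf := BCF { bcf_a : int; bcf_b : int; bcf_c : int; bcf_d : int }.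

Definition bcf_eval (f : bcf) (x y : int) : int :=
  bcf_a f * x ^+ 3 + bcf_b f * x ^+ 2 * y + bcf_c f * x * y ^+ 2 + bcf_d f * y ^+ 3.

(* The form f(p x + u y, q x + v y). *)
Definition bcf_act (f : bcf) (p q u v : int) : bcf :=
  let: BCF a b c d := f in
  BCF (a * p ^+ 3 + b * p ^+ 2 * q + c * p * q ^+ 2 + d * q ^+ 3)
      (3 * a * p ^+ 2 * u + b * (p ^+ 2 * v + 2 * p * q * u)
       + c * (q ^+ 2 * u + 2 * p * q * v) + 3 * d * q ^+ 2 * v)
      (3 * a * p * u ^+ 2 + b * (q * u ^+ 2 + 2 * p * u * v)
       + c * (p * v ^+ 2 + 2 * q * u * v) + 3 * d * q * v ^+ 2)
      (a * u ^+ 3 + b * u ^+ 2 * v + c * u * v ^+ 2 + d * v ^+ 3).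

Definition hessian (f : bcf) : bqf int :=
  let: BCF a b c d := f in
  BQF (b ^+ 2 - 3 * a * c) (b * c - 9 * a * d) (c ^+ 2 - 3 * b * d).

Definition bcf_disc (f : bcf) : int :=
  let: BCF a b c d := f in
  b ^+ 2 * c ^+ 2 - 4 * a * c ^+ 3 - 4 * b ^+ 3 * d - 27 * a ^+ 2 * d ^+ 2
  + 18 * a * b * c * d.

Lemma bcf_act_eval f p q u v x y :
  bcf_eval (bcf_act f p q u v) x y = bcf_eval f (x * p + y * u) (x * q + y * v).
Proof. by case: f => a b c d; rewrite /bcf_eval /=; ring. Qed.

Lemma bcf_act_comp f p q u v p' q' u' v' :
  bcf_act (bcf_act f p q u v) p' q' u' v' =
  bcf_act f (p' * p + q' * u) (p' * q + q' * v) (u' * p + v' * u) (u' * q + v' * v).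
Proof. by case: f => a b c d; congr BCF; ring. Qed.

Lemma bcf_act1 f : bcf_act f 1 0 0 1 = f.
Proof. by case: f => a b c d; congr BCF; ring. Qed.

Lemma bcf_ext f g : (forall x y, bcf_eval f x y = bcf_eval g x y) -> f = g.
Proof.
case: f => a b c d; case: g => a' b' c' d' E.
have := E 1 0; have := E 0 1; have := E 1 1; have := E 1 (-1).
rewrite /bcf_eval /= => E1 E2 E3 E4.
congr BCF; lia.
Qed.

Lemma hessian_disc f : bqf_disc (hessian f) = - 3 * bcf_disc f.
Proof. by case: f => a b c d; rewrite /bqf_disc /=; ring. Qed.

Lemma bcf_disc_act f p q u v : p * v - q * u = 1 ->
  bcf_disc (bcf_act f p q u v) = bcf_disc f.
Proof.
move=> dt; rewrite -[RHS]mulr1 -(expr1n _ 6) -dt.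
case: f => a b c d; rewrite /=; ring.
Qed.

(** * Alternating maps as multiples of the determinant *)

Section Orientation.
Variables (A : comNzRingType) (d : A -> A -> A -> int).
Hypothesis dalt : alternating_trilinear d.

Lemma int_additiveMz (B : zmodType) (g : B -> int) (n : int) x :
  (forall x y, g (x + y) = g x + g y) -> g (x *~ n) = n * g x.
Proof.
move=> gD.
have gB : zmod_morphism g.
  have g0 : g 0 = 0 by apply: (addrI (g 0)); rewrite -gD !addr0.
  have gN z : g (- z) = - g z.
    by apply: (addrI (g z)); rewrite -gD subrr g0 subrr.
  by move=> y z; rewrite gD gN.
pose gm := GRing.isZmodMorphism.Build B int g gB.
pose h : {additive B -> int} := HB.pack g gm.
by rewrite -[g]/(h : B -> int) raddfMz /= -mulrzr mulrC intz.
Qed.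

Definition lin (w h : A) (x y z : int) : A := x%:~R + y%:~R * w + z%:~R * h.

(** Antisymmetry comes from polarizing the vanishing on equal arguments; what remains is the
    determinant of the three coordinate vectors. *)
Lemma orientation_lin w h x y z x' y' z' x2 y2 z2 :
  d (lin w h x y z) (lin w h x' y' z') (lin w h x2 y2 z2) =
  (x * (y' * z2 - z' * y2) - y * (x' * z2 - z' * x2) + z * (x' * y2 - y' * x2))
  * d 1 w h.
Proof.
have [D1 D2 D3 D12 D13 D23] := dalt.
have Z1 n p q r : d (p *~ n) q r = n * d p q r.
  by apply: (int_additiveMz (g := fun p => d p q r)).
have Z2 n p q r : d p (q *~ n) r = n * d p q r.
  by apply: (int_additiveMz (g := fun q => d p q r)).
have Z3 n p q r : d p q (r *~ n) = n * d p q r.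
  by apply: (int_additiveMz (g := fun r => d p q r)).
have S12 p q r : d q p r = - d p q r.
  have := D12 (p + q) r; rewrite D1 !D2 !D12; lia.
have S23 p q r : d p r q = - d p q r.
  have := D23 (q + r) p; rewrite D2 !D3 !D23; lia.
rewrite /lin !mulrzl !D1 !D2 !D3 !Z1 !Z2 !Z3 !D12 !D13 !D23.
have -> : d 1 h w = - d 1 w h by rewrite S23.
have -> : d w 1 h = - d 1 w h by rewrite S12.
have -> : d h 1 w = d 1 w h by rewrite S12 S23 opprK.
have -> : d w h 1 = d 1 w h by rewrite S23 S12 opprK.
have -> : d h w 1 = - d 1 w h by rewrite S12 S23 S12 !opprK.
ring.
Qed.

End Orientation.

(** The carrier is always Z^3; it takes the form as a parameter so that each form gets a ring
    structure of its own. *)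
Definition cubic_carrier (f : bcf) : Type := (int * int * int)%type.

Section CubicRing.
Variable f : bcf.
Local Notation T := (cubic_carrier f).
HB.instance Definition _ := Choice.copy T (int * int * int)%type.
HB.instance Definition _ := GRing.Zmodule.copy T (int * int * int)%type.

(** The multiplication of Delone and Faddeev in the basis 1, w, h: wh = -ad, w^2 = -ac + bw - ah,
    h^2 = -bd + dw - ch. *)
Definition cubic_mul (x y : T) : T :=
  let: BCF a b c d := f in
  let: (x0, x1, x2) := x in let: (y0, y1, y2) := y in
  (x0 * y0 - a * c * x1 * y1 - a * d * (x1 * y2 + x2 * y1) - b * d * x2 * y2,
   x0 * y1 + x1 * y0 + b * x1 * y1 + d * x2 * y2,
   x0 * y2 + x2 * y0 - a * x1 * y1 - c * x2 * y2).

Definition cubic_one : T := (1, 0, 0).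

Fact cubic_mulA : associative cubic_mul.
Proof.
move=> [[x0 x1] x2] [[y0 y1] y2] [[z0 z1] z2].
by rewrite /cubic_mul; case: (f) => a b c d; congr (_, _, _); ring.
Qed.

Fact cubic_mulC : commutative cubic_mul.
Proof.
move=> [[x0 x1] x2] [[y0 y1] y2].
by rewrite /cubic_mul; case: (f) => a b c d; congr (_, _, _); ring.
Qed.

Fact cubic_mul1 : left_id cubic_one cubic_mul.
Proof.
move=> [[x0 x1] x2]; rewrite /cubic_mul /cubic_one; case: (f) => a b c d.
by congr (_, _, _); ring.
Qed.

Fact cubic_mulDl : left_distributive cubic_mul +%R.
Proof.
move=> [[x0 x1] x2] [[y0 y1] y2] [[z0 z1] z2].
rewrite /cubic_mul /cubic_one; case: (f) => a b c d.
by congr (_, _, _); rewrite /=; ring.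
Qed.

Fact cubic_one_neq0 : cubic_one != 0 :> T.
Proof. by []. Qed.

HB.instance Definition _ := GRing.Zmodule_isComNzRing.Build T
  cubic_mulA cubic_mulC cubic_mul1 cubic_mulDl cubic_one_neq0.

Definition cubic_w : T := (0, 1, 0).
Definition cubic_h : T := (0, 0, 1).

Lemma cubic_carrier_int (n : int) : n%:~R = (n, 0, 0) :> T.
Proof.
have nat_case (m : nat) : m%:R = (m%:Z, 0, 0) :> T.
  elim: m => // m IHm; rewrite -addn1 natrD IHm.
  by congr (_, _, _); rewrite /= ?addr0 // PoszD.
case: n => m; first exact: nat_case.
rewrite NegzE mulrNz -pmulrn nat_case.
by congr (_, _, _); rewrite ?oppr0.
Qed.

Lemma cubic_linE (x y z : int) : lin cubic_w cubic_h x y z = (x, y, z) :> T.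
Proof.
rewrite /lin !cubic_carrier_int /cubic_w /cubic_h.
rewrite /GRing.mul /= /cubic_mul; case: (f) => a b c d.
by congr (_, _, _); rewrite /=; ring.
Qed.

Definition cubic_orientation (x y z : T) : int :=
  let: (x0, x1, x2) := x in let: (y0, y1, y2) := y in
  let: (z0, z1, z2) := z in
  x0 * (y1 * z2 - y2 * z1) - x1 * (y0 * z2 - y2 * z0)
  + x2 * (y0 * z1 - y1 * z0).

Lemma cubic_orientation_alt : alternating_trilinear cubic_orientation.
Proof.
split=> [[[? ?] ?] [[? ?] ?] [[? ?] ?] [[? ?] ?] | [[? ?] ?] [[? ?] ?] [[? ?] ?] [[? ?] ?] | [[? ?] ?] [[? ?] ?] [[? ?] ?] [[? ?] ?] | [[? ?] ?] [[? ?] ?] | [[? ?] ?] [[? ?] ?] | [[? ?] ?] [[? ?] ?]]; rewrite /cubic_orientation /=; ring.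
Qed.

End CubicRing.

Definition obasis (A : oriented_cubic_ring) (w h : A) : Prop :=
  [/\ forall t, exists x y z, t = lin w h x y z,
      forall x y z, lin w h x y z = 0 -> [/\ x = 0, y = 0 & z = 0]
    & orientation 1 w h = 1].

Definition table (f : bcf) (A : comNzRingType) (w h : A) : Prop :=
  [/\ w * h = (- (bcf_a f * bcf_d f))%:~R,
      w * w = lin w h (- (bcf_a f * bcf_c f)) (bcf_b f) (- bcf_a f)
    & h * h = lin w h (- (bcf_b f * bcf_d f)) (bcf_d f) (- bcf_c f)].

Definition triple (T : Type) (x y z : T) (i : 'I_3) : T :=
  if i == 0 then x else if i == 1 then y else z.

Lemma big_ord3 (A : nmodType) (F : 'I_3 -> A) :
  \sum_i F i = F 0 + F 1 + F (1 + 1).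
Proof.
rewrite !big_ord_recl big_ord0 addr0 addrA; congr (F _ + F _ + F _);
exact: val_inj.
Qed.

Lemma ord3P (P : 'I_3 -> Prop) : P 0 -> P 1 -> P (1 + 1) -> forall i, P i.
Proof.
move=> P0 P1 P2 [[|[|[|//]]] lti];
  [have -> : Ordinal lti = 0 | have -> : Ordinal lti = 1
  |have -> : Ordinal lti = 1 + 1] => //; exact: val_inj.
Qed.

Lemma Zbasis_triple (A : comNzRingType) (w h : A) :
  Zbasis (triple 1 w h) <->
  (forall t, exists x y z, t = lin w h x y z)
  /\ (forall x y z, lin w h x y z = 0 -> [/\ x = 0, y = 0 & z = 0]).
Proof.
have sumE (c : 'rV[int]_3) :
  \sum_i triple 1 w h i *~ c 0 i = lin w h (c 0 0) (c 0 1) (c 0 (1 + 1)).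
  by rewrite big_ord3 /triple /= /lin !mulrzl.
split=> [B | [S I]].
  split=> [t|x y z E].
    have [c [-> _]] := B t; rewrite sumE.
    by exists (c 0 0), (c 0 1), (c 0 (1 + 1)).
  have [c [_ cU]] := B 0.
  have c0 : c = 0.
    by apply: cU; rewrite big1 // => i _; rewrite mxE mulr0z.
  have := cU (\row_i triple x y z i).
  rewrite sumE !mxE /triple /= E c0 => /(_ erefl) /rowP H.
  by have := H 0; have := H 1; have := H (1 + 1); rewrite !mxE /triple /=.
move=> t; have [x [y [z ->]]] := S t.
exists (\row_i triple x y z i); split; first by rewrite sumE !mxE.
move=> c; rewrite sumE => E.
have : lin w h (x - c 0 0) (y - c 0 1) (z - c 0 (1 + 1)) = 0.
  have /eqP := E; rewrite -subr_eq0 => /eqP <-.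
  by rewrite /lin; ring.
move=> /I[/eqP + /eqP + /eqP]; rewrite !subr_eq0 => /eqP xE /eqP yE /eqP zE.
by apply/rowP; apply: ord3P; rewrite mxE /triple /=.
Qed.

Lemma cubic_obasis_span f (t : cubic_carrier f) :
  exists x y z, t = lin (cubic_w f) (cubic_h f) x y z.
Proof. by move: t => [[x y] z]; exists x, y, z; rewrite cubic_linE. Qed.

Lemma cubic_obasis_free f x y z :
  lin (cubic_w f) (cubic_h f) x y z = 0 -> [/\ x = 0, y = 0 & z = 0].
Proof. by rewrite cubic_linE => -[-> -> ->]. Qed.

Lemma cubic_Zbasis f : exists b : 'I_3 -> cubic_carrier f, Zbasis b.
Proof.
exists (triple 1 (cubic_w f) (cubic_h f)); apply/Zbasis_triple.
by split; [exact: cubic_obasis_span | exact: cubic_obasis_free].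
Qed.

Lemma cubic_orientation_iso f :
  exists x y z : cubic_carrier f, cubic_orientation x y z = 1.
Proof. by exists 1, (cubic_w f), (cubic_h f). Qed.

Definition ring_of_form (f : bcf) : oriented_cubic_ring :=
  OrientedCubicRing (cubic_Zbasis f) (cubic_orientation_alt f)
    (cubic_orientation_iso f).

Definition has_form (A : oriented_cubic_ring) (f : bcf) : Prop :=
  exists w h : A, obasis w h /\ table f w h.

Lemma ring_of_form_obasis f :
  @obasis (ring_of_form f) (cubic_w f) (cubic_h f).
Proof. by split; [exact: cubic_obasis_span | exact: cubic_obasis_free |]. Qed.

Lemma ring_of_form_table f : @table f (ring_of_form f) (cubic_w f) (cubic_h f).
Proof.
split; rewrite ?cubic_linE ?cubic_carrier_int -[LHS]/(cubic_mul _ _) /cubic_mul;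
  case: (f) => a b c d; rewrite /cubic_w /cubic_h /=; congr (_, _, _); ring.
Qed.

Lemma ring_of_form_has_form f : has_form (ring_of_form f) f.
Proof.
by exists (cubic_w f), (cubic_h f); split;
  [exact: ring_of_form_obasis | exact: ring_of_form_table].
Qed.

Lemma linB (A : comNzRingType) (w h : A) x y z x' y' z' :
  lin w h x y z - lin w h x' y' z' = lin w h (x - x') (y - y') (z - z').
Proof. rewrite /lin; ring. Qed.

Lemma lin_lin (A : comNzRingType) (w h : A) k p q l u v x y z :
  lin (lin w h k p q) (lin w h l u v) x y z =
  lin w h (x + y * k + z * l) (y * p + z * u) (y * q + z * v).
Proof. rewrite /lin; ring. Qed.

Lemma lin100 (A : comNzRingType) (w h : A) : lin w h 1 0 0 = 1.
Proof. rewrite /lin; ring. Qed.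

Lemma lin_inj (A : oriented_cubic_ring) (w h : A) x y z x' y' z' :
  obasis w h -> lin w h x y z = lin w h x' y' z' -> [/\ x = x', y = y' & z = z'].
Proof.
move=> [_ I _] /eqP; rewrite -subr_eq0 linB => /eqP/I[/eqP + /eqP + /eqP].
by rewrite !subr_eq0 => /eqP-> /eqP-> /eqP->.
Qed.

Lemma lin_mul f (A : comNzRingType) (w h : A) x y z x' y' z' : table f w h ->
  lin w h x y z * lin w h x' y' z' =
  lin w h (x * x' - bcf_a f * bcf_c f * y * y' - bcf_a f * bcf_d f * (y * z' + z * y')
            - bcf_b f * bcf_d f * z * z')
          (x * y' + y * x' + bcf_b f * y * y' + bcf_d f * z * z')
          (x * z' + z * x' - bcf_a f * y * y' - bcf_c f * z * z').
Proof.
case: f => a b c d [/= wh ww hh].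
have -> : lin w h x y z * lin w h x' y' z' =
  (x * x')%:~R + (x * y' + y * x')%:~R * w + (x * z' + z * x')%:~R * h
  + (y * y')%:~R * (w * w) + (y * z' + z * y')%:~R * (w * h)
  + (z * z')%:~R * (h * h) by rewrite /lin; ring.
rewrite wh ww hh /lin; ring.
Qed.

(* The index form of a cubic ring is the form of its multiplication table. *)
Lemma table_eval (A : oriented_cubic_ring) f (w h : A) m x y :
  obasis w h -> table f w h ->
  orientation 1 (lin w h m x y) (lin w h m x y * lin w h m x y) = - bcf_eval f x y.
Proof.
move=> [_ _ o1] tb; rewrite (lin_mul _ _ _ _ _ _ tb) -{1}(lin100 w h).
rewrite (orientation_lin (orientation_alt A)) o1.
by case: f tb => a b c d _; rewrite /bcf_eval /=; ring.
Qed.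

Lemma obasis_change (A : oriented_cubic_ring) (w h : A) k p q l u v :
  obasis w h -> p * v - q * u = 1 -> obasis (lin w h k p q) (lin w h l u v).
Proof.
move=> [S I o1] dt; split=> [t|x y z|].
- have [x [y [z ->]]] := S t.
  exists (x - (y * v - z * u) * k - (z * p - y * q) * l), (y * v - z * u), (z * p - y * q).
  rewrite lin_lin; congr lin.
  + ring.
  + by rewrite -[LHS]mulr1 -dt; ring.
  + by rewrite -[LHS]mulr1 -dt; ring.
- rewrite lin_lin => /I[xE yE zE].
  have y0 : y = 0.
    rewrite -[LHS]mulr1 -dt.
    have -> : y * (p * v - q * u) = (y * p + z * u) * v - (y * q + z * v) * u by ring.
    by rewrite yE zE !mul0r subr0.
  have z0 : z = 0.
    rewrite -[LHS]mulr1 -dt.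
    have -> : z * (p * v - q * u) = (y * q + z * v) * p - (y * p + z * u) * q by ring.
    by rewrite yE zE !mul0r subr0.
  by split => //; move: xE; rewrite y0 z0 !mul0r !addr0.
- rewrite -(lin100 w h) (orientation_lin (orientation_alt A)) o1 mulr1 -[RHS]dt.
  ring.
Qed.

(** The index form sends t to [orientation 1 t (t * t)], up to sign; it ignores the integers k and l
    and determines the form by [bcf_ext]. Comparing it in the two bases replaces a computation with
    structure constants. *)
Lemma table_change (A : oriented_cubic_ring) f f' (w h : A) k p q l u v :
  obasis w h -> table f w h -> p * v - q * u = 1 ->
  table f' (lin w h k p q) (lin w h l u v) -> f' = bcf_act f p q u v.
Proof.
move=> ob tb dt tb'; apply: bcf_ext => x y.
apply: oppr_inj; rewrite -(table_eval 0 x y (obasis_change k l ob dt) tb').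
rewrite lin_lin (table_eval _ _ _ ob tb) bcf_act_eval.
by congr (- bcf_eval _ _ _); ring.
Qed.

(** Translating w and h by integers kills the coefficients of w and h in wh. Associativity of the
    products wwh and whh then expresses the remaining constants by four of them, which are the
    coefficients of f up to sign. *)
Lemma obasis_table (A : oriented_cubic_ring) (w h : A) : obasis w h ->
  exists f k l, table f (w - k%:~R) (h - l%:~R).
Proof.
move=> ob; have [S I o1] := ob.
have [q0 [q1 [q2 E]]] := S (w * h).
pose k := q2; pose l := q1.
pose w' := w - k%:~R; pose h' := h - l%:~R.
have [w'E h'E] : w' = lin w h (- k) 1 0 /\ h' = lin w h (- l) 0 1.
  by rewrite /w' /h' /lin; split; ring.
have ob' : obasis w' h' by rewrite w'E h'E; apply: obasis_change.
have [S' I' _] := ob'.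
pose n := q0 + k * l.
have wh : w' * h' = n%:~R.
  have -> : w' * h' = w * h - l%:~R * w - k%:~R * h + (k * l)%:~R by rewrite /w' /h'; ring.
  by rewrite E /n /k /l /lin; ring.
have [p0 [p1 [p2 ww]]] := S' (w' * w').
have [s0 [s1 [s2 hh]]] := S' (h' * h').
have e1 : (w' * w') * h' = w' * (w' * h') by rewrite mulrA.
have e2 : w' * (h' * h') = (w' * h') * h' by rewrite mulrA.
have {e1} : lin w' h' (p1 * n + p2 * s0) (p2 * s1) (p0 + p2 * s2) = lin w' h' 0 n 0.
  have -> : lin w' h' 0 n 0 = w' * (w' * h') by rewrite wh /lin; ring.
  rewrite -e1 ww.
  have -> : lin w' h' p0 p1 p2 * h' = p0%:~R * h' + p1%:~R * (w' * h') + p2%:~R * (h' * h').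
    by rewrite /lin; ring.
  by rewrite wh hh /lin; ring.
move=> /(lin_inj ob')[_ nE p0E].
have {e2} : lin w' h' (s1 * p0 + s2 * n) (s0 + s1 * p1) (s1 * p2) = lin w' h' 0 0 n.
  have -> : lin w' h' 0 0 n = (w' * h') * h' by rewrite wh /lin; ring.
  rewrite -e2 hh.
  have -> : w' * lin w' h' s0 s1 s2 = s0%:~R * w' + s1%:~R * (w' * w') + s2%:~R * (w' * h').
    by rewrite /lin; ring.
  by rewrite wh ww /lin; ring.
move=> /(lin_inj ob')[_ s0E _].
exists (BCF (- p2) p1 (- s2) s1), k, l; split => /=.
- by rewrite wh -nE; congr intmul; ring.
- by rewrite ww; congr lin; [move/eqP: p0E; rewrite addr_eq0 => /eqP->|]; ring.
- by rewrite hh; congr lin; [move/eqP: s0E; rewrite addr_eq0 => /eqP->|]; ring.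
Qed.

Lemma has_form_act (A : oriented_cubic_ring) f (w h : A) p q u v :
  obasis w h -> table f w h -> p * v - q * u = 1 ->
  exists k l, obasis (lin w h k p q) (lin w h l u v) /\
    table (bcf_act f p q u v) (lin w h k p q) (lin w h l u v).
Proof.
move=> ob tb dt.
have [f' [k [l tb']]] := obasis_table (obasis_change 0 0 ob dt).
have E x y j : lin w h 0 x y - j%:~R = lin w h (- j) x y by rewrite /lin; ring.
rewrite !E in tb'; exists (- k), (- l); split; first exact: obasis_change.
by rewrite -(table_change ob tb dt tb').
Qed.

Lemma has_form_equiv (A : oriented_cubic_ring) f f' :
  has_form A f -> has_form A f' ->
  exists p q u v, p * v - q * u = 1 /\ f' = bcf_act f p q u v.
Proof.
move=> [w [h [ob tb]]] [w' [h' [ob' tb']]].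
have [S I o1] := ob.
have [k [p [q wE]]] := S w'; have [l [u [v hE]]] := S h'.
have dt : p * v - q * u = 1.
  have [_ _ <-] := ob'; rewrite wE hE -(lin100 w h).
  by rewrite (orientation_lin (orientation_alt A)) o1; ring.
exists p, q, u, v; split => //.
by apply: (table_change ob tb dt (k := k) (l := l)); rewrite -wE -hE.
Qed.

Lemma has_form_iso (A B : oriented_cubic_ring) f :
  has_form A f -> has_form B f -> oriented_isomorphic A B.
Proof.
move=> [w [h [ob tb]]] [w' [h' [ob' tb']]].
have [S _ o1] := ob; have [S' _ o1'] := ob'.
have S3 t : exists c : int * int * int, t = lin w h c.1.1 c.1.2 c.2.
  by have [x [y [z ->]]] := S t; exists (x, y, z).
pose co t := projT1 (cid (S3 t)).
pose F t := lin w' h' (co t).1.1 (co t).1.2 (co t).2.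
have FE x y z : F (lin w h x y z) = lin w' h' x y z.
  rewrite /F; have := projT2 (cid (S3 (lin w h x y z))).
  by move=> /(lin_inj ob)[<- <- <-].
have FB : zmod_morphism F.
  move=> t1 t2; have [x [y [z ->]]] := S t1; have [x' [y' [z' ->]]] := S t2.
  by rewrite linB !FE linB.
have FM : monoid_morphism F.
  split; first by rewrite -(lin100 w h) FE lin100.
  move=> t1 t2; have [x [y [z ->]]] := S t1; have [x' [y' [z' ->]]] := S t2.
  by rewrite (lin_mul _ _ _ _ _ _ tb) !FE (lin_mul _ _ _ _ _ _ tb').
pose FA := GRing.isZmodMorphism.Build A B F FB.
pose FM' := GRing.isMonoidMorphism.Build A B F FM.
pose G : {rmorphism A -> B} := HB.pack F FA FM'.
exists G.
  have S3' t : exists c : int * int * int, t = lin w' h' c.1.1 c.1.2 c.2.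
    by have [x [y [z ->]]] := S' t; exists (x, y, z).
  pose co' t := projT1 (cid (S3' t)).
  exists (fun t => lin w h (co' t).1.1 (co' t).1.2 (co' t).2) => t.
    have [x [y [z ->]]] := S t; rewrite /= FE.
    by have := projT2 (cid (S3' (lin w' h' x y z))) => /(lin_inj ob')[<- <- <-].
  by rewrite /= FE; have <- := projT2 (cid (S3' t)).
move=> t1 t2 t3; have [x [y [z ->]]] := S t1; have [x' [y' [z' ->]]] := S t2.
have [x2 [y2 [z2 ->]]] := S t3.
rewrite /= !FE !(orientation_lin (orientation_alt _)) o1' -[X in _ * X]o1 //.
Qed.

Lemma iso_has_form (A B : oriented_cubic_ring) f :
  oriented_isomorphic A B -> has_form A f -> has_form B f.
Proof.
move=> [F Fbij Fo] [w [h [ob [wh ww hh]]]]; have [S I o1] := ob.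
have Flin x y z : F (lin w h x y z) = lin (F w) (F h) x y z.
  by rewrite /lin !rmorphD !rmorphM /= !rmorph_int.
exists (F w), (F h); split; split.
- move=> t; have [G FK GK] := Fbij.
  have [x [y [z E]]] := S (G t).
  by exists x, y, z; rewrite -Flin -E GK.
- move=> x y z; rewrite -Flin => F0; apply: I; apply: (bij_inj Fbij).
  by rewrite F0 rmorph0.
- by rewrite -(rmorph1 F) Fo.
- by rewrite -rmorphM wh rmorph_int.
- by rewrite -rmorphM ww Flin.
- by rewrite -rmorphM hh Flin.
Qed.

Lemma has_form_bcf_act (A : oriented_cubic_ring) f p q u v :
  has_form A f -> p * v - q * u = 1 -> has_form A (bcf_act f p q u v).
Proof.
move=> [w [h [ob tb]]] dt; have [k [l [ob' tb']]] := has_form_act ob tb dt.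
by do 2 eexists; split; [exact: ob' | exact: tb'].
Qed.

(** This stands in for the symmetry of [oriented_isomorphic] without building an inverse morphism: B
    carries both forms, so that these are equivalent under SL_2(Z). *)
Lemma iso_has_form_inv (A B : oriented_cubic_ring) f g :
  oriented_isomorphic A B -> has_form A g -> has_form B f -> has_form A f.
Proof.
move=> AB Ag Bf; have Bg := iso_has_form AB Ag.
have [p [q [u [v [dt ->]]]]] := has_form_equiv Bg Bf.
exact: has_form_bcf_act.
Qed.

(** [mul_matrix] is a choice made by [xget]; uniqueness of coordinates in a Z-basis shows that any
    matrix with the required property is the chosen one. *)
Lemma mul_matrixE (A : comNzRingType) (b : 'I_3 -> A) (x : A) (m : 'M[int]_3) :
  Zbasis b -> (forall i, b i * x = \sum_j b j *~ m i j) -> mul_matrix b x = m.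
Proof.
move=> B mE; rewrite /mul_matrix; case: xgetP => [m' _ m'E|/(_ m)//].
apply/matrixP => i j; have [c [_ cU]] := B (b i * x).
have R1 : row i m = row i m'.
  by rewrite -(cU (row i m)) ?(cU (row i m')) //;
    [rewrite m'E|rewrite mE]; apply: eq_bigr => k _; rewrite mxE.
by have /rowP/(_ j) := R1; rewrite !mxE.
Qed.

Lemma det_mx33E (m : 'M[int]_3) :
  \det m = m 0 0 * (m 1 1 * m 2 2 - m 1 2 * m 2 1)
         - m 0 1 * (m 1 0 * m 2 2 - m 1 2 * m 2 0)
         + m 0 2 * (m 1 0 * m 2 1 - m 1 1 * m 2 0).
Proof.
rewrite (expand_det_row _ 0) big_ord3 /cofactor !det_mx22E !mxE.
have E (i j : 'I_3) : val i = val j -> i = j by move=> ?; apply: val_inj.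
rewrite (E (lift 0 0) 1) // (E (lift 0 1) 2) //.
rewrite (E (lift 1 0) 0) // (E (lift 1 1) 2) //.
rewrite (E (lift (1 + 1) 0) 0) // (E (lift (1 + 1) 1) 1) //.
rewrite (E (1 + 1) 2) // /=.
rewrite !expr0 !expr1 expr2.
ring.
Qed.

(** * Traces, discriminants and the Hessian *)

Section TraceForm.
Variables (A : oriented_cubic_ring) (b : 'I_3 -> A) (f : bcf) (k l : int).
Hypotheses (bZ : Zbasis b) (b0 : b 0 = 1).
Let w : A := b 1 - k%:~R.
Let h : A := b 2 - l%:~R.
Hypothesis tb : table f w h.

Lemma trace_lin x y z : trace b (lin w h x y z) = 3 * x + bcf_b f * y - bcf_c f * z.
Proof.
(* These are the coordinates of x + y w + z h in the basis b, where b 1 = w + k and b 2 = h + l. *)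
pose row3 (x y z : int) : 'I_3 -> int := triple (x - k * y - l * z) y z.
have linE (x' y' z' : int) : \sum_j b j *~ row3 x' y' z' j = lin w h x' y' z'.
  rewrite big_ord3 /row3 /triple /= b0 -[1 + 1]/(2 : 'I_3) /lin /w /h; ring.
have b1E : b 1 = lin w h k 1 0 by rewrite /lin /w; ring.
have b2E : b 2 = lin w h l 0 1 by rewrite /lin /w /h; ring.
pose m : 'M[int]_3 := \matrix_(i, j)
  triple (row3 x y z j)
    (row3 (k * x - bcf_a f * bcf_c f * y - bcf_a f * bcf_d f * z)
     (k * y + x + bcf_b f * y) (k * z - bcf_a f * y) j)
    (row3 (l * x - bcf_a f * bcf_d f * y - bcf_b f * bcf_d f * z)
     (l * y + bcf_d f * z) (l * z + x - bcf_c f * z) j) i.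
rewrite /trace (@mul_matrixE _ b _ m) //.
  rewrite /mxtrace big_ord3 !mxE /row3 /triple /=; ring.
have mE i j : m i j = _ := mxE _ _ _ _.
apply: ord3P; under eq_bigr do rewrite mE /triple /=.
- by rewrite linE b0 mul1r.
- by rewrite linE b1E (lin_mul _ _ _ _ _ _ tb); congr lin; ring.
- rewrite linE -[1 + 1]/(2 : 'I_3) b2E (lin_mul _ _ _ _ _ _ tb); congr lin; ring.
Qed.

(** [perp] kills the integers, so that the translations by k and l drop out: the two basis vectors
    give 3w - b and 3h + c. *)
Lemma perp_comb_lin x y :
  perp_comb b x y = lin w h (- bcf_b f * x + bcf_c f * y) (3 * x) (3 * y).
Proof.
have b1E : b 1 = lin w h k 1 0 by rewrite /lin /w; ring.
have b2E : b 2 = lin w h l 0 1 by rewrite /lin /w /h; ring.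
rewrite /perp_comb /perp {2}b1E {2}b2E !trace_lin /w /h /lin; ring.
Qed.

Lemma trace_form_hessian :
  trace_form b = BQF (6 * bqf_r (hessian f)) (6 * bqf_s (hessian f))
    (6 * bqf_t (hessian f)).
Proof.
rewrite /trace_form /bqf_of !perp_comb_lin !expr2 !(lin_mul _ _ _ _ _ _ tb) !trace_lin.
by case: (f) => a b' c d /=; congr BQF; ring.
Qed.

Lemma ring_disc_form : ring_disc b = bcf_disc f.
Proof.
have b1E : b 1 = lin w h k 1 0 by rewrite /lin /w; ring.
have b2E : b 2 = lin w h l 0 1 by rewrite /lin /w /h; ring.
have b0E : b 0 = lin w h 1 0 0 by rewrite lin100.
rewrite /ring_disc det_mx33E !mxE b0E b1E b2E !(lin_mul _ _ _ _ _ _ tb) !trace_lin.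
by case: (f) => a b' c d /=; ring.
Qed.

End TraceForm.

Definition bqf_scale (n : int) (Q : bqf int) : bqf int :=
  BQF (n * bqf_r Q) (n * bqf_s Q) (n * bqf_t Q).

Lemma content_scale (n : int) (Q : bqf int) : 0 < n -> bqf_primitive Q ->
  bqf_content (bqf_scale n Q) = n.
Proof.
move=> n0 prQ; rewrite /bqf_content /=.
have nE : n = `|n|%:Z by rewrite gtz0_abs.
rewrite -mulz_gcdr -nE -mulz_gcdr -nE.
by move: prQ; rewrite /bqf_primitive /bqf_content => ->; rewrite mulr1.
Qed.

Lemma primitive_part_scale (n : int) (Q : bqf int) : 0 < n -> bqf_primitive Q ->
  bqf_primitive_part (bqf_scale n Q) = Q.
Proof.
move=> n0 prQ; rewrite /bqf_primitive_part content_scale //.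
have n0' : n != 0 by rewrite gt_eqF.
by case: Q prQ => r s t _ /=; rewrite !mulKz.
Qed.

Lemma content_primitive_part (T : bqf int) :
  T = bqf_scale (bqf_content T) (bqf_primitive_part T).
Proof.
case: T => r s t; rewrite /bqf_scale /bqf_primitive_part /= /bqf_content /=.
set g := gcdz r (gcdz s t).
have dr : (g %| r)%Z by exact: dvdz_gcdl.
have dst : (g %| gcdz s t)%Z by exact: dvdz_gcdr.
have ds : (g %| s)%Z := dvdz_trans dst (dvdz_gcdl _ _).
have dt : (g %| t)%Z := dvdz_trans dst (dvdz_gcdr _ _).
by congr BQF; rewrite mulrC divzK.
Qed.

Lemma content_ge0 (T : bqf int) : 0 <= bqf_content T.
Proof. by []. Qed.

Lemma primitive_bezout (Q : bqf int) : bqf_primitive Q ->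
  exists x y z, x * bqf_r Q + y * bqf_s Q + z * bqf_t Q = 1.
Proof.
move=> prQ.
have [u [v E]] := Bezoutz (bqf_s Q) (bqf_t Q).
have [x [y E']] := Bezoutz (bqf_r Q) (gcdz (bqf_s Q) (bqf_t Q)).
exists x, (y * u), (y * v); rewrite -[RHS]prQ /bqf_content -E' -E; ring.
Qed.

Definition bqf_ev (A : comNzRingType) (Q : bqf A) (x y : A) : A :=
  bqf_r Q * x ^+ 2 + bqf_s Q * x * y + bqf_t Q * y ^+ 2.

Lemma bqf_evalE (A : comNzRingType) (Q : bqf A) v :
  bqf_eval Q v = bqf_ev Q (v 0 0) (v 0 1).
Proof. by []. Qed.

Lemma bqf_ext (P Q : bqf int) : (forall x y, bqf_ev P x y = bqf_ev Q x y) -> P = Q.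
Proof.
case: P => r s t; case: Q => r' s' t' E.
have := E 1 0; have := E 0 1; have := E 1 1.
by rewrite /bqf_ev /= => E1 E2 E3; congr BQF; lia.
Qed.

Lemma hessian_act f p q u v x y : p * v - q * u = 1 ->
  bqf_ev (hessian (bcf_act f p q u v)) x y =
  bqf_ev (hessian f) (x * p + y * u) (x * q + y * v).
Proof.
move=> dt; rewrite -[RHS]mul1r -(expr1n _ 2) -dt.
by case: f => a b c d; rewrite /bqf_ev /=; ring.
Qed.

Lemma row2_evalE (g : 'M[int]_2) (v : 'rV[int]_2) :
  ((v *m g) 0 0 = v 0 0 * g 0 0 + v 0 1 * g 1 0) *
  ((v *m g) 0 1 = v 0 0 * g 0 1 + v 0 1 * g 1 1).
Proof.
have E : lift ord0 (ord0 : 'I_1) = 1 :> 'I_2 by apply/val_inj.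
by rewrite !mxE !big_ord_recl !big_ord0 !addr0 !E.
Qed.

Lemma bqf_equivP (Q Q' : bqf int) : bqf_equiv Q Q' <->
  exists p q u v, p * v - q * u = 1 /\
    forall x y, bqf_ev Q' x y = bqf_ev Q (x * p + y * u) (x * q + y * v).
Proof.
split=> [[g dg E] | [p [q [u [v [dt E]]]]]].
  exists (g 0 0), (g 0 1), (g 1 0), (g 1 1); split; first by rewrite -det_mx22E.
  move=> x y; have := E (\row_i if i == 0 then x else y).
  by rewrite !bqf_evalE !row2_evalE !mxE.
exists (\matrix_(i, j) if i == 0 then if j == 0 then p else q
                       else if j == 0 then u else v).
  by rewrite det_mx22E !mxE.
by move=> w; rewrite !bqf_evalE !row2_evalE !mxE E.
Qed.

(** After the inverse substitution, 6 times the Hessian is m Q, where m is the content. A Bezout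
    relation between the coefficients of the primitive form [Q] shows that 6 divides m; and m = 0
    would force Q = 0. *)
Lemma trace_form_equiv (Q : bqf int) f : bqf_primitive Q ->
  bqf_equiv Q (bqf_primitive_part (bqf_scale 6 (hessian f))) ->
  exists p q u v n, [/\ p * v - q * u = 1, 0 < n &
    hessian (bcf_act f p q u v) = bqf_scale n Q].
Proof.
move=> prQ /bqf_equivP[p [q [u [v [dt E]]]]].
set T := bqf_scale 6 (hessian f) in E.
have dt' : v * p - (- q) * (- u) = 1 by rewrite -dt; ring.
exists v, (- q), (- u), p.
set m := bqf_content T.
have HE x y : 6 * bqf_ev (hessian (bcf_act f v (- q) (- u) p)) x y = m * bqf_ev Q x y.
  rewrite hessian_act //.
  have T6 x' y' : 6 * bqf_ev (hessian f) x' y' = bqf_ev T x' y'.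
    by rewrite /T /bqf_ev /=; ring.
  rewrite T6 (content_primitive_part T) -/m.
  have -> x' y' : bqf_ev (bqf_scale m (bqf_primitive_part T)) x' y' =
      m * bqf_ev (bqf_primitive_part T) x' y' by rewrite /bqf_ev /=; ring.
  rewrite E; congr (m * bqf_ev _ _ _).
  - by rewrite -[RHS]mulr1 -dt; ring.
  - by rewrite -[RHS]mulr1 -dt; ring.
set H := hessian _ in HE *.
have ev10 P : bqf_ev P 1 0 = bqf_r P :> int by rewrite /bqf_ev; ring.
have ev01 P : bqf_ev P 0 1 = bqf_t P :> int by rewrite /bqf_ev; ring.
have ev11 P : bqf_ev P 1 1 = bqf_r P + bqf_s P + bqf_t P :> int by rewrite /bqf_ev; ring.
have rE : 6 * bqf_r H = m * bqf_r Q by have := HE 1 0; rewrite !ev10.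
have tE : 6 * bqf_t H = m * bqf_t Q by have := HE 0 1; rewrite !ev01.
have sE : 6 * bqf_s H = m * bqf_s Q.
  have := HE 1 1; rewrite !ev11 !mulrDr rE tE => /addIr.
  by rewrite [RHS]addrC [LHS]addrC; move=> /addIr.
have [x [y [z bz]]] := primitive_bezout prQ.
pose n := x * bqf_r H + y * bqf_s H + z * bqf_t H.
have m6 : m = 6 * n.
  transitivity (m * (x * bqf_r Q + y * bqf_s Q + z * bqf_t Q)).
    by rewrite bz mulr1.
  rewrite /n.
  have -> : m * (x * bqf_r Q + y * bqf_s Q + z * bqf_t Q)
    = x * (m * bqf_r Q) + y * (m * bqf_s Q) + z * (m * bqf_t Q) by ring.
  by rewrite -rE -sE -tE; ring.
have m0 : 0 <= m by exact: content_ge0.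
have mn0 : m != 0.
  apply/eqP => m0'; have T0 : T = BQF 0 0 0.
    rewrite (content_primitive_part T) -/m m0' /bqf_scale !mul0r //.
  have Q0 x' y' : bqf_ev Q x' y' = 0.
    pose x1 := x' * v + y' * (- u); pose y1 := x' * (- q) + y' * p.
    transitivity (bqf_ev Q (x1 * p + y1 * u) (x1 * q + y1 * v)).
      congr bqf_ev; rewrite /x1 /y1.
      - by rewrite -[LHS]mulr1 -dt; ring.
      - by rewrite -[LHS]mulr1 -dt; ring.
    by rewrite -E T0 /bqf_ev /= !mul0r !addr0.
  have : Q = BQF 0 0 0 by apply: bqf_ext => x' y'; rewrite Q0 /bqf_ev /=; ring.
  by move=> QE; move: prQ; rewrite QE.
exists n; split; first by rewrite -dt; ring.
  by lia.
by move: rE sE tE; rewrite m6 /bqf_scale; case: (H) => r' s' t' /= rE sE tE;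
  congr BQF; apply: (@mulfI _ (6 : int)) => //; [rewrite rE|rewrite sE|rewrite tE]; ring.
Qed.

(** * Roots of Q and the time of a form *)

Lemma nonsquare_lead_neq0 (Q : bqf int) :
  (forall n : int, bqf_disc Q <> n ^+ 2) -> bqf_r Q != 0.
Proof.
move=> sqQ; apply/eqP => r0; apply: (sqQ (bqf_s Q)).
by rewrite /bqf_disc r0 mulr0 mul0r subr0.
Qed.

Lemma indefinite_disc_gt0 (Q : bqf int) : bqf_indefinite Q -> bqf_r Q != 0 ->
  0 < bqf_disc Q.
Proof.
move=> [[v vP] [w wP]] r0; rewrite ltNge; apply/negP => D0.
have sq x y : 0 <= bqf_r Q * bqf_ev Q x y.
  have E : 4 * (bqf_r Q * bqf_ev Q x y) =
      (2 * bqf_r Q * x + bqf_s Q * y) ^+ 2 + - bqf_disc Q * y ^+ 2.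
    by rewrite /bqf_ev /bqf_disc; ring.
  have : 0 <= 4 * (bqf_r Q * bqf_ev Q x y).
    by rewrite E addr_ge0 ?sqr_ge0// mulr_ge0 ?sqr_ge0// oppr_ge0.
  by rewrite pmulr_rge0.
move: vP wP; rewrite !bqf_evalE => vP wP.
have := sq (v 0 0) (v 0 1); have := sq (w 0 0) (w 0 1).
case: (ltgtP (bqf_r Q) 0) r0 => // r0 _.
  by rewrite (nmulr_rge0 _ r0) => _; rewrite (nmulr_rge0 _ r0) leNgt vP.
by rewrite (pmulr_rge0 _ r0) leNgt wP.
Qed.

(** The endpoints of [gamma], in the sense Q = r (x + th1 y) (x + th2 y). The absolute value in the
    denominator orders them for either sign of r. *)
Definition bqf_root1 (R : realType) (Q : bqf int) : R :=
  (bqf_s Q)%:~R / (2 * (bqf_r Q)%:~R)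
  - Num.sqrt (bqf_disc Q)%:~R / (2 * `|(bqf_r Q)%:~R|).

Definition bqf_root2 (R : realType) (Q : bqf int) : R :=
  (bqf_s Q)%:~R / (2 * (bqf_r Q)%:~R)
  + Num.sqrt (bqf_disc Q)%:~R / (2 * `|(bqf_r Q)%:~R|).

Lemma gammaE (R : realType) (Q : bqf int) (t : R) :
  gamma Q t = geodesic (bqf_root1 R Q) (bqf_root2 R Q) t.
Proof. by []. Qed.

(** If f is apolar to [Q], then 3 (th2 - th1) f = cf1 (x + th2 y)^3 - cf2 (x + th1 y)^3: the value
    formed with one root is the coefficient of the cube belonging to the other. *)
Definition cofactor1 (R : realType) (Q : bqf int) (f : bcf) : R :=
  (bcf_b f)%:~R - 3 * (bcf_a f)%:~R * bqf_root1 R Q.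

Definition cofactor2 (R : realType) (Q : bqf int) (f : bcf) : R :=
  (bcf_b f)%:~R - 3 * (bcf_a f)%:~R * bqf_root2 R Q.

Definition form_time (R : realType) (Q : bqf int) (f : bcf) : R :=
  ln `|cofactor1 R Q f / cofactor2 R Q f| / 3.

Section Geometry.
Variables (R : realType) (Q : bqf int).
Hypotheses (Q_primitive : bqf_primitive Q).
Hypotheses (r_neq0 : bqf_r Q != 0) (D_gt0 : 0 < bqf_disc Q).

Local Notation r := ((bqf_r Q)%:~R : R).
Local Notation s := ((bqf_s Q)%:~R : R).
Local Notation t := ((bqf_t Q)%:~R : R).
Local Notation th1 := (bqf_root1 R Q).
Local Notation th2 := (bqf_root2 R Q).

Let rR_neq0 : r != 0. Proof. by rewrite intr_eq0. Qed.

Lemma root_lt : th1 < th2.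
Proof.
rewrite /bqf_root1 /bqf_root2 -subr_gt0.
set c := s / _; set rho := _ / _.
have rho0 : 0 < rho.
  by rewrite divr_gt0 ?sqrtr_gt0 ?ltr0z// mulr_gt0 ?normr_gt0.
by lra.
Qed.

Lemma root_diff : (th2 - th1) ^+ 2 * r ^+ 2 = (bqf_disc Q)%:~R.
Proof.
have -> : th2 - th1 = Num.sqrt (bqf_disc Q)%:~R / `|r|.
  by rewrite /bqf_root1 /bqf_root2; field; rewrite ?normr_eq0 rR_neq0.
rewrite exprMn sqr_sqrtr ?ler0z ?(ltW D_gt0)// exprVn real_normK ?num_real//.
by rewrite divfK ?expf_neq0//.
Qed.

Lemma root_sum : r * (th1 + th2) = s.
Proof. by rewrite /bqf_root1 /bqf_root2; field; rewrite ?normr_eq0 rR_neq0. Qed.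

Lemma root_prod : r * (th1 * th2) = t.
Proof.
have E : 4 * (th1 * th2) = (th1 + th2) ^+ 2 - (th2 - th1) ^+ 2 by ring.
have r4 : 4 * r != 0 by rewrite mulf_neq0 // pnatr_eq0.
apply: (mulfI r4).
have -> : 4 * r * (r * (th1 * th2)) = r ^+ 2 * (4 * (th1 * th2)) by ring.
rewrite E.
have -> : r ^+ 2 * ((th1 + th2) ^+ 2 - (th2 - th1) ^+ 2) =
  (r * (th1 + th2)) ^+ 2 - (th2 - th1) ^+ 2 * r ^+ 2 by ring.
by rewrite root_diff root_sum /bqf_disc; ring.
Qed.

Lemma bqf_ev_factor (x y : int) : (bqf_ev Q x y)%:~R =
  r * (x%:~R + th1 * y%:~R) * (x%:~R + th2 * y%:~R).
Proof.
have -> : (bqf_ev Q x y)%:~R = r * x%:~R ^+ 2 + s * x%:~R * y%:~R + t * y%:~R ^+ 2.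
  by rewrite /bqf_ev; ring.
by rewrite -root_sum -root_prod; ring.
Qed.

(** The sequence 3a, b, c, 3d satisfies the recurrence r u'' = s u' - t u, whose characteristic
    roots are th1 and th2. Solving the recurrence gives [apolar_coefs]. *)
Definition apolar (f : bcf) : Prop :=
  bqf_r Q * bcf_c f = bqf_s Q * bcf_b f - 3 * bqf_t Q * bcf_a f /\
  3 * bqf_r Q * bcf_d f = bqf_s Q * bcf_c f - bqf_t Q * bcf_b f.

(** Every cubic form is apolar to its own Hessian, identically in a, b, c, d; the factor n is then
    cancelled. *)
Lemma hessian_apolar f n : n != 0 -> hessian f = bqf_scale n Q -> apolar f.
Proof.
move=> n0; case: f => a b c d [/= rE sE tE].
split; apply: (mulfI n0) => /=.
- have -> : n * (bqf_r Q * c) = (n * bqf_r Q) * c by ring.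
  have -> : n * (bqf_s Q * b - 3 * bqf_t Q * a) =
    (n * bqf_s Q) * b - 3 * (n * bqf_t Q) * a by ring.
  by rewrite -rE -sE -tE; ring.
- have -> : n * (3 * bqf_r Q * d) = 3 * (n * bqf_r Q) * d by ring.
  have -> : n * (bqf_s Q * c - bqf_t Q * b) =
    (n * bqf_s Q) * c - (n * bqf_t Q) * b by ring.
  by rewrite -rE -sE -tE; ring.
Qed.

(** The relations [e3] and [e4] make the Hessian proportional to [Q] over the rationals; primitivity
    of [Q] makes the ratio an integer, of any sign. *)
Lemma apolar_hessian f : apolar f -> exists n, hessian f = bqf_scale n Q.
Proof.
move=> [e1 e2]; set H := hessian f.
case: f @H e1 e2 => a b c d H /= e1 e2.
have e3 : bqf_r Q * bqf_s H = bqf_s Q * bqf_r H.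
  rewrite /H /=.
  have -> : bqf_r Q * (b * c - 9 * a * d) =
    b * (bqf_r Q * c) - 3 * a * (3 * bqf_r Q * d) by ring.
  by rewrite e2 e1; ring.
have e4 : bqf_r Q * bqf_t H = bqf_t Q * bqf_r H.
  rewrite /H /=.
  have -> : bqf_r Q * (c ^+ 2 - 3 * b * d) =
    c * (bqf_r Q * c) - b * (3 * bqf_r Q * d) by ring.
  by rewrite e2 e1; ring.
have [x [y [z bz]]] := primitive_bezout Q_primitive.
pose n := x * bqf_r H + y * bqf_s H + z * bqf_t H.
have nE : n * bqf_r Q = bqf_r H.
  transitivity (bqf_r H * (x * bqf_r Q + y * bqf_s Q + z * bqf_t Q)).
    rewrite /n.
    have -> : (x * bqf_r H + y * bqf_s H + z * bqf_t H) * bqf_r Q =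
      x * bqf_r H * bqf_r Q + y * (bqf_r Q * bqf_s H) + z * (bqf_r Q * bqf_t H) by ring.
    by rewrite e3 e4; ring.
  by rewrite bz mulr1.
exists n; rewrite /bqf_scale nE.
have -> : n * bqf_s Q = bqf_s H.
  by apply: (mulfI r_neq0); rewrite e3 -nE; ring.
have -> : n * bqf_t Q = bqf_t H.
  by apply: (mulfI r_neq0); rewrite e4 -nE; ring.
by case: (H).
Qed.

Local Notation cf1 := (cofactor1 R Q).
Local Notation cf2 := (cofactor2 R Q).

Lemma apolar_coefs f : apolar f ->
  [/\ (bcf_a f)%:~R = (cf1 f - cf2 f) / (3 * (th2 - th1)),
      (bcf_b f)%:~R = (th2 * cf1 f - th1 * cf2 f) / (th2 - th1),
      (bcf_c f)%:~R = (th2 ^+ 2 * cf1 f - th1 ^+ 2 * cf2 f) / (th2 - th1) &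
      (bcf_d f)%:~R = (th2 ^+ 3 * cf1 f - th1 ^+ 3 * cf2 f) / (3 * (th2 - th1))].
Proof.
case: f => a b c d [/= e1 e2]; rewrite /cofactor1 /cofactor2 /=.
have dth : th2 - th1 != 0 by rewrite subr_eq0 gt_eqF // root_lt.
have e1R : c%:~R = (th1 + th2) * b%:~R - 3 * (th1 * th2) * a%:~R.
  apply: (mulfI rR_neq0).
  have := congr1 (fun z => z%:~R : R) e1; rewrite /= rmorphM rmorphB /= !rmorphM /= => ->.
  by rewrite -root_sum -root_prod; ring.
have e2R : d%:~R = ((th1 + th2) * c%:~R - th1 * th2 * b%:~R) / 3.
  have r3 : 3 * r != 0 by rewrite mulf_neq0 // pnatr_eq0.
  apply: (mulfI r3).
  have := congr1 (fun z => z%:~R : R) e2; rewrite /= !rmorphM rmorphB /= !rmorphM /= => ->.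
  by rewrite -root_sum -root_prod; field.
by split; rewrite ?e2R ?e1R; field.
Qed.

Lemma apolar_cofactor_prod f n : apolar f -> hessian f = bqf_scale n Q ->
  cf1 f * cf2 f = n%:~R * r.
Proof.
move=> [e1 e2] fH.
case: f fH e1 e2 => a b c d /= [rE _ _] e1 _.
apply: (mulfI rR_neq0); rewrite /cofactor1 /cofactor2 /=.
have -> : r * (n%:~R * r) = r * (n * bqf_r Q)%:~R by rewrite rmorphM.
rewrite -rE.
have -> : r * (b ^+ 2 - 3 * a * c)%:~R =
   r * b%:~R ^+ 2 - 3 * a%:~R * (bqf_r Q * c)%:~R :> R by ring.
rewrite e1.
have -> : (bqf_s Q * b - 3 * bqf_t Q * a)%:~R = s * b%:~R - 3 * t * a%:~R :> R by ring.
by rewrite -root_sum -root_prod; ring.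
Qed.

Lemma cofactor_prod f n : n != 0 -> hessian f = bqf_scale n Q ->
  cf1 f * cf2 f = n%:~R * r.
Proof.
by move=> n0 fH; apply: apolar_cofactor_prod => //; exact: hessian_apolar n0 fH.
Qed.

Lemma hessian_scale_disc f n : hessian f = bqf_scale n Q ->
  3 * bcf_disc f = - (n ^+ 2 * bqf_disc Q).
Proof.
move=> fH; have := hessian_disc f; rewrite fH.
have -> : bqf_disc (bqf_scale n Q) = n ^+ 2 * bqf_disc Q.
  by rewrite /bqf_disc /=; ring.
by move=> ->; ring.
Qed.

(* [automorph p q u v eps]: the matrix with rows (p, q), (u, v) has the
   eigenvectors (1, th1), (1, th2) for the eigenvalues eps, 1 / eps. *)
Definition automorph (p q u v : int) (eps : R) : Prop :=
  [/\ p * v - q * u = 1, eps != 0,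
      p%:~R + q%:~R * th1 = eps /\ u%:~R + v%:~R * th1 = eps * th1 &
      p%:~R + q%:~R * th2 = eps^-1 /\ u%:~R + v%:~R * th2 = eps^-1 * th2].

(** An automorph divides cf1 by eps^3 and multiplies cf2 by eps^3, hence shifts log |cf1 / cf2| / 3
    by - 2 log |eps|. [period_mobius] and [mobius_period] identify these numbers with the
    translations along [gamma] induced by SL_2(Z). *)
Definition period (l : R) : Prop :=
  exists p q u v eps, automorph p q u v eps /\ l = - 2 * ln `|eps|.

Lemma automorph_bqf p q u v eps : automorph p q u v eps ->
  forall x y, bqf_ev Q (x * p + y * u) (x * q + y * v) = bqf_ev Q x y.
Proof.
move=> [dt e0 [p1 u1] [p2 u2]] x y; apply: (@intr_inj R).
rewrite !bqf_ev_factor.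
have -> : (x * p + y * u)%:~R + th1 * (x * q + y * v)%:~R =
  x%:~R * (p%:~R + q%:~R * th1) + y%:~R * (u%:~R + v%:~R * th1) by ring.
have -> : (x * p + y * u)%:~R + th2 * (x * q + y * v)%:~R =
  x%:~R * (p%:~R + q%:~R * th2) + y%:~R * (u%:~R + v%:~R * th2) by ring.
by rewrite p1 u1 p2 u2; field.
Qed.

Lemma automorph_hessian p q u v eps f n : automorph p q u v eps ->
  hessian f = bqf_scale n Q -> hessian (bcf_act f p q u v) = bqf_scale n Q.
Proof.
move=> am fH; apply: bqf_ext => x y; have [dt _ _ _] := am.
rewrite hessian_act // fH.
have E x' y' : bqf_ev (bqf_scale n Q) x' y' = n * bqf_ev Q x' y'.
  by rewrite /bqf_ev /=; ring.
by rewrite !E (automorph_bqf am).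
Qed.

(** The substitution multiplies x + th1 y by eps and x + th2 y by 1 / eps, and cf1 belongs to the
    cube of the latter. *)
Lemma automorph_cofactor p q u v eps f : automorph p q u v eps -> apolar f ->
  cf1 (bcf_act f p q u v) = cf1 f / eps ^+ 3 /\
  cf2 (bcf_act f p q u v) = cf2 f * eps ^+ 3.
Proof.
move=> [dt e0 [p1 u1] [p2 u2]] ap.
have [aE bE cE dE] := apolar_coefs ap.
set F1 := cf1 f in aE bE cE dE *; set F2 := cf2 f in aE bE cE dE *.
have dth : th2 - th1 != 0 by rewrite subr_eq0 gt_eqF // root_lt.
have aE' : (bcf_a (bcf_act f p q u v))%:~R =
   (F1 * (p%:~R + q%:~R * th2) ^+ 3 - F2 * (p%:~R + q%:~R * th1) ^+ 3)
   / (3 * (th2 - th1)) :> R.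
  case: f @F1 @F2 aE bE cE dE {ap} => a b c d F1 F2 /= aE bE cE dE.
  have -> : (a * p ^+ 3 + b * p ^+ 2 * q + c * p * q ^+ 2 + d * q ^+ 3)%:~R
    = a%:~R * p%:~R ^+ 3 + b%:~R * p%:~R ^+ 2 * q%:~R + c%:~R * p%:~R * q%:~R ^+ 2
      + d%:~R * q%:~R ^+ 3 :> R by ring.
  by rewrite aE bE cE dE; field.
have bE' : (bcf_b (bcf_act f p q u v))%:~R =
   (F1 * (p%:~R + q%:~R * th2) ^+ 2 * (u%:~R + v%:~R * th2)
    - F2 * (p%:~R + q%:~R * th1) ^+ 2 * (u%:~R + v%:~R * th1))
   / (th2 - th1) :> R.
  case: f @F1 @F2 aE bE cE dE {ap aE'} => a b c d F1 F2 /= aE bE cE dE.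
  have -> : (3 * a * p ^+ 2 * u + b * (p ^+ 2 * v + 2 * p * q * u)
       + c * (q ^+ 2 * u + 2 * p * q * v) + 3 * d * q ^+ 2 * v)%:~R
    = 3 * a%:~R * p%:~R ^+ 2 * u%:~R
       + b%:~R * (p%:~R ^+ 2 * v%:~R + 2 * p%:~R * q%:~R * u%:~R)
       + c%:~R * (q%:~R ^+ 2 * u%:~R + 2 * p%:~R * q%:~R * v%:~R)
       + 3 * d%:~R * q%:~R ^+ 2 * v%:~R :> R by ring.
  by rewrite aE bE cE dE; field.
rewrite /cofactor1 /cofactor2 aE' bE' p1 p2 u1 u2.
by split; field; rewrite ?dth ?e0.
Qed.

Lemma form_time_automorph p q u v eps f n : automorph p q u v eps ->
  0 < n -> hessian f = bqf_scale n Q ->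
  form_time R Q (bcf_act f p q u v) = form_time R Q f - 2 * ln `|eps|.
Proof.
move=> am n0 fH; have n0' : n != 0 by rewrite gt_eqF.
have ap := hessian_apolar n0' fH.
have [E1 E2] := automorph_cofactor am ap; have [_ e0 _ _] := am.
have : cf1 f * cf2 f != 0.
  by rewrite (cofactor_prod n0' fH) mulf_neq0 // intr_eq0.
rewrite mulf_eq0 negb_or => /andP[c1 c2].
rewrite /form_time E1 E2.
have -> : cf1 f / eps ^+ 3 / (cf2 f * eps ^+ 3) = (cf1 f / cf2 f) / eps ^+ 6.
  by field; rewrite c2 e0.
rewrite [in LHS]normf_div ln_div ?posrE ?normr_gt0 ?mulf_neq0 ?invr_neq0 ?expf_neq0 //.
rewrite [in LHS]normrX lnXn ?normr_gt0//.
by rewrite mulrBl; congr (_ - _); rewrite -mulr_natr; field.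
Qed.

Lemma period_shift l f n : period l -> 0 < n -> hessian f = bqf_scale n Q ->
  exists p q u v, [/\ p * v - q * u = 1,
    hessian (bcf_act f p q u v) = bqf_scale n Q &
    form_time R Q (bcf_act f p q u v) = form_time R Q f + l].
Proof.
move=> [p [q [u [v [eps [am ->]]]]]] n0 fH; exists p, q, u, v.
rewrite (form_time_automorph am n0 fH) (automorph_hessian am fH).
by have [dt _ _ _] := am; split => //; ring.
Qed.

Lemma automorph_inv p q u v eps : automorph p q u v eps ->
  automorph v (- q) (- u) p eps^-1.
Proof.
move=> [dt e0 [p1 u1] [p2 u2]].
have dtR : p%:~R * v%:~R - q%:~R * u%:~R = 1 :> R by rewrite -!rmorphM -rmorphB dt.
have inv_aux (a b c d e x : R) : e != 0 -> a * d - b * c = 1 ->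
    a + b * x = e -> c + d * x = e * x -> d - b * x = e^-1 /\ - c + a * x = e^-1 * x.
  move=> e_neq0 dt' E1 E2.
  have E3 : (d - b * x) * e = 1.
    by rewrite mulrBl -{1}E1 -mulrA -(mulrC x) [x * e]mulrC -E2 -dt'; ring.
  have E4 : d - b * x = e^-1 by rewrite -[LHS](mulfK e_neq0) E3 mul1r.
  split=> //; apply: (mulfI e_neq0); rewrite mulrA divff // mul1r.
  rewrite mulrDr [e * (a * x)]mulrCA -E2.
  have -> : e * - c = - (a + b * x) * c by rewrite E1; ring.
  by rewrite -[RHS]mul1r -dt'; ring.
split.
- by rewrite -dt; ring.
- by rewrite invr_neq0.
- by have := inv_aux _ _ _ _ _ _ e0 dtR p1 u1; rewrite !rmorphN /= mulNr.
- have e0' : eps^-1 != 0 by rewrite invr_neq0.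
  by have := inv_aux _ _ _ _ _ _ e0' dtR p2 u2; rewrite !rmorphN /= mulNr.
Qed.

Lemma periodN l : period l -> period (- l).
Proof.
move=> [p [q [u [v [eps [am ->]]]]]]; have [_ e0 _ _] := am.
exists v, (- q), (- u), p, eps^-1; split; first exact: automorph_inv.
by rewrite normfV lnV ?posrE ?normr_gt0//; ring.
Qed.

(** Invariance of [Q] alone would allow the two linear factors to be exchanged. Determinant 1 yields
    [lm'], which together with [lm] determines both products and excludes the exchange. *)
Lemma bqf_automorph p q u v : p * v - q * u = 1 ->
  (forall x y, bqf_ev Q (x * p + y * u) (x * q + y * v) = bqf_ev Q x y) ->
  automorph p q u v (p%:~R + q%:~R * th1).
Proof.
move=> dt E.
have dtR : p%:~R * v%:~R - q%:~R * u%:~R = 1 :> R by rewrite -!rmorphM -rmorphB dt.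
pose l1 := p%:~R + q%:~R * th1; pose m1 := u%:~R + v%:~R * th1.
pose l2 := p%:~R + q%:~R * th2; pose m2 := u%:~R + v%:~R * th2.
have EE (x y : int) : (x%:~R * l1 + y%:~R * m1) * (x%:~R * l2 + y%:~R * m2) =
    (x%:~R + th1 * y%:~R) * (x%:~R + th2 * y%:~R).
  apply: (mulfI rR_neq0); rewrite [RHS]mulrA -bqf_ev_factor -E bqf_ev_factor.
  by rewrite /l1 /l2 /m1 /m2; ring.
have l12 : l1 * l2 = 1 by have := EE 1 0; rewrite !mul0r !mulr0 !addr0 !mul1r.
have m12 : m1 * m2 = th1 * th2.
  by have := EE 0 1; rewrite !mul0r !mulr1 !add0r !mul1r.
have lm : l1 * m2 + m1 * l2 = th1 + th2.
  have := EE 1 1; rewrite !mul1r !mulr1 => EE1.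
  have -> : l1 * m2 + m1 * l2 = (l1 + m1) * (l2 + m2) - l1 * l2 - m1 * m2 by ring.
  by rewrite EE1 l12 m12; ring.
have lm' : l1 * m2 - m1 * l2 = th2 - th1.
  transitivity ((p%:~R * v%:~R - q%:~R * u%:~R) * (th2 - th1)).
    by rewrite /l1 /l2 /m1 /m2; ring.
  by rewrite dtR mul1r.
have l1m2 : l1 * m2 = th2 by lra.
have m1l2 : m1 * l2 = th1 by lra.
have l1_neq0 : l1 != 0.
  by apply/eqP => l10; move: l12; rewrite l10 mul0r => /eqP; rewrite eq_sym oner_eq0.
have l2E : l2 = l1^-1 by rewrite -[RHS]mulr1 -l12 mulKf.
split=> //; split=> //.
- by rewrite -/m1 -/l1 -m1l2 l2E; field.
- by rewrite -/m2 -/l1 -l1m2 mulKf.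
Qed.

(** The discriminant is invariant and determines n^2, hence n by positivity. So the substitution
    preserves n Q, hence [Q], and is an automorph. *)
Lemma form_equiv_period f f' n n' p q u v : 0 < n -> 0 < n' ->
  hessian f = bqf_scale n Q -> hessian f' = bqf_scale n' Q ->
  p * v - q * u = 1 -> f' = bcf_act f p q u v ->
  n' = n /\ period (form_time R Q f' - form_time R Q f).
Proof.
move=> n0 n0' fH fH' dt f'E.
have nn : n' = n.
  have D1 := hessian_scale_disc fH; have := hessian_scale_disc fH'.
  rewrite f'E bcf_disc_act // D1 => /oppr_inj.
  have D0 : bqf_disc Q != 0 by rewrite gt_eqF.
  move=> /(mulIf D0) /eqP; rewrite eqf_sqr => /orP[/eqP //|/eqP nE].
  by move: n0; rewrite nE oppr_gt0 ltNge (ltW n0').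
split=> //; subst n'.
have am : automorph p q u v (p%:~R + q%:~R * th1).
  apply: bqf_automorph => // x y.
  have := congr1 (fun P => bqf_ev P x y) fH'; rewrite f'E hessian_act // fH.
  have E x' y' : bqf_ev (bqf_scale n Q) x' y' = n * bqf_ev Q x' y'.
    by rewrite /bqf_ev /=; ring.
  by rewrite !E => /mulfI; apply; rewrite gt_eqF.
exists p, q, u, v, (p%:~R + q%:~R * th1); split => //.
by rewrite f'E (form_time_automorph am n0 fH); ring.
Qed.

End Geometry.

(** * Translations along the geodesic induced by SL_2(Z) *)

Section GammaPeriod.
Variables (R : realType) (Q : bqf int).
Hypotheses (Q_primitive : bqf_primitive Q).
Hypotheses (r_neq0 : bqf_r Q != 0) (D_gt0 : 0 < bqf_disc Q).
Local Notation th1 := (bqf_root1 R Q).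
Local Notation th2 := (bqf_root2 R Q).

Lemma complex_intE (n : int) : n%:~R = Complex n%:~R 0 :> R[i].
Proof. by have := rmorph_int (real_complex R) n => /= <-. Qed.

Lemma geodesicE (a b t : R) : geodesic a b t =
  Complex ((a + b * expR t ^+ 2) / (1 + expR t ^+ 2))
          ((b - a) * expR t / (1 + expR t ^+ 2)).
Proof.
have E0 : 1 + expR t ^+ 2 != 0 by rewrite gt_eqF // ltr_wpDr ?sqr_ge0.
rewrite /geodesic; apply/eqP.
have D0 : Complex 1 (expR t) != 0 by rewrite eq_complex /= oner_eq0.
rewrite -(inj_eq (mulIf D0)) divfK // eq_complex /=.
by apply/andP; split; apply/eqP; field.
Qed.

Lemma gamma_half_plane (t : R) : half_plane R (gamma Q t).
Proof.
rewrite /half_plane gammaE geodesicE /=.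
by rewrite divr_gt0 ?mulr_gt0 ?expR_gt0 ?subr_gt0 ?root_lt// ltr_wpDr ?sqr_ge0.
Qed.

Lemma mobius_frac (g : 'M[int]_2) (N M : R[i]) : M != 0 ->
  mobius g (N / M) = ((g 0 0)%:~R * N + (g 0 1)%:~R * M) /
                     ((g 1 0)%:~R * N + (g 1 1)%:~R * M).
Proof.
move=> M0; rewrite /mobius.
have E a b : a * (N / M) + b = (a * N + b * M) / M by rewrite mulrDl mulfK // mulrA.
by rewrite !E invf_div mulrA divfK.
Qed.

Lemma gamma_mobiusE (g : 'M[int]_2) (t : R) : mobius g (gamma Q t) =
  Complex ((g 0 0)%:~R * th1 + (g 0 1)%:~R)
          (((g 0 0)%:~R * th2 + (g 0 1)%:~R) * expR t) /
  Complex ((g 1 0)%:~R * th1 + (g 1 1)%:~R)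
          (((g 1 0)%:~R * th2 + (g 1 1)%:~R) * expR t).
Proof.
rewrite gammaE /geodesic mobius_frac; last by rewrite eq_complex /= oner_eq0.
congr (_ / _); apply/eqP; rewrite eq_complex !complex_intE /=;
  by apply/andP; split; apply/eqP; ring.
Qed.

Lemma expR_m2ln (eps : R) : eps != 0 -> expR (- 2 * ln `|eps|) = (eps ^+ 2)^-1.
Proof.
move=> e0; rewrite mulNr expRN -[2]/(2%:R) mulr_natl -[X in expR X]mulr_natl expRM_natl.
by rewrite lnK ?posrE ?normr_gt0// real_normK ?num_real.
Qed.

Lemma period_mobius l : period Q l ->
  exists2 g : 'M[int]_2, \det g = 1 &
    forall t : R, gamma Q (t + l) = mobius g (gamma Q t).
Proof.
move=> [p [q [u [v [eps [[dt e0 [p1 u1] [p2 u2]] ->]]]]]].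
(* On endpoints the automorph acts by th |-> (v th + u) / (q th + p), which fixes th1 and th2 by the
   eigenvector equations. *)
exists (\matrix_(i, j) if i == 0 then if j == 0 then v else u
                       else if j == 0 then q else p).
  by rewrite det_mx22E !mxE /= -dt; ring.
move=> t; rewrite gamma_mobiusE gammaE /geodesic expRD expR_m2ln // !mxE /=.
have -> : v%:~R * th1 + u%:~R = eps * th1 by rewrite -u1; ring.
have -> : v%:~R * th2 + u%:~R = eps^-1 * th2 by rewrite -u2; ring.
have -> : q%:~R * th1 + p%:~R = eps by rewrite -p1; ring.
have -> : q%:~R * th2 + p%:~R = eps^-1 by rewrite -p2; ring.
apply/eqP; rewrite eqr_div; [|by rewrite eq_complex /= oner_eq0|
  by rewrite eq_complex /= (negbTE e0)].
by rewrite eq_complex /=; apply/andP; split; apply/eqP; field.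
Qed.

Lemma mobius_period l (g : 'M[int]_2) : \det g = 1 ->
  (forall t : R, gamma Q (t + l) = mobius g (gamma Q t)) -> period Q l.
Proof.
move=> dg G.
pose A1 : R := (g 0 0)%:~R * th1 + (g 0 1)%:~R.
pose A2 : R := (g 0 0)%:~R * th2 + (g 0 1)%:~R.
pose B1 : R := (g 1 0)%:~R * th1 + (g 1 1)%:~R.
pose B2 : R := (g 1 0)%:~R * th2 + (g 1 1)%:~R.
have th12 : th1 < th2 by exact: root_lt.
have dgR : (g 0 0)%:~R * (g 1 1)%:~R - (g 0 1)%:~R * (g 1 0)%:~R = 1 :> R.
  by rewrite -!rmorphM -rmorphB -det_mx22E dg.
have key t : A1 - expR t ^+ 2 * expR l * A2 = th1 * B1 - expR t ^+ 2 * expR l * th2 * B2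
    /\ expR l * A1 + A2 = th1 * B2 + expR l * th2 * B1.
  have := G t; rewrite gamma_mobiusE gammaE /geodesic -/A1 -/A2 -/B1 -/B2 => /eqP.
  have E0 : expR t != 0 by rewrite gt_eqF // expR_gt0.
  rewrite eqr_div; first last.
  - rewrite eq_complex /= mulf_eq0 (negbTE E0) orbF; apply/negP => /andP[/eqP B10 /eqP B20].
    have : B2 - B1 = (g 1 0)%:~R * (th2 - th1) by rewrite /B1 /B2; ring.
    rewrite B10 B20 subrr => /esym/eqP; rewrite mulf_eq0 subr_eq0 (gt_eqF th12) orbF.
    move=> /eqP g10; move: B10; rewrite /B1 g10 mul0r add0r => g11.
    by move: dgR; rewrite g10 g11 !mulr0 subr0 => /eqP; rewrite eq_sym oner_eq0.
  - by rewrite eq_complex /= oner_eq0.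
  rewrite eq_complex expRD /= => /andP[/eqP e1 /eqP e2]; split.
    by lra.
  by apply: (mulfI E0); lra.
(* The first equation of [key] is affine in [expR t ^+ 2], so that two times separate its
   coefficients: g fixes both endpoints. *)
have [k1 k2] := key 0; have [k3 _] := key 1.
have e1 : expR 1 ^+ 2 - expR 0 ^+ 2 != 0 :> R.
  rewrite expR0 expr1n subr_eq0 gt_eqF // exprn_egt1 //.
  by rewrite -expR0 ltr_expR.
have A2E : A2 = th2 * B2.
  have l0 : expR l != 0 by rewrite gt_eqF // expR_gt0.
  apply: (mulfI l0); apply: (mulfI e1); lra.
have A1E : A1 = th1 * B1.
  by have := k1; rewrite A2E; lra.
have B12 : B1 * B2 = 1.
  have d0 : th2 - th1 != 0 by rewrite subr_eq0 gt_eqF.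
  have E : (th2 - th1) * (B1 * B2) = A2 * B1 - A1 * B2 by rewrite A1E A2E; ring.
  have E' : (th2 - th1) * ((g 0 0)%:~R * (g 1 1)%:~R - (g 0 1)%:~R * (g 1 0)%:~R) =
     A2 * B1 - A1 * B2 by rewrite /A1 /A2 /B1 /B2; ring.
  by apply: (mulfI d0); rewrite E -E' dgR.
have B10 : B1 != 0 by apply/eqP => B0; move: B12 => /eqP; rewrite B0 mul0r eq_sym oner_eq0.
have B2E : B2 = B1^-1 by rewrite -[RHS]mulr1 -B12 mulKf.
have lB : expR l * B1 ^+ 2 = 1.
  have d0 : th2 - th1 != 0 by rewrite subr_eq0 gt_eqF.
  have : (th2 - th1) * (expR l * B1) = (th2 - th1) * B2.
    by move: k2; rewrite A1E A2E; lra.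
  by move=> /(mulfI d0) lB2; rewrite expr2 mulrA lB2 mulrC.
exists (g 1 1), (g 1 0), (g 0 1), (g 0 0), B1; split.
  split=> //.
  - by rewrite -[RHS]dg det_mx22E; ring.
  - by split; [rewrite /B1; ring | rewrite [RHS]mulrC -A1E /A1; ring].
  - by rewrite -B2E; split; [rewrite /B2; ring | rewrite [RHS]mulrC -A2E /A2; ring].
apply: expR_inj; rewrite expR_m2ln //.
by rewrite -[LHS](mulfK (expf_neq0 2 B10)) lB mul1r.
Qed.

Lemma modular_class_mobius (z w : R[i]) (g : 'M[int]_2) :
  half_plane R z -> half_plane R w -> \det g = 1 -> w = mobius g z ->
  modular_class z = modular_class w.
Proof.
move=> zH wH dg wE; rewrite /modular_class.
apply/eqmodP => /=; apply/asboolP; exists g => //.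
by rewrite !insubdK ?inE.
Qed.

Lemma modular_class_period l t : period Q l ->
  modular_class (gamma Q (t + l)) = modular_class (gamma Q t : R[i]).
Proof.
move=> /period_mobius[g dg G]; apply/esym.
by apply: (modular_class_mobius _ _ dg (G t)); exact: gamma_half_plane.
Qed.

End GammaPeriod.

(** * Pell's equation *)

Lemma not_injective_ord (T : finType) (n : nat) (F : nat -> T) : (#|T| < n)%N ->
  exists i j : nat, (i < j < n)%N /\ F i = F j.
Proof.
move=> ltn; pose G (i : 'I_n) := F i.
have /injectivePn[i [j ij Fij]] : ~~ injectiveb G.
  apply/negP => /injectiveP /leq_card; rewrite card_ord leqNgt => /negP; exact.
have [lt|lt|/val_inj E] := ltngtP (val i) (val j).
- by exists i, j; rewrite lt ltn_ord.
- by exists j, i; rewrite lt ltn_ord.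
- by rewrite E eqxx in ij.
Qed.

Section Pell.
Variables (R : realType) (D : int).
Hypotheses (D_gt0 : 0 < D) (D_nonsquare : forall n : int, D <> n ^+ 2).
Local Notation w := (Num.sqrt D%:~R : R).

Let w_gt0 : 0 < w. Proof. by rewrite sqrtr_gt0 ltr0z. Qed.
Let w2 : w ^+ 2 = D%:~R. Proof. by rewrite sqr_sqrtr // ler0z ltW. Qed.

Lemma sqrt_irrational (p q : int) : q != 0 -> p%:~R - q%:~R * w != 0.
Proof.
move=> q0; apply/eqP => /eqP; rewrite subr_eq0 => /eqP E.
have {E} : p ^+ 2 = D * q ^+ 2.
  by apply: (@intr_inj R); rewrite rmorphXn /= E exprMn w2; ring.
move=> E; have En : (`|p| ^ 2 = `|D| * `|q| ^ 2)%N by rewrite -!abszX E abszM.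
have : (`|q| ^ 2 %| `|p| ^ 2)%N by rewrite En dvdn_mull.
rewrite dvdn_pexp2r // => /dvdnP[k kE].
have : (`|D| * `|q| ^ 2 = k ^ 2 * `|q| ^ 2)%N by rewrite -En kE expnMn.
move=> /eqP; rewrite eqn_pmul2r ?expn_gt0 ?absz_gt0 ?q0 // => /eqP Dk.
by apply: (D_nonsquare (n := k%:Z)); rewrite -(gtz0_abs D_gt0) Dk -mulnn PoszM expr2.
Qed.

(** The fractional parts of N + 2 multiples of w fall into N + 1 boxes of length 1 / (N + 1). *)
Lemma dirichlet (N : nat) : exists p q : int,
  0 < q <= N.+1%:Z /\ N.+1%:R * `|p%:~R - q%:~R * w| < 1.
Proof.
pose x (i : nat) : R := i%:R * w - (Num.floor (i%:R * w))%:~R.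
have x01 i : 0 <= x i < 1.
  have /andP[l u] := floor_itv (i%:R * w).
  by rewrite /x; move: u; rewrite rmorphD /=; lra.
pose z i := Num.floor (N.+1%:R * x i).
have zitv i : (z i)%:~R <= N.+1%:R * x i < (z i)%:~R + 1.
  by have := floor_itv (N.+1%:R * x i); rewrite rmorphD.
have z0 i : 0 <= z i by rewrite floor_ge0 mulr_ge0 //; case/andP: (x01 i).
have zN i : (`|z i| < N.+1)%N.
  rewrite -ltz_nat gez0_abs // -(ltr_int R) -pmulrn.
  apply: (@le_lt_trans _ _ (N.+1%:R * x i)); first by case/andP: (zitv i).
  by rewrite -[ltRHS]mulr1 ltr_pM2l ?ltr0n //; case/andP: (x01 i).
have [i [j [/andP[ij jN] E]]] : exists i j : nat, (i < j < N.+2)%N /\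
    inord `|z i|%N = inord `|z j|%N :> 'I_N.+1.
  by apply: not_injective_ord; rewrite card_ord.
have {E} zij : z i = z j.
  have := congr1 val E; rewrite /= !inordK // => E'.
  by rewrite -(gez0_abs (z0 i)) E' gez0_abs.
exists (Num.floor (j%:R * w) - Num.floor (i%:R * w)), (j%:Z - i%:Z); split.
  by move: ij jN; lia.
have /andP[li ui] := zitv i; have /andP[lj uj] := zitv j; rewrite zij in li ui.
have -> : (Num.floor (j%:R * w) - Num.floor (i%:R * w))%:~R - (j%:Z - i%:Z)%:~R * w
   = x i - x j by rewrite /x !rmorphB /=; ring.
rewrite -[N.+1%:R]ger0_norm // -normrM ltr_norml; apply/andP; split; lra.
Qed.

(** Better and better approximations p / q of w have norms p^2 - D q^2 in a bounded set. Two of them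
    share their norm k and their residues modulo k, so that their quotient is an integral element of
    norm 1. *)
Lemma pell : exists x y : int, y != 0 /\ x ^+ 2 - D * y ^+ 2 = 1.
Proof.
pose nm (c : int * int) : R := `|c.1%:~R - c.2%:~R * w|.
(* With d = p - q w, the norm is d (d + 2 q w); as |d| and |d| q are at most 1, it is at most 2 w +
   1 in absolute value. *)
pose B := (`|Num.floor (2 * w + 1)|%N).+1.
have BP (k : int) : (`|k|%:~R : R) <= 2 * w + 1 -> (`|k| < B)%N.
  move=> kB; rewrite /B ltnS -lez_nat [leRHS]gez0_abs ?floor_ge0; last first.
    by have := w_gt0; lra.
  by rewrite floor_ge_int.
have step (c : int * int) : exists c' : int * int, 0 < c.2 ->
    [/\ 0 < c'.2, nm c' < nm c & (`|(c'.1 ^+ 2 - D * c'.2 ^+ 2)%R| < B)%N].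
  have [c20|] := boolP (0 < c.2); last by exists c.
  have c0 : 0 < nm c by rewrite normr_gt0 sqrt_irrational // gt_eqF.
  pose N := `|Num.floor (nm c)^-1|%N.
  have N1 : 1 < N.+1%:R * nm c.
    rewrite -ltr_pdivrMr // div1r.
    apply: lt_le_trans (floorD1_gt _) _.
    have -> : N.+1%:R = (Num.floor (nm c)^-1 + 1)%:~R :> R.
      by rewrite -natr1 rmorphD /= /N pmulrn gez0_abs // floor_ge0 invr_ge0 ltW.
    by [].
  have [p [q [/andP[q0 qN] pq]]] := dirichlet N.
  exists (p, q) => _; split=> //=.
    by rewrite -(ltr_pM2l (ltr0Sn R N)); apply: lt_trans pq N1.
  apply: BP; rewrite intr_norm.
  have -> : (p ^+ 2 - D * q ^+ 2)%:~R =
    (p%:~R - q%:~R * w) * ((p%:~R - q%:~R * w) + 2 * (q%:~R * w)) :> R.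
    have -> : (p ^+ 2 - D * q ^+ 2)%:~R = p%:~R ^+ 2 - w ^+ 2 * q%:~R ^+ 2 :> R.
      by rewrite w2; ring.
    by ring.
  have qR : 0 < q%:~R :> R by rewrite ltr0z.
  have q1 : 1 <= q%:~R :> R by rewrite ler1z; lia.
  have qNR : q%:~R <= N.+1%:R :> R by rewrite pmulrn ler_int.
  set d := _ - _; have dE : `|d| * N.+1%:R < 1 by rewrite mulrC.
  have d0 : 0 <= `|d| by [].
  have dq : `|d| * q%:~R <= 1.
    by apply: le_trans (ltW dE); rewrite ler_wpM2l.
  have d1 : `|d| <= 1 by apply: le_trans dq; rewrite ler_peMr.
  rewrite normrM; apply: (@le_trans _ _ (`|d| * (`|d| + 2 * (q%:~R * w)))).
    rewrite ler_wpM2l //; apply: le_trans (ler_normD _ _) _.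
    by rewrite lerD2l ger0_norm // !mulr_ge0 // ltW.
  rewrite mulrDr [leRHS]addrC lerD //.
    by rewrite -[leRHS]mulr1 ler_pM.
  have -> : `|d| * (2 * (q%:~R * w)) = (`|d| * q%:~R) * (2 * w) by ring.
  by rewrite -[leRHS]mul1r ler_wpM2r // mulr_ge0 // ltW.
pose next c := projT1 (cid (step c)).
have nextP c : 0 < c.2 -> [/\ 0 < (next c).2, nm (next c) < nm c &
    (`|((next c).1 ^+ 2 - D * (next c).2 ^+ 2)%R| < B)%N] by exact: projT2 (cid (step c)).
(* The seed (0, 1) need not satisfy the bound on the norm, so that the sequence starts at its
   successor. *)
pose c i := iter i.+1 next (0, 1).
have c0 i : 0 < (c i).2.
  by elim: i => [|i IHi]; [have [] := nextP (0, 1) isT | have [] := nextP (c i) IHi].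
have cB i : (`|((c i).1 ^+ 2 - D * (c i).2 ^+ 2)%R| < B)%N.
  by case: i => [|i]; [have [] := nextP (0, 1) isT | have [] := nextP (c i) (c0 i)].
have cdec i j : (i < j)%N -> nm (c j) < nm (c i).
  elim: j => // j IHj; rewrite ltnS leq_eqVlt => /orP[/eqP ->|/IHj lt].
    by have [] := nextP (c j) (c0 j).
  by apply: lt_trans lt; have [] := nextP (c j) (c0 j).
pose k i := (c i).1 ^+ 2 - D * (c i).2 ^+ 2.
have kR i : (k i)%:~R = (c i).1%:~R ^+ 2 - w ^+ 2 * (c i).2%:~R ^+ 2 :> R.
  by rewrite w2 /k; ring.
have k0 i : k i != 0.
  apply/eqP => ki; have c20 : (c i).2 != 0 by rewrite gt_eqF.
  have : ((c i).1%:~R - (c i).2%:~R * w) * ((c i).1%:~R - (- (c i).2)%:~R * w) = 0.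
    transitivity ((k i)%:~R : R); last by rewrite ki.
    by rewrite kR; ring.
  by apply/eqP; rewrite mulf_neq0 // sqrt_irrational // oppr_eq0.
pose T := (bool * 'I_B * 'I_B * 'I_B)%type.
have modB i (a : int) : (`|(a %% k i)%Z| < B)%N.
  apply: ltn_trans (cB i); rewrite -ltz_nat gez0_abs ?modz_ge0 //.
  by rewrite abszE; exact: ltz_mod (k0 i).
(* The label records the sign and the size of the norm and both residues modulo it; all are below
   [B], so there are finitely many labels. *)
pose F i : T := (0 < k i, inord `|k i|%N, inord `|((c i).1 %% k i)%Z|%N,
  inord `|((c i).2 %% k i)%Z|%N).
have [i [j [/andP[ij _] [sE kE pE qE]]]] := @not_injective_ord T _ F (ltnSn _).
have {sE} kij : k i = k j.
  move: (congr1 val kE); rewrite /= !inordK ?cB // => kE'.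
  by move: sE kE' (k0 i) (k0 j); clear; lia.
have pij : ((c i).1 = (c j).1 %[mod k i])%Z.
  move: (congr1 val pE); rewrite /= !inordK ?modB // -kij => pE'.
  by rewrite -[LHS]gez0_abs ?modz_ge0 // pE' gez0_abs ?modz_ge0.
have qij : ((c i).2 = (c j).2 %[mod k i])%Z.
  move: (congr1 val qE); rewrite /= !inordK ?modB // -kij => qE'.
  by rewrite -[LHS]gez0_abs ?modz_ge0 // qE' gez0_abs ?modz_ge0.
move/eqP: pij; rewrite eqz_mod_dvd => /dvdzP[a aE].
move/eqP: qij; rewrite eqz_mod_dvd => /dvdzP[b bE].
set p := (c i).1 in aE; set q := (c i).2 in bE.
set p' := (c j).1 in aE; set q' := (c j).2 in bE.
have kip : k i = p ^+ 2 - D * q ^+ 2 by [].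
have kjp : k i = p' ^+ 2 - D * q' ^+ 2 by rewrite kij.
have p'E : p' = p - a * k i by rewrite -aE; ring.
have q'E : q' = q - b * k i by rewrite -bE; ring.
(* This is x + y w = (p' + q' w) / (p + q w), already divided by k thanks to the congruences. *)
pose x := 1 - p * a + D * q * b; pose y := q * a - p * b.
have xk : x * k i = p * p' - D * (q * q').
  by rewrite /x p'E q'E mulrDl mulrBl mul1r {1}kip; ring.
have yk : y * k i = p * q' - q * p' by rewrite /y p'E q'E; ring.
have xy : x ^+ 2 - D * y ^+ 2 = 1.
  have k2 : k i ^+ 2 != 0 by rewrite expf_neq0.
  apply: (mulIf k2); rewrite mul1r.
  have -> : (x ^+ 2 - D * y ^+ 2) * k i ^+ 2 = (x * k i) ^+ 2 - D * (y * k i) ^+ 2 by ring.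
  rewrite xk yk.
  have -> : (p * p' - D * (q * q')) ^+ 2 - D * (p * q' - q * p') ^+ 2 =
    (p ^+ 2 - D * q ^+ 2) * (p' ^+ 2 - D * q' ^+ 2) by ring.
  by rewrite -kip -kjp.
(* If y = 0 then x = 1 or x = -1, and the two approximations would have the same error, against the
   strict decrease [cdec]. *)
exists x, y; split => //; apply/eqP => y0.
have x2 : x ^+ 2 = 1 by move: xy; rewrite y0 expr0n mulr0 subr0.
have x1 : `|x%:~R| = 1 :> R.
  by move/eqP: x2; rewrite sqrf_eq1 => /orP[] /eqP ->; rewrite ?normrN normr1.
have E : (p%:~R - q%:~R * w) * (p'%:~R - (- q')%:~R * w) =
   x%:~R * ((p'%:~R - q'%:~R * w) * (p'%:~R - (- q')%:~R * w)) :> R.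
  have -> : (p'%:~R - q'%:~R * w) * (p'%:~R - (- q')%:~R * w) = (k i)%:~R.
    by rewrite kij kR; ring.
  rewrite -[RHS]rmorphM /= xk.
  have -> : (p * p' - D * (q * q'))%:~R = p%:~R * p'%:~R - w ^+ 2 * (q%:~R * q'%:~R) :> R.
    by rewrite w2; ring.
  have pq0 : p%:~R * q'%:~R - q%:~R * p'%:~R = 0 :> R.
    by rewrite -!rmorphM -rmorphB -yk y0 mul0r.
  have -> : (p%:~R - q%:~R * w) * (p'%:~R - (- q')%:~R * w) =
    p%:~R * p'%:~R - w ^+ 2 * (q%:~R * q'%:~R) + (p%:~R * q'%:~R - q%:~R * p'%:~R) * w by ring.
  by rewrite pq0 mul0r addr0.
have q'0 : p'%:~R - (- q')%:~R * w != 0 by rewrite sqrt_irrational // oppr_eq0 gt_eqF // /q' c0.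
move: E; rewrite mulrA => /(mulIf q'0) E.
have := cdec i j ij; rewrite /nm -/p -/q -/p' -/q' E normrM x1 mul1r.
by rewrite ltxx.
Qed.

End Pell.

(** * The least period *)

Section MinimalPeriod.
Variables (R : realType) (Q : bqf int).
Hypotheses (Q_primitive : bqf_primitive Q).
Hypotheses (r_neq0 : bqf_r Q != 0) (D_gt0 : 0 < bqf_disc Q).
Hypothesis Q_nonsquare : forall n : int, bqf_disc Q <> n ^+ 2.
Local Notation th1 := (bqf_root1 R Q).
Local Notation th2 := (bqf_root2 R Q).

Lemma period_gt0_exists : exists l : R, 0 < l /\ period Q l.
Proof.
have [x [y [y0 xy]]] := pell R D_gt0 Q_nonsquare.
(* The matrix is x I + y N with N of trace 0 and N^2 = D I; it multiplies [Q] by its determinant x^2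
   - D y^2. *)
pose p := x + y * bqf_s Q; pose q := - 2 * bqf_r Q * y.
pose u := 2 * bqf_t Q * y; pose v := x - y * bqf_s Q.
have dt : p * v - q * u = 1.
  by rewrite -[RHS]xy /p /q /u /v /bqf_disc; ring.
have am : automorph Q p q u v (p%:~R + q%:~R * th1).
  apply: bqf_automorph => // x' y'.
  transitivity ((x ^+ 2 - bqf_disc Q * y ^+ 2) * bqf_ev Q x' y').
    by rewrite /p /q /u /v /bqf_disc /bqf_ev; ring.
  by rewrite xy mul1r.
set eps := _ + _ in am.
have [_ e0 [p1 _] [p2 _]] := am.
have q0 : q != 0 by rewrite /q !mulf_neq0.
have e1 : `|eps| != 1.
  apply/eqP => e1.
  have e2 : eps ^+ 2 = 1 by rewrite -real_normK ?num_real // e1 expr1n.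
  have e3 : eps^-1 = eps by rewrite -[LHS]mulr1 -e2 expr2 mulKf.
  have : q%:~R * (th2 - th1) = 0.
    have -> : q%:~R * (th2 - th1) = (p%:~R + q%:~R * th2) - (p%:~R + q%:~R * th1) by ring.
    by rewrite p2 p1 e3 subrr.
  move/eqP; rewrite mulf_eq0 intr_eq0 (negbTE q0) /= subr_eq0 gt_eqF //.
  exact: root_lt.
have l0 : - 2 * ln `|eps| != 0.
  by rewrite mulf_neq0 ?oppr_eq0 ?pnatr_eq0 // ln_eq0 ?normr_gt0.
have lP : period Q (- 2 * ln `|eps|) by exists p, q, u, v, eps.
have [lt|gt|] := ltgtP (- 2 * ln `|eps|) 0; last by move/eqP; rewrite (negbTE l0).
- by exists (- (- 2 * ln `|eps|)); rewrite oppr_gt0; split => //; exact: periodN.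
- by exists (- 2 * ln `|eps|).
Qed.

(** The trace p + v of the automorph is eps + 1 / eps, an integer. This is the discreteness that
    prevents periods from accumulating at 0. *)
Lemma period_trace (l : R) : period Q l ->
  exists m : nat, expR (l / 2) + (expR (l / 2))^-1 = m%:R.
Proof.
move=> [p [q [u [v [eps [[dt e0 [p1 u1] [p2 u2]] ->]]]]]].
exists `|(p + v)%R|%N.
have dth : th2 - th1 != 0 by rewrite subr_eq0 gt_eqF // root_lt.
have trE : (p + v)%:~R = eps + eps^-1.
  apply: (mulIf dth).
  have -> : (p + v)%:~R * (th2 - th1) =
    p%:~R * (th2 - th1) + (u%:~R + v%:~R * th2) - (u%:~R + v%:~R * th1) by ring.
  rewrite u2 u1.
  have -> : p%:~R * (th2 - th1) = (p%:~R + q%:~R * th1) * th2 - (p%:~R + q%:~R * th2) * th1.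
    by ring.
  by rewrite p1 p2; ring.
have -> : - 2 * ln `|eps| / 2 = - ln `|eps| by field.
rewrite expRN lnK ?posrE ?normr_gt0 // invrK pmulrn abszE intr_norm trE.
have [e|e] := leP 0 eps.
  by rewrite !ger0_norm ?addr_ge0 ?invr_ge0 // addrC.
rewrite (ltr0_norm e) ler0_norm; first by rewrite invrN; ring.
by rewrite -oppr_ge0 opprD addr_ge0 // ?oppr_ge0 ?invr_le0 ltW.
Qed.

Lemma addr_inv_incr (x y : R) : 1 <= x -> x < y -> x + x^-1 < y + y^-1.
Proof.
move=> x1 xy; have x0 : 0 < x by lra.
have y0 : 0 < y by lra.
rewrite -subr_gt0.
have -> : y + y^-1 - (x + x^-1) = (y - x) * (x * y - 1) / (x * y).
  by field; rewrite !gt_eqF.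
rewrite divr_gt0 ?mulr_gt0 ?subr_gt0 //.
by apply: (@lt_le_trans _ _ y); [lra | rewrite ler_peMl // ltW].
Qed.

(** The function 2 cosh (l / 2) takes natural values at periods and increases strictly for l > 0, so
    that a positive period of least value is the least one. *)
Lemma minimal_period : exists l : R,
  [/\ 0 < l, period Q l & forall l', 0 < l' -> period Q l' -> l <= l'].
Proof.
pose P (m : nat) := `[< exists l : R, [/\ 0 < l, period Q l &
  expR (l / 2) + (expR (l / 2))^-1 = m%:R] >].
have exP : exists m, P m.
  have [l [l0 lP]] := period_gt0_exists; have [m mE] := period_trace lP.
  by exists m; apply/asboolP; exists l.
case: (ex_minnP exP) => m /asboolP[l [l0 lP lm]] min_m.
exists l; split => // l' l'0 l'P; rewrite leNgt; apply/negP => ll'.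
have [m' m'E] := period_trace l'P.
have : (m <= m')%N by apply: min_m; apply/asboolP; exists l'.
rewrite -(ler_nat R) -m'E -lm leNgt addr_inv_incr //.
  by rewrite -expR0 ler_expR divr_ge0 // ltW.
by rewrite ltr_expR ltr_pM2r ?invr_gt0.
Qed.

Lemma gamma_period_minimal : 0 < gamma_period R Q /\ period Q (gamma_period R Q) /\
  forall l', 0 < l' -> period Q l' -> gamma_period R Q <= l'.
Proof.
have [l [l0 lP lmin]] := minimal_period.
suff -> : gamma_period R Q = l by [].
set S := [set l : R | 0 < l /\ exists2 g : 'M[int]_2, \det g = 1 &
                     forall t : R, gamma Q (t + l) = mobius g (gamma Q t)].
have Sl : S l by split => //; exact: period_mobius.
have Slb : lbound S l.
  by move=> l' [l'0 [g dg G]]; apply: lmin => //; exact: (mobius_period _ _ dg G).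
apply/eqP; rewrite eq_le; apply/andP; split.
  by apply: ge_inf => //; exists l.
by apply: lb_le_inf => //; exists l.
Qed.

End MinimalPeriod.

(** * Complex cubic orders and their shapes *)

Definition anisotropic (f : bcf) : Prop :=
  forall x y, bcf_eval f x y = 0 -> x = 0 /\ y = 0.

(* If f vanished at a primitive vector, a change of basis would give a = 0, so
   that w (w - b) = 0. *)
Lemma domain_anisotropic (A : oriented_cubic_ring) f (w h : A) :
  (forall x y : A, x * y = 0 -> x = 0 \/ y = 0) ->
  obasis w h -> table f w h -> anisotropic f.
Proof.
move=> dom ob tb.
have a_neq0 f' (w' h' : A) : obasis w' h' -> table f' w' h' -> bcf_a f' != 0.
  move=> ob' tb'; apply/eqP => a0; have [_ ww _] := tb'.
  have : w' * (w' - (bcf_b f')%:~R) = 0.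
    by rewrite mulrBr ww /lin a0; ring.
  move=> /dom[w0|w0].
    have : lin w' h' 0 1 0 = lin w' h' 0 0 0 by rewrite /lin w0; ring.
    by move=> /(lin_inj ob')[].
  have : lin w' h' (- bcf_b f') 1 0 = lin w' h' 0 0 0.
    have -> : lin w' h' (- bcf_b f') 1 0 = w' - (bcf_b f')%:~R by rewrite /lin; ring.
    by rewrite w0 /lin; ring.
  by move=> /(lin_inj ob')[].
move=> x y fxy; suff /andP[/eqP-> /eqP->] : (x == 0) && (y == 0) by [].
rewrite -gcdz_eq0; apply/negPn/negP => g0.
set g := gcdz x y in g0.
have [u [v uv]] := Bezoutz x y; rewrite -/g in uv.
have /dvdzP[x' xE] : (g %| x)%Z by exact: dvdz_gcdl.
have /dvdzP[y' yE] : (g %| y)%Z by exact: dvdz_gcdr.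
have dt : x' * u - y' * (- v) = 1.
  by apply: (mulfI g0); rewrite mulr1 -[RHS]uv xE yE; ring.
have [k [l [ob' tb']]] := has_form_act ob tb dt.
apply/negP: (a_neq0 _ _ _ ob' tb'); rewrite negbK; apply/eqP.
have -> : bcf_a (bcf_act f x' y' (- v) u) = bcf_eval f x' y'.
  by case: (f) => a b c d; rewrite /bcf_eval /=; ring.
have g3 : g ^+ 3 != 0 by rewrite expf_neq0.
apply: (mulfI g3); transitivity (bcf_eval f (x' * g) (y' * g)).
  by rewrite /bcf_eval; ring.
by rewrite -xE -yE fxy mulr0.
Qed.

(** * Cardano's formulas *)

Section CubeRoots.
Variable R : realType.

Lemma cube_root_exists (x : R) : exists y, y ^+ 3 = x.
Proof.
have pos (z : R) : 0 <= z -> exists y, y ^+ 3 = z.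
  move=> z0; exists (z `^ 3^-1); rewrite -powR_mulrn ?powR_ge0 // -powRrM mulVf ?pnatr_eq0 //.
  by rewrite powRr1.
have [x0|x0] := leP 0 x; first exact: pos.
have [y yE] : exists y, y ^+ 3 = - x by apply: pos; rewrite oppr_ge0 ltW.
by exists (- y); rewrite exprNn yE; ring.
Qed.

Definition omega : R[i] := Complex (- 2^-1) (Num.sqrt 3 / 2).

Lemma omega2 : omega ^+ 2 = - 1 - omega.
Proof.
have s3 : Num.sqrt 3 ^+ 2 = 3 :> R by rewrite sqr_sqrtr.
rewrite expr2; apply/eqP; rewrite eq_complex /=; apply/andP; split; apply/eqP; last by field.
have -> : Num.sqrt 3 / 2 * (Num.sqrt 3 / 2) = Num.sqrt 3 ^+ 2 / 4 :> R by field.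
by rewrite s3; field.
Qed.

Lemma omega3 : omega ^+ 3 = 1.
Proof. by rewrite exprS omega2 mulrBr mulrN1 -expr2 omega2; ring. Qed.

End CubeRoots.

Section CubicRoots.
Variables (R : realType) (Q : bqf int).
Hypotheses (Q_primitive : bqf_primitive Q).
Hypotheses (r_neq0 : bqf_r Q != 0) (D_gt0 : 0 < bqf_disc Q).
Variables (f : bcf) (n : int).
Hypotheses (n_gt0 : 0 < n) (fH : hessian f = bqf_scale n Q) (a_neq0 : bcf_a f != 0).
Local Notation th1 := (bqf_root1 R Q).
Local Notation th2 := (bqf_root2 R Q).
Local Notation a := ((bcf_a f)%:~R : R).
Local Notation b := ((bcf_b f)%:~R : R).
Local Notation c := ((bcf_c f)%:~R : R).
Local Notation d := ((bcf_d f)%:~R : R).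
Variables (sg tu : R).
Hypotheses (sgE : sg ^+ 3 = cofactor1 R Q f) (tuE : tu ^+ 3 = cofactor2 R Q f).
Local Notation A1 := (sg * tu ^+ 2).
Local Notation B1 := (sg ^+ 2 * tu).

Let n_neq0 : n != 0. Proof. by rewrite gt_eqF. Qed.

(** [A1] and [B1] are the Lagrange resolvents of X^3 - b X^2 + ac X - a^2 d, the characteristic
    polynomial of w. Their product and the sum of their cubes are what Cardano's formulas require,
    and real cube roots of the cofactors provide both. *)
Lemma fourier_prod : A1 * B1 = b ^+ 2 - 3 * a * c.
Proof.
have -> : A1 * B1 = sg ^+ 3 * tu ^+ 3 by ring.
rewrite sgE tuE (cofactor_prod R r_neq0 D_gt0 n_neq0 fH).
have -> : n%:~R * (bqf_r Q)%:~R = (n * bqf_r Q)%:~R :> R by ring.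
have -> : n * bqf_r Q = bqf_r (hessian f) by rewrite fH.
by case: (f) => a' b' c' d' /=; ring.
Qed.

Lemma fourier_sum : A1 ^+ 3 + B1 ^+ 3 = 2 * b ^+ 3 - 9 * a * b * c + 27 * a ^+ 2 * d.
Proof.
have -> : A1 ^+ 3 + B1 ^+ 3 = (sg ^+ 3 * tu ^+ 3) * (sg ^+ 3 + tu ^+ 3) by ring.
rewrite sgE tuE (cofactor_prod R r_neq0 D_gt0 n_neq0 fH) /cofactor1 /cofactor2.
have -> : n%:~R * (bqf_r Q)%:~R * (b - 3 * a * th1 + (b - 3 * a * th2)) =
  2 * b * (n%:~R * (bqf_r Q)%:~R) - 3 * a * (n%:~R * ((bqf_r Q)%:~R * (th1 + th2))) by ring.
rewrite root_sum //.
have -> : n%:~R * (bqf_r Q)%:~R = (bqf_r (hessian f))%:~R :> R by rewrite fH /=; ring.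
have -> : n%:~R * (bqf_s Q)%:~R = (bqf_s (hessian f))%:~R :> R by rewrite fH /=; ring.
by case: (f) => a' b' c' d' /=; ring.
Qed.

Local Notation C x := (x%:C)%C.
Definition cubic_root (u : R[i]) : R[i] := (C b + C A1 * u + C B1 * u ^+ 2) / 3.
(** The conjugate of h that goes with the conjugate [cubic_root u] of w; [cubic_root2E] is the
    relation w^2 = -ac + bw - ah between them. *)
Definition cubic_root2 (u : R[i]) : R[i] := (- C c + C (th1 * A1) * u + C (th2 * B1) * u ^+ 2) / 3.

Let aC : C a != 0. Proof. by rewrite fmorph_eq0 intr_eq0. Qed.

Lemma cubic_factor (X : R[i]) : let w := omega R in
  X ^+ 3 - C b * X ^+ 2 + C (a * c) * X - C (a ^+ 2 * d) =
  (X - cubic_root 1) * (X - cubic_root w) * (X - cubic_root (w ^+ 2)).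
Proof.
move=> w; rewrite /cubic_root.
have E1 : C A1 * C B1 = C b ^+ 2 - 3 * C a * C c.
  by rewrite -rmorphM fourier_prod /=; ring.
have E2 : C A1 ^+ 3 + C B1 ^+ 3 = 2 * C b ^+ 3 - 9 * C a * C b * C c + 27 * C a ^+ 2 * C d.
  by rewrite -!rmorphXn -rmorphD fourier_sum /=; ring.
have w2 : w ^+ 2 = - 1 - w by exact: omega2.
have w4 : (w ^+ 2) ^+ 2 = w by rewrite -exprM -[(2 * 2)%N]/(3 + 1)%N exprD omega3 mul1r expr1.
rewrite w4 w2 expr1n.
set x := C A1 in E1 E2 *; set y := C B1 in E1 E2 *.
pose Y := 3 * X - C b.
have XE : X = (Y + C b) / 3 by rewrite /Y; field.
have H3 : (Y - x - y) * (Y - x * w - y * (- 1 - w)) * (Y - x * (- 1 - w) - y * w) =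
   Y ^+ 3 - 3 * (x * y) * Y - (x ^+ 3 + y ^+ 3).
  have w2' : w ^+ 2 + w + 1 = 0 by rewrite w2; ring.
  (* The two sides differ by an explicit multiple of w^2 + w + 1, which makes the identity
     polynomial. *)
  transitivity (Y ^+ 3 - 3 * (x * y) * Y - (x ^+ 3 + y ^+ 3)
    + (w ^+ 2 + w + 1) * (- Y * (x - y) ^+ 2 + (x + y) * (x - y) ^+ 2)); last by rewrite w2'; ring.
  ring.
transitivity ((Y - x - y) * (Y - x * w - y * (- 1 - w)) * (Y - x * (- 1 - w) - y * w) / 27).
  by rewrite H3 E1 E2 XE; field.
by rewrite /Y; field.
Qed.

Lemma cubic_root2E (u : R[i]) : u ^+ 3 = 1 ->
  C a * cubic_root2 u = C b * cubic_root u - C (a * c) - cubic_root u ^+ 2.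
Proof.
move=> u3.
have E1 : C A1 * C B1 = C b ^+ 2 - 3 * C a * C c.
  by rewrite -rmorphM fourier_prod /=; ring.
(* Both sides are sg^4 tu^2, the first factor on the right being cf1 = sg^3; this is how th1 gets
   into the conjugates of h. *)
have EB : C B1 ^+ 2 = (C b - 3 * C a * C th1) * C A1.
  have -> : C b - 3 * C a * C th1 = C (sg ^+ 3) by rewrite sgE /cofactor1; ring.
  by rewrite -rmorphXn -rmorphM /=; congr (C _); ring.
have EA : C A1 ^+ 2 = (C b - 3 * C a * C th2) * C B1.
  have -> : C b - 3 * C a * C th2 = C (tu ^+ 3) by rewrite tuE /cofactor2; ring.
  by rewrite -rmorphXn -rmorphM /=; congr (C _); ring.
rewrite /cubic_root2 /cubic_root [C (th1 * A1)]rmorphM [C (th2 * B1)]rmorphM [C (a * c)]rmorphM /=.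
set x := C A1 in E1 EB EA *; set y := C B1 in E1 EB EA *.
have u4 : u ^+ 4 = u by rewrite exprS u3 mulr1.
have -> : ((C b + x * u + y * u ^+ 2) / 3) ^+ 2 =
   (C b ^+ 2 + x ^+ 2 * u ^+ 2 + y ^+ 2 * u ^+ 4 + 2 * C b * x * u + 2 * C b * y * u ^+ 2
    + 2 * (x * y) * u ^+ 3) / 9 by field.
by rewrite u4 u3 E1 EA EB; field.
Qed.

Let c12 : cofactor1 R Q f * cofactor2 R Q f != 0.
Proof. by rewrite (cofactor_prod R r_neq0 D_gt0 n_neq0 fH) mulf_neq0 // intr_eq0. Qed.

Lemma cube_roots_neq0 : sg != 0 /\ tu != 0.
Proof.
move: c12; rewrite -sgE -tuE mulf_eq0 negb_or !expf_eq0 /= => /andP[]; by split.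
Qed.

Lemma cube_roots_neq : sg != tu.
Proof.
apply/eqP => st; have : cofactor1 R Q f = cofactor2 R Q f by rewrite -sgE -tuE st.
rewrite /cofactor1 /cofactor2 => /addrI/oppr_inj/mulfI => /(_ _)/eqP.
rewrite mulf_neq0 ?pnatr_eq0 ?intr_eq0 // => /(_ isT).
by rewrite lt_eqF // root_lt.
Qed.

Lemma cubic_root_im : [/\ complex.Im (cubic_root 1) = 0,
  complex.Im (cubic_root (omega R)) = Num.sqrt 3 / 6 * (A1 - B1) &
  complex.Im (cubic_root (omega R ^+ 2)) = - (Num.sqrt 3 / 6 * (A1 - B1))].
Proof.
have E (z : R[i]) : z / 3 = C (3^-1) * z by rewrite rmorphV ?unitfE ?pnatr_eq0 //= rmorph_nat mulrC.
have w4 : (omega R ^+ 2) ^+ 2 = omega R.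
  by rewrite -exprM -[(2 * 2)%N]/(3 + 1)%N exprD omega3 mul1r expr1.
rewrite /cubic_root w4 !omega2 expr1n !E /omega /=; by split; field.
Qed.

Lemma cubic_root_im_neq0 : Num.sqrt 3 / 6 * (A1 - B1) != 0.
Proof.
have [s0 t0] := cube_roots_neq0.
have -> : A1 - B1 = sg * tu * (tu - sg) by ring.
have s3 : Num.sqrt 3 != 0 :> R by rewrite gt_eqF // sqrtr_gt0.
apply: mulf_neq0; first by rewrite mulf_neq0 // invr_neq0 // pnatr_eq0.
by rewrite mulf_neq0 ?mulf_neq0 // subr_eq0 eq_sym cube_roots_neq.
Qed.

End CubicRoots.

Lemma common_denominator (I : finType) (k : I -> rat) :
  exists N : int, N != 0 /\ exists x : I -> int, forall i, N%:~R * k i = (x i)%:~R.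
Proof.
exists (\prod_i denq (k i)); split; first by apply/prodf_neq0 => i _; exact: denq_neq0.
exists (fun i => numq (k i) * \prod_(j | j != i) denq (k j)) => i.
rewrite (bigD1 i) //= !rmorphM /= -{2}(divq_num_den (k i)).
by field; rewrite intr_eq0 denq_neq0.
Qed.

(** * Conjugates of the basis of an order *)

Section CubicOrder.
Variables (R : realType) (A : oriented_cubic_ring) (D : complex_cubic_order R A).

Definition order_emb (i : 'I_3) (x : A) : R[i] := cc_emb D i (cc_incl D x).

Lemma order_emb_lin i (w h : A) x y z : order_emb i (lin w h x y z) =
  lin (order_emb i w) (order_emb i h) x y z.
Proof. by rewrite /order_emb /lin !rmorphD !rmorphM /= !rmorph_int. Qed.

Lemma order_embM i x y : order_emb i (x * y) = order_emb i x * order_emb i y.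
Proof. by rewrite /order_emb !rmorphM. Qed.

Lemma order_domain (x y : A) : x * y = 0 -> x = 0 \/ y = 0.
Proof.
move=> xy; have : cc_incl D x * cc_incl D y = 0 by rewrite -rmorphM xy rmorph0.
move/eqP; rewrite mulf_eq0 => /orP[] /eqP E; [left|right];
  by apply: (cc_incl_inj (c := D)); rewrite E rmorph0.
Qed.

(** Clearing denominators, independence of 1, w, h over the integers gives independence over the
    rationals; in dimension 3 they form a basis of the field. *)
Lemma order_span (w h : A) : obasis w h -> forall y : cc_field D,
  exists N : int, N != 0 /\ exists x : A, N%:~R * y = cc_incl D x.
Proof.
move=> [S I _]; pose e : 3.-tuple (cc_field D) :=
  [tuple cc_incl D 1; cc_incl D w; cc_incl D h].
have eE (x : 'I_3 -> int) : \sum_i (x i)%:~R * e`_i = cc_incl D (lin w h (x 0) (x 1) (x (1 + 1))).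
  rewrite big_ord3 /= /lin !rmorphD !rmorphM /= rmorph1 mulr1.
  by rewrite !(rmorph_int (cc_incl D)).
have scE (q : rat) (v : cc_field D) (N x : int) : N%:~R * q = x%:~R ->
    N%:~R * (q *: v) = x%:~R * v.
  move=> E; rewrite mulrzl -scaler_int scalerA E.
  by rewrite scaler_int mulrzl.
have efree : free e.
  apply/freeP => k k0 i; have [N [N0 [x xE]]] := common_denominator k.
  have : \sum_i (x i)%:~R * e`_i = 0.
    transitivity (N%:~R * \sum_(j < 3) k j *: e`_j); last by rewrite k0 mulr0.
    by rewrite mulr_sumr; apply: eq_bigr => j _; rewrite (scE _ _ _ _ (xE j)).
  rewrite eE -(rmorph0 (cc_incl D)) => /(cc_incl_inj (c := D)) /I[x0 x1 x2].
  have : N%:~R * k i = 0.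
    by rewrite xE; elim/ord3P: i => //=; rewrite ?x0 ?x1 ?x2.
  by move/eqP; rewrite mulf_eq0 intr_eq0 (negbTE N0) => /eqP.
have espan : basis_of fullv e.
  rewrite basisEfree efree subvf /=.
  by rewrite (cc_dim D).
move=> y; have yE := coord_basis espan (memvf y).
have [N [N0 [x xE]]] := common_denominator (fun i => coord e i y).
exists N; split => //; exists (lin w h (x 0) (x 1) (x (1 + 1))).
rewrite -eE {1}yE mulr_sumr; apply: eq_bigr => j _.
by rewrite (scE _ _ _ _ (xE j)).
Qed.

(** As a != 0, the conjugate of w determines that of h, hence the embedding of the order and then of
    the field. So the three conjugates of w are distinct. *)
Lemma order_emb_inj f (w h : A) i j : obasis w h -> table f w h -> bcf_a f != 0 ->
  order_emb i w = order_emb j w -> i = j.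
Proof.
move=> ob tb a0 E; have aR : (bcf_a f)%:~R != 0 :> R[i] by rewrite intr_eq0.
have hE : order_emb i h = order_emb j h.
  have [_ ww _] := tb; apply: (mulfI aR).
  have key k : (bcf_a f)%:~R * order_emb k h = (- (bcf_a f * bcf_c f))%:~R
     + (bcf_b f)%:~R * order_emb k w - order_emb k w ^+ 2.
    by rewrite expr2 -order_embM ww order_emb_lin /lin; ring.
  by rewrite !key E.
have AE x : order_emb i x = order_emb j x.
  by have [S _ _] := ob; have [p [q [s ->]]] := S x; rewrite !order_emb_lin E hE.
apply: cc_emb_distinct (D) _ _ _ => y.
have [N [N0 [x xE]]] := order_span ob y.
have NR : N%:~R != 0 :> R[i] by rewrite intr_eq0.
have key i' : N%:~R * cc_emb D i' y = order_emb i' x.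
  by rewrite /order_emb -xE rmorphM /= rmorph_int.
by apply: (mulfI NR); rewrite !key AE.
Qed.

End CubicOrder.

Section Shape.
Variables (R : realType) (Q : bqf int).
Hypotheses (Q_primitive : bqf_primitive Q).
Hypotheses (r_neq0 : bqf_r Q != 0) (D_gt0 : 0 < bqf_disc Q).
Variables (A : oriented_cubic_ring) (D : complex_cubic_order R A).
Variables (f : bcf) (n k l : int).
Hypotheses (n_gt0 : 0 < n) (fH : hessian f = bqf_scale n Q).
Hypothesis tb : table f (cc_basis D 1 - k%:~R) (cc_basis D 2 - l%:~R).
Local Notation th1 := (bqf_root1 R Q).
Local Notation th2 := (bqf_root2 R Q).
Local Notation w := (cc_basis D 1 - k%:~R).
Local Notation h := (cc_basis D 2 - l%:~R).

Lemma cc_basis_triple : cc_basis D = triple 1 (cc_basis D 1) (cc_basis D 2).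
Proof. by apply/funext; apply: ord3P => //; rewrite /triple /= cc_basis0. Qed.

Lemma cc_obasis : obasis (cc_basis D 1) (cc_basis D 2).
Proof.
have := cc_basisP D; rewrite cc_basis_triple => /Zbasis_triple[S I].
by split => //; rewrite -(cc_basis_oriented D) cc_basis0.
Qed.

Lemma cc_obasis_shift k' l' : obasis (cc_basis D 1 - k'%:~R) (cc_basis D 2 - l'%:~R).
Proof.
have -> : cc_basis D 1 - k'%:~R = lin (cc_basis D 1) (cc_basis D 2) (- k') 1 0.
  by rewrite /lin; ring.
have -> : cc_basis D 2 - l'%:~R = lin (cc_basis D 1) (cc_basis D 2) (- l') 0 1.
  by rewrite /lin; ring.
by apply: obasis_change => //; exact: cc_obasis.
Qed.

Lemma cc_anisotropic : anisotropic f.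
Proof.
exact: (domain_anisotropic (@order_domain _ _ D) (cc_obasis_shift k l) tb).
Qed.

Lemma anisotropic_a_neq0 : bcf_a f != 0.
Proof.
apply/eqP => a0; have [] // := @cc_anisotropic 1 0.
by rewrite /bcf_eval a0; ring.
Qed.

(** Parseval's identity for the cube roots of unity: the cross terms between the two characters
    cancel. *)
Lemma minkowski_sum (P S : R) (om := omega R) :
  \sum_(j : 'I_3) ComplexField.Normc.normc
     ((P%:C)%C * om ^+ j + (S%:C)%C * (om ^+ j) ^+ 2) ^+ 2 = 3 * (P ^+ 2 + S ^+ 2).
Proof.
have normc2 (z : R[i]) : ComplexField.Normc.normc z ^+ 2 =
    complex.Re z ^+ 2 + complex.Im z ^+ 2.
  by case: z => x y /=; rewrite sqr_sqrtr // addr_ge0 ?sqr_ge0.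
have s3 : Num.sqrt 3 ^+ 2 = 3 :> R by rewrite sqr_sqrtr.
have om4 : (om ^+ 2) ^+ 2 = om.
  by rewrite -exprM -[(2 * 2)%N]/(3 + 1)%N exprD omega3 mul1r expr1.
rewrite big_ord3 !normc2 expr0 expr1n !expr1 -[nat_of_ord (1 + 1)]/2%N om4 omega2 /=.
move: (Num.sqrt 3) s3 => z z2.
transitivity (3 / 2 * (P + S) ^+ 2 + z ^+ 2 / 2 * (P - S) ^+ 2); first by field.
by rewrite z2; field.
Qed.

Lemma trace_zero_fourier (F : numFieldType) (b c x y u s z e1 e2 : F) :
  - b * x + c * y + 3 * x * ((b + s * z ^+ 2 * u + s ^+ 2 * z * u ^+ 2) / 3)
  + 3 * y * ((- c + e1 * (s * z ^+ 2) * u + e2 * (s ^+ 2 * z) * u ^+ 2) / 3) =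
  s * z ^+ 2 * (x + e1 * y) * u + s ^+ 2 * z * (x + e2 * y) * u ^+ 2.
Proof. by field. Qed.

Lemma cc_minkowski (sg tu : R) (x y : int) :
  sg ^+ 3 = cofactor1 R Q f -> tu ^+ 3 = cofactor2 R Q f ->
  \sum_i ComplexField.Normc.normc (order_emb D i (perp_comb (cc_basis D) x y)) ^+ 2 =
  3 * ((sg * tu ^+ 2 * (x%:~R + th1 * y%:~R)) ^+ 2 +
       (sg ^+ 2 * tu * (x%:~R + th2 * y%:~R)) ^+ 2).
Proof.
move=> sgE tuE; have a0 := anisotropic_a_neq0.
pose om := omega R; pose rt (j : 'I_3) := cubic_root f sg tu (om ^+ j).
pose rt2 (j : 'I_3) := cubic_root2 Q f sg tu (om ^+ j).
have om3 : om ^+ 3 = 1 by exact: omega3.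
have omj (j : 'I_3) : (om ^+ j) ^+ 3 = 1 by rewrite exprAC om3 expr1n.
have intC (m : int) : ((m%:~R : R)%:C)%C = m%:~R by rewrite rmorph_int.
have aC : (bcf_a f)%:~R != 0 :> R[i] by rewrite intr_eq0.
have acE : (((bcf_a f)%:~R * (bcf_c f)%:~R : R)%:C)%C = (bcf_a f * bcf_c f)%:~R.
  by rewrite -intC; congr (_%:C)%C; ring.
have a2dE : (((bcf_a f)%:~R ^+ 2 * (bcf_d f)%:~R : R)%:C)%C = (bcf_a f ^+ 2 * bcf_d f)%:~R.
  by rewrite -intC; congr (_%:C)%C; ring.
have [wh ww hh] := tb.
(* Multiplying w^2 = -ac + bw - ah by w gives w^3 - b w^2 + ac w - a^2 d = 0, which [cubic_factor]
   splits. *)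
have embP i : exists j, order_emb D i w == rt j.
  pose X := order_emb D i w.
  have : (X - rt 0) * (X - rt 1) * (X - rt (1 + 1)) = 0.
    rewrite /rt expr0 expr1 -[nat_of_ord (1 + 1)]/2%N.
    rewrite -(cubic_factor r_neq0 D_gt0 n_gt0 fH sgE tuE).
    rewrite acE a2dE !intC.
    have : order_emb D i (w * (w * w)) = order_emb D i (w * lin w h (- (bcf_a f * bcf_c f)) (bcf_b f) (- bcf_a f)).
      by rewrite ww.
    rewrite [in X in _ = X](_ : w * lin w h _ _ _ = (- (bcf_a f * bcf_c f))%:~R * w
       + (bcf_b f)%:~R * (w * w) + (- bcf_a f)%:~R * (w * h)); last by rewrite /lin; ring.
    rewrite wh /order_emb !rmorphD !rmorphM /= !rmorph_int -/(order_emb D i w) -/X => XE.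
    transitivity (X * (X * X) - (bcf_b f)%:~R * (X * X) + (bcf_a f * bcf_c f)%:~R * X
       - (bcf_a f ^+ 2 * bcf_d f)%:~R); first by ring.
    by rewrite XE; ring.
  move/eqP; rewrite !mulf_eq0 !subr_eq0 => /orP[/orP[]|] E;
    [by exists 0 | by exists 1 | by exists (1 + 1)].
(* The embeddings come in an unknown order; [pi] matches them with the roots and, being an injection
   of a finite set into itself, reindexes the sum. *)
pose pi i := projT1 (cid (embP i)).
have piE i : order_emb D i w = rt (pi i) by exact/eqP/(projT2 (cid (embP i))).
have pi_inj : injective pi.
  move=> i j ij; apply: (order_emb_inj (D := D) (cc_obasis_shift k l) tb a0).
  by rewrite !piE ij.
have piE2 i : order_emb D i h = rt2 (pi i).
  apply: (mulfI aC).
  have := cubic_root2E r_neq0 D_gt0 n_gt0 fH sgE tuE (omj (pi i)).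
  rewrite -/(rt (pi i)) -/(rt2 (pi i)) !intC => ->.
  rewrite -piE expr2 -order_embM ww order_emb_lin /lin acE; ring.
rewrite -minkowski_sum [RHS](reindex_inj pi_inj); apply: eq_bigr => i _.
congr (ComplexField.Normc.normc _ ^+ 2).
rewrite (perp_comb_lin (cc_basisP D) (cc_basis0 D) tb) order_emb_lin piE piE2.
rewrite /rt /rt2 /cubic_root /cubic_root2 /lin -/om.
have -> : (- bcf_b f * x + bcf_c f * y)%:~R =
    ((- (bcf_b f)%:~R * x%:~R + (bcf_c f)%:~R * y%:~R : R)%:C)%C.
  by rewrite -intC; congr (_%:C)%C; ring.
have int3C (m : int) : (3 * m)%:~R = ((3 * m%:~R : R)%:C)%C.
  by rewrite -intC; congr (_%:C)%C; ring.
rewrite !int3C; move: (om ^+ pi i) th1 th2 => u e1 e2.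
move: ((bcf_b f)%:~R : R) ((bcf_c f)%:~R : R) (x%:~R : R) (y%:~R : R) => b' c' x' y'.
rewrite !(rmorphN, rmorphXn, rmorphD, rmorphM, rmorph1) /=.
exact: trace_zero_fourier.
Qed.

(** By [cc_minkowski] the Minkowski form is proportional to A1^2 (x + th1 y)^2 + B1^2 (x + th2 y)^2.
    As A1^2 and B1^2 vary, the points of such forms trace the geodesic from th1 to th2, with time
    log |B1 / A1| = log |sg / tu|. *)
Lemma cc_shape_time : bqf_point (minkowski_form (cc_basis D)
    (fun i x => cc_emb D i (cc_incl D x))) = gamma Q (form_time R Q f).
Proof.
have a0 := anisotropic_a_neq0.
have [sg sgE] := cube_root_exists (cofactor1 R Q f).
have [tu tuE] := cube_root_exists (cofactor2 R Q f).
have [s0 t0] := cube_roots_neq0 r_neq0 D_gt0 n_gt0 fH sgE tuE.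
have ME x y : \sum_i ComplexField.Normc.normc
    (cc_emb D i (cc_incl D (perp_comb (cc_basis D) x y))) ^+ 2 =
    3 * ((sg * tu ^+ 2 * (x%:~R + th1 * y%:~R)) ^+ 2 +
       (sg ^+ 2 * tu * (x%:~R + th2 * y%:~R)) ^+ 2).
  exact: cc_minkowski.
have tE : expR (form_time R Q f) = `|sg / tu|.
  rewrite /form_time -sgE -tuE -expr_div_n normrX lnXn ?normr_gt0 ?mulf_neq0 ?invr_neq0 //.
  have -> (z : R) : z *+ 3 / 3 = z by field.
  by rewrite lnK ?posrE ?normr_gt0 ?mulf_neq0 ?invr_neq0.
have th12 : th1 < th2 by exact: root_lt.
rewrite gammaE geodesicE tE real_normK ?num_real // /minkowski_form /bqf_of !ME /bqf_point /=.
pose A1 := sg * tu ^+ 2; pose B1 := sg ^+ 2 * tu.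
have AB0 : A1 ^+ 2 + B1 ^+ 2 != 0.
  rewrite gt_eqF // ltr_pwDl ?sqr_ge0 // exprn_even_gt0 //=.
  by rewrite mulf_neq0 // expf_neq0.
have st0 : sg ^+ 2 + tu ^+ 2 != 0.
  by rewrite gt_eqF // ltr_pwDl ?sqr_ge0 // exprn_even_gt0.
congr Complex.
  by field; rewrite t0 [tu ^+ 2 + _]addrC st0 AB0.
set S := Num.sqrt _.
have -> : S = 6 * (`|A1| * `|B1| * (th2 - th1)).
  rewrite /S [X in Num.sqrt X](_ : _ = (6 * (`|A1| * `|B1| * (th2 - th1))) ^+ 2).
    rewrite sqrtr_sqr ger0_norm // !mulr_ge0 // subr_ge0 ltW //.
  transitivity (36 * (A1 ^+ 2 * B1 ^+ 2 * (th2 - th1) ^+ 2)); first by rewrite /A1 /B1; ring.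
  by rewrite -(real_normK (num_real A1)) -(real_normK (num_real B1)); ring.
pose p := `|sg|; pose q := `|tu|.
have p0 : p != 0 by rewrite normr_eq0.
have q0 : q != 0 by rewrite normr_eq0.
have sg2 : sg ^+ 2 = p ^+ 2 by rewrite real_normK ?num_real.
have tu2 : tu ^+ 2 = q ^+ 2 by rewrite real_normK ?num_real.
have -> : `|A1| = p * q ^+ 2 by rewrite /A1 normrM normrX.
have -> : `|B1| = p ^+ 2 * q by rewrite /B1 normrM normrX.
have -> : `|sg / tu| = p / q by rewrite normrM normfV.
rewrite expr_div_n !exprMn sg2 tu2.
have pq0 : q ^+ 2 + p ^+ 2 != 0 by rewrite -sg2 -tu2 addrC.
have pq1 : (p * (q * q)) ^+ 2 + (p * p * q) ^+ 2 != 0.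
  rewrite [X in X != 0](_ : _ = p ^+ 2 * q ^+ 2 * (q ^+ 2 + p ^+ 2)); last by ring.
  by rewrite mulf_neq0 ?pq0 // mulf_neq0 // expf_neq0.
by field; rewrite q0 pq0 pq1.
Qed.

End Shape.

(** These are trace identities: w and h have traces b and -c, and the new basis vectors b' and -c'.
    They are derived from the vanishing of the coordinates of w'h' along w and h. *)
Lemma table_shift (A : oriented_cubic_ring) f f' (w h : A) k p q l u v :
  obasis w h -> table f w h -> p * v - q * u = 1 ->
  table f' (lin w h k p q) (lin w h l u v) ->
  3 * k = bcf_b f' - bcf_b f * p + bcf_c f * q /\
  3 * l = - bcf_c f' - bcf_b f * u + bcf_c f * v.
Proof.
move=> ob tb dt tb'; rewrite (table_change ob tb dt tb').
have [wh _ _] := tb'; move: wh; rewrite (lin_mul _ _ _ _ _ _ tb).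
rewrite -[RHS](_ : lin w h (- (bcf_a f' * bcf_d f')) 0 0 = _); last by rewrite /lin; ring.
move=> /(lin_inj ob)[_]; case: (f) => a b c d /= e1 e2.
split.
- transitivity (3 * (k * (p * v - q * u))); first by rewrite dt mulr1.
  have -> : k * (p * v - q * u) = p * (k * v + q * l - a * p * u - c * q * v)
    - q * (k * u + p * l + b * p * u + d * q * v)
    + (a * p ^+ 2 * u + b * p * q * u + c * p * q * v + d * q ^+ 2 * v) by ring.
  rewrite e1 e2 !mulr0 subr0 add0r.
  transitivity ((3 * a * p ^+ 2 * u + b * (p ^+ 2 * v + 2 * p * q * u) +
     c * (q ^+ 2 * u + 2 * p * q * v) + 3 * d * q ^+ 2 * v)
     - b * p * (p * v - q * u) + c * q * (p * v - q * u)); first by ring.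
  by rewrite dt !mulr1.
- transitivity (3 * (l * (p * v - q * u))); first by rewrite dt mulr1.
  have -> : l * (p * v - q * u) = v * (k * u + p * l + b * p * u + d * q * v)
    - u * (k * v + q * l - a * p * u - c * q * v)
    - (a * p * u ^+ 2 + b * p * u * v + c * q * u * v + d * q * v ^+ 2) by ring.
  rewrite e1 e2 !mulr0 subr0 add0r.
  transitivity (- (3 * a * p * u ^+ 2 + b * (q * u ^+ 2 + 2 * p * u * v)
       + c * (p * v ^+ 2 + 2 * q * u * v) + 3 * d * q * v ^+ 2)
     - b * u * (p * v - q * u) + c * v * (p * v - q * u)); first by ring.
  by rewrite dt !mulr1.
Qed.

(** The field, the inclusion and the embeddings are kept and only the basis is replaced, so that
    both Minkowski forms are values of one function. The shifts are 0 because the new basis is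
    already normalized. *)
Lemma order_change (R : realType) (A : oriented_cubic_ring)
    (D : complex_cubic_order R A) f k l p q u v :
  table f (cc_basis D 1 - k%:~R) (cc_basis D 2 - l%:~R) -> p * v - q * u = 1 ->
  exists D' : complex_cubic_order R A,
    table (bcf_act f p q u v) (cc_basis D' 1 - 0%:~R) (cc_basis D' 2 - 0%:~R) /\
    forall i x y, order_emb D' i (perp_comb (cc_basis D') x y) =
      order_emb D i (perp_comb (cc_basis D) (x * p + y * u) (x * q + y * v)).
Proof.
move=> tb dt; have ob := cc_obasis_shift D k l.
have [k' [l' [ob' tb']]] := has_form_act ob tb dt.
have [kE lE] := table_shift ob tb dt tb'.
set w := cc_basis D 1 - _ in ob tb ob' tb'.
set h := cc_basis D 2 - _ in ob tb ob' tb'.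
have bZ : Zbasis (triple 1 (lin w h k' p q) (lin w h l' u v)).
  by have [S I _] := ob'; apply/Zbasis_triple.
have bo : orientation (triple 1 (lin w h k' p q) (lin w h l' u v) 0)
    (triple 1 (lin w h k' p q) (lin w h l' u v) 1)
    (triple 1 (lin w h k' p q) (lin w h l' u v) 2) = 1 by have [_ _ ->] := ob'.
exists (Build_complex_cubic_order (cc_dim D) (@cc_incl_inj _ _ D) (@cc_emb_distinct _ _ D)
  (@cc_emb_real _ _ D) (@cc_emb_complex _ _ D) bZ erefl bo).
set D' := Build_complex_cubic_order _ _ _ _ _ _ _ _.
have tb0 : table (bcf_act f p q u v) (cc_basis D' 1 - 0%:~R) (cc_basis D' 2 - 0%:~R).
  by rewrite !subr0.
split=> // i x y; rewrite (perp_comb_lin (cc_basisP D') (cc_basis0 D') tb0).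
rewrite (perp_comb_lin (cc_basisP D) (cc_basis0 D) tb) !subr0 -/w -/h.
rewrite lin_lin /order_emb; congr (cc_emb D i (cc_incl D _)); congr lin; try ring.
transitivity (- bcf_b (bcf_act f p q u v) * x + bcf_c (bcf_act f p q u v) * y
  + x * (3 * k') + y * (3 * l')); first by ring.
by rewrite kE lE; ring.
Qed.

(** Equivariance of the point of a definite form; the matrix has the same arrangement as in
    [period_mobius], where it acts on the roots of [Q]. *)
Lemma bqf_point_act (R : realType) (P : bqf R) (p q u v : int) :
  0 < bqf_r P -> 0 < 4 * bqf_r P * bqf_t P - bqf_s P ^+ 2 -> p * v - q * u = 1 ->
  bqf_point (bqf_of (fun x y : int => bqf_ev P (x * p + y * u)%:~R (x * q + y * v)%:~R)) =
  mobius (\matrix_(i, j) if i == 0 then if j == 0 then v else u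
                         else if j == 0 then q else p) (bqf_point P).
Proof.
case: P => r s t /=; set Dl := _ - _ => r0 D0 dt.
have dtR : p%:~R * v%:~R - q%:~R * u%:~R = 1 :> R by rewrite -!rmorphM -rmorphB dt.
pose r' := r * p%:~R ^+ 2 + s * p%:~R * q%:~R + t * q%:~R ^+ 2.
pose s' := 2 * (r * p%:~R * u%:~R + t * q%:~R * v%:~R)
  + s * (p%:~R * v%:~R + q%:~R * u%:~R).
pose t' := r * u%:~R ^+ 2 + s * u%:~R * v%:~R + t * v%:~R ^+ 2.
have -> : bqf_of (fun x y : int => bqf_ev (BQF r s t) (x * p + y * u)%:~R (x * q + y * v)%:~R)
    = BQF r' s' t'.
  by rewrite /bqf_of /bqf_ev /=; congr BQF; rewrite /r' /s' /t'; ring.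
have DlE : 4 * r' * t' - s' ^+ 2 = Dl.
  transitivity (Dl * (p%:~R * v%:~R - q%:~R * u%:~R) ^+ 2).
    by rewrite /Dl /r' /s' /t'; ring.
  by rewrite dtR expr1n mulr1.
have pq0 : (2 * r * p%:~R + s * q%:~R) ^+ 2 + Dl * q%:~R ^+ 2 > 0.
  rewrite lt0r; apply/andP; split; last first.
    by rewrite addr_ge0 ?sqr_ge0 // mulr_ge0 ?sqr_ge0 // ltW.
  rewrite paddr_eq0 ?sqr_ge0 //; last by rewrite mulr_ge0 ?sqr_ge0 // ltW.
  rewrite [Dl * _ == 0]mulf_eq0 (gt_eqF D0) !expf_eq0 /=; apply/negP => /andP[/eqP E /eqP q0].
  move: E; rewrite q0 mulr0 addr0 => /eqP; rewrite !mulf_eq0 pnatr_eq0 (gt_eqF r0) /=.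
  move=> /eqP p0; move: dtR; rewrite p0 q0 !mul0r subrr => /eqP.
  by rewrite eq_sym oner_eq0.
have r'0 : 0 < r'.
  have : 0 < 4 * r * r'.
    by rewrite [X in 0 < X](_ : _ = (2 * r * p%:~R + s * q%:~R) ^+ 2 + Dl * q%:~R ^+ 2) //
      /r' /Dl; ring.
  by rewrite pmulr_rgt0 // mulr_gt0.
pose S := Num.sqrt Dl.
have S2 : S ^+ 2 = Dl by rewrite sqr_sqrtr // ltW.
have S0 : S != 0 by rewrite gt_eqF // sqrtr_gt0.
rewrite /bqf_point /mobius !mxE /= DlE -/Dl -/S.
have rn0 : r != 0 by rewrite gt_eqF.
have r'n0 : r' != 0 by rewrite gt_eqF.
rewrite !complex_intE.
set den := _ * _ + Complex p%:~R 0.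
have den0 : den != 0.
  rewrite /den eq_complex /= !mul0r subr0 !addr0.
  apply/negP => /andP[/eqP E1 /eqP E2].
  move: pq0; rewrite [X in 0 < X](_ : _ = (2 * r) ^+ 2 * (q%:~R * (s / (2 * r)) + p%:~R) ^+ 2
     + Dl * q%:~R ^+ 2); last by field.
  rewrite E1 expr0n mulr0 add0r.
  have -> : Dl * q%:~R ^+ 2 = (2 * r) ^+ 2 * (q%:~R * (S / (2 * r))) ^+ 2.
    by rewrite -S2; field.
  by move: E2 => /eqP; rewrite mulf_eq0 => /orP[] /eqP ->; rewrite ?mul0r ?mulr0 expr0n mulr0 ltxx.
apply/eqP; rewrite -(inj_eq (mulIf den0)) divfK // /den eq_complex /=.
have dlq : q%:~R * S ^+ 2 = q%:~R * (p%:~R * v%:~R - q%:~R * u%:~R) * (4 * r * t - s ^+ 2).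
  by rewrite dtR mulr1 S2.
apply/andP; split; apply/eqP.
- have E : s' * (q%:~R * s + 2 * r * p%:~R) - q%:~R * S ^+ 2 = 2 * r' * (v%:~R * s + 2 * r * u%:~R).
    by rewrite dlq /r' /s'; ring.
  apply: (@mulfI _ (4 * r * r')); first by rewrite !mulf_neq0 ?pnatr_eq0.
  transitivity (s' * (q%:~R * s + 2 * r * p%:~R) - q%:~R * S ^+ 2).
    by field; rewrite rn0 r'n0.
  by rewrite E; field.
- have E : s' * q%:~R + q%:~R * s + 2 * r * p%:~R = 2 * r' * v%:~R.
    transitivity (s' * q%:~R + (q%:~R * s + 2 * r * p%:~R) * (p%:~R * v%:~R - q%:~R * u%:~R)).
      by rewrite dtR; ring.
    by rewrite /r' /s'; ring.
  apply: (@mulfI _ (4 * r * r')); first by rewrite !mulf_neq0 ?pnatr_eq0.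
  transitivity (S * (s' * q%:~R + q%:~R * s + 2 * r * p%:~R)).
    by field; rewrite rn0 r'n0.
  by rewrite E; field.
Qed.

(** The conventions sqrt x = 0 for x < 0 and 1 / 0 = 0 allow a converse: a point with positive
    imaginary part can only come from a positive definite form. *)
Lemma bqf_point_half_plane (R : realType) (P : bqf R) : half_plane R (bqf_point P) ->
  0 < bqf_r P /\ 0 < 4 * bqf_r P * bqf_t P - bqf_s P ^+ 2.
Proof.
rewrite /half_plane /bqf_point /=; set Dl := _ - _.
have S0 : 0 <= Num.sqrt Dl by exact: sqrtr_ge0.
move=> H; have r0 : 0 < bqf_r P.
  rewrite ltNge; apply/negP => r0; move: H; rewrite ltNge mulr_ge0_le0 //.
  by rewrite invr_le0 mulr_ge0_le0.
split => //; rewrite -sqrtr_gt0 lt_neqAle S0 andbT eq_sym; apply/eqP => E.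
by move: H; rewrite E mul0r ltxx.
Qed.

Lemma mobius_half_plane (R : realType) (g : 'M[int]_2) (z : R[i]) : \det g = 1 ->
  half_plane R z -> half_plane R (mobius g z).
Proof.
move=> dg zH.
have := @mobius_den_neq0 R g (SigSub (mem_set zH) : set_type (half_plane R)) dg.
have dgR : (g 0 0)%:~R * (g 1 1)%:~R - (g 0 1)%:~R * (g 1 0)%:~R = 1 :> R.
  by rewrite -!rmorphM -rmorphB -det_mx22E dg.
case: z zH => a b; rewrite /half_plane /mobius /= => b0.
rewrite !complex_intE eq_complex /= => den0.
rewrite !mul0r !subr0 !addr0 in den0 *.
set C := _ + (g 1 1)%:~R in den0 *; set E := (g 1 0)%:~R * b in den0 *.
have N0 : 0 < C ^+ 2 + E ^+ 2.
  by rewrite lt0r addr_ge0 ?sqr_ge0 // andbT paddr_eq0 ?sqr_ge0 // !expf_eq0.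
set A := _ + (g 0 1)%:~R; set B := (g 0 0)%:~R * b.
have BCE : B * C - A * E = b.
  rewrite -[RHS]mulr1 -[X in _ = _ * X]dgR /A /B /C /E; ring.
rewrite [X in 0 < X](_ : _ = (B * C - A * E) / (C ^+ 2 + E ^+ 2)).
  by rewrite BCE divr_gt0.
by field; exact: lt0r_neq0.
Qed.

(* What membership of an order in the count means in terms of its form. *)
Definition counted_form (Q : bqf int) (n : int) (f : bcf) : Prop :=
  [/\ 0 < n, hessian f = bqf_scale n Q & anisotropic f].

(** * From orders to forms *)

Section CountedOrders.
Variables (R : realType) (Q : bqf int).
Hypotheses (Q_primitive : bqf_primitive Q).
Hypotheses (r_neq0 : bqf_r Q != 0) (D_gt0 : 0 < bqf_disc Q).

(** In the given basis the trace form is only equivalent to [Q]. The shape is computed by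
    [cc_shape_time] in a basis with Hessian n Q, and brought back by the inverse substitution, which
    does not change its class. *)
Lemma order_form (A : oriented_cubic_ring) (D : complex_cubic_order R A) :
  bqf_equiv Q (cc_trace_form D) -> exists f n,
  [/\ has_form A f, counted_form Q n f, 3 * `|cc_disc D| = n ^+ 2 * bqf_disc Q &
      cc_shape D = modular_class (gamma Q (form_time R Q f))].
Proof.
have [f0 [k [l tb]]] := obasis_table (cc_obasis D).
have bZ := cc_basisP D; have b0 := cc_basis0 D.
rewrite /cc_trace_form (trace_form_hessian bZ b0 tb) => /(trace_form_equiv Q_primitive).
move=> [p [q [u [v [n [dt n0 fH]]]]]].
have [D' [tb' embE]] := order_change tb dt.
set f := bcf_act f0 p q u v in fH tb' *.
exists f, n; split.
- by exists (cc_basis D' 1 - 0%:~R), (cc_basis D' 2 - 0%:~R); split => //; exact: cc_obasis_shift.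
- by split => //; exact: (cc_anisotropic tb').
- have E := hessian_scale_disc fH.
  rewrite /cc_disc (ring_disc_form bZ b0 tb) -(bcf_disc_act f0 dt) -/f.
  by rewrite -[3]ger0_norm // -normrM E normrN ger0_norm // mulr_ge0 ?sqr_ge0 // ltW.
have st := cc_shape_time r_neq0 D_gt0 n0 fH tb'.
have gH : half_plane R (gamma Q (form_time R Q f)) by exact: gamma_half_plane.
pose P' := minkowski_form (cc_basis D') (fun i x => cc_emb D' i (cc_incl D' x)).
have [P'r P'D] : 0 < bqf_r P' /\ 0 < 4 * bqf_r P' * bqf_t P' - bqf_s P' ^+ 2.
  by apply: bqf_point_half_plane; rewrite /P' st.
pose F (x y : int) : R := \sum_i ComplexField.Normc.normc
   (order_emb D i (perp_comb (cc_basis D) x y)) ^+ 2.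
pose F' (x y : int) : R := \sum_i ComplexField.Normc.normc
   (order_emb D' i (perp_comb (cc_basis D') x y)) ^+ 2.
have FE x y : F' x y = F (x * p + y * u) (x * q + y * v).
  by apply: eq_bigr => i _; rewrite embE.
have F'E x y : F' x y = bqf_ev P' x%:~R y%:~R.
  have [sg sgE] := cube_root_exists (cofactor1 R Q f).
  have [tu tuE] := cube_root_exists (cofactor2 R Q f).
  have ME x' y' := cc_minkowski r_neq0 D_gt0 n0 fH tb' x' y' sgE tuE.
  rewrite /P' /minkowski_form /bqf_of /bqf_ev /= -!/(order_emb D' _ _) -!/(F' _ _).
  by rewrite /F' !ME; ring.
have PE : minkowski_form (cc_basis D) (fun i x => cc_emb D i (cc_incl D x)) =
   bqf_of (fun x y : int => bqf_ev P' (x * v + y * (- u))%:~R (x * (- q) + y * p)%:~R).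
  rewrite /minkowski_form; congr bqf_of; apply/funext => x; apply/funext => y.
  rewrite -F'E FE -/(F x y); congr F.
    transitivity (x * (p * v - q * u)); first by rewrite dt mulr1.
    by ring.
  transitivity (y * (p * v - q * u)); first by rewrite dt mulr1.
  by ring.
have dt' : v * p - (- q) * (- u) = 1 by rewrite -dt; ring.
have mE := bqf_point_act P'r P'D dt'.
rewrite /cc_shape PE mE {1}/P' st; apply/esym.
set g := \matrix_(_, _) _.
have dg : \det g = 1 by rewrite det_mx22E !mxE /= -dt; ring.
by apply: (modular_class_mobius _ _ dg erefl) => //; exact: mobius_half_plane.
Qed.
End CountedOrders.

(** * Embeddings of a field generated by a root *)

Section PolynomialEmbedding.
Variables (C : numFieldType) (p : {poly rat}) (L : fieldExtType rat) (z : L).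
Hypotheses (p_irr : irreducible_poly p) (pz : root (map_poly (in_alg L) p) z).
Hypothesis L_gen : <<1; z>>%VS = fullv.

Lemma adjoin_poly_exists (x : L) : exists q, x = (map_poly (in_alg L) q).[z].
Proof.
have : x \in <<1; z>>%VS by rewrite L_gen memvf.
by move=> /Fadjoin_polyP[q0 /polyOver1P[q ->] ->]; exists q.
Qed.

Lemma irreducible_root_dvdp (q : {poly rat}) :
  root (map_poly (in_alg L) q) z -> p %| q.
Proof.
move=> qz; apply/negPn/negP => npq.
have : coprimep p q by rewrite (irreducible_poly_coprime q p_irr).
move=> /Bezout_eq1_coprimepP[[u v] /= uv].
have := congr1 (fun s => (map_poly (in_alg L) s).[z]) uv.
rewrite rmorphD !rmorphM /= hornerD !hornerM (eqP pz) (eqP qz) !mulr0 addr0.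
by rewrite rmorph1 hornerC => /eqP; rewrite eq_sym oner_eq0.
Qed.

(** Each element is written as a polynomial in z by a choice [co]; two expressions differ by a
    multiple of p, which vanishes at y, so that the value is well defined and the map is a
    morphism. *)
Lemma root_embedding (y : C) : root (map_poly ratr p) y ->
  exists s : {rmorphism L -> C}, forall q,
    s (map_poly (in_alg L) q).[z] = (map_poly ratr q).[y].
Proof.
move=> py; pose co x := projT1 (cid (adjoin_poly_exists x)).
have coE x : x = (map_poly (in_alg L) (co x)).[z] by exact: projT2 (cid (adjoin_poly_exists x)).
pose s x := (map_poly ratr (co x)).[y].
have sE q : s (map_poly (in_alg L) q).[z] = (map_poly ratr q).[y].
  apply/eqP; rewrite /s -subr_eq0 -hornerN -hornerD -rmorphB.
  set q' := co _ - q; have /dvdpP[u ->] : p %| q'.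
    apply: irreducible_root_dvdp.
    by rewrite /q' rmorphB /= /root hornerD hornerN -coE subrr.
  by rewrite rmorphM /= hornerM (eqP py) mulr0.
have sB : zmod_morphism s.
  move=> x x'; rewrite (coE x) (coE x') -hornerN -hornerD -rmorphB !sE.
  by rewrite rmorphB hornerD hornerN.
have sM : monoid_morphism s.
  split.
    have -> : 1 = (map_poly (in_alg L) 1).[z] by rewrite rmorph1 hornerC.
    by rewrite sE rmorph1 hornerC.
  move=> x x'; rewrite (coE x) (coE x') -hornerM -rmorphM !sE.
  by rewrite rmorphM hornerM.
pose mB := GRing.isZmodMorphism.Build L C s sB.
pose mM := GRing.isMonoidMorphism.Build L C s sM.
pose sh : {rmorphism L -> C} := HB.pack s mB mM.
by exists sh.
Qed.

End PolynomialEmbedding.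

(** The characteristic polynomial of w. Its product with a is f(X, -a), so that a rational root of
    it is a rational zero of f. *)
Definition char_poly_form (f : bcf) : {poly rat} :=
  'X^3 - (bcf_b f)%:~R *: 'X^2 + (bcf_a f * bcf_c f)%:~R *: 'X
  - ((bcf_a f ^+ 2 * bcf_d f)%:~R)%:P.

Lemma size_char_poly_form f : size (char_poly_form f) = 4%N.
Proof.
rewrite /char_poly_form -!addrA size_polyDl ?size_polyXn //.
rewrite (leq_ltn_trans (size_polyD _ _)) // gtn_max size_polyN.
rewrite (leq_ltn_trans (size_scale_leq _ _)) ?size_polyXn //=.
rewrite (leq_ltn_trans (size_polyD _ _)) // gtn_max size_polyN.
rewrite (leq_ltn_trans (size_scale_leq _ _)) ?size_polyX //=.
by rewrite (leq_ltn_trans (size_polyC_leq1 _)).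
Qed.

Lemma char_poly_form_eval (F : fieldType) (phi : {rmorphism rat -> F}) f (X : F) :
  (map_poly phi (char_poly_form f)).[X] = X ^+ 3 - (bcf_b f)%:~R * X ^+ 2
    + (bcf_a f * bcf_c f)%:~R * X - (bcf_a f ^+ 2 * bcf_d f)%:~R.
Proof.
have E : map_poly phi (char_poly_form f) = 'X^3 - (bcf_b f)%:~R *: 'X^2
    + (bcf_a f * bcf_c f)%:~R *: 'X - ((bcf_a f ^+ 2 * bcf_d f)%:~R)%:P :> {poly F}.
  apply/polyP => i; rewrite coef_map /char_poly_form !(coefB, coefD, coefZ, coefXn, coefX, coefC) /=.
rewrite (rmorphB phi) (rmorphD phi) (rmorphB phi) !(rmorphM phi) !(rmorph_int phi).
  rewrite !(rmorph_nat phi); congr (_ - _).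
  by case: eqP; rewrite ?rmorph_int ?rmorph0.
by rewrite E !(hornerD, hornerN, hornerZ, hornerXn, hornerX, hornerC).
Qed.

Lemma char_poly_form_irreducible f : bcf_a f != 0 -> anisotropic f ->
  irreducible_poly (char_poly_form f).
Proof.
move=> a0 an; apply: cubic_irreducible => [|x]; first by rewrite size_char_poly_form.
apply/negP => /eqP x0.
have d0 : (denq x)%:~R != 0 :> rat by rewrite intr_eq0 denq_neq0.
have [] := an (numq x) (- bcf_a f * denq x).
  apply: (@intr_inj rat).
  have -> : (bcf_eval f (numq x) (- bcf_a f * denq x))%:~R =
     (bcf_a f)%:~R * (denq x)%:~R ^+ 3 * (map_poly ratr (char_poly_form f)).[x].
    rewrite char_poly_form_eval -{4 5 6}(divq_num_den x) /bcf_eval; by field.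
  rewrite (_ : map_poly ratr _ = char_poly_form f); first by rewrite x0 mulr0.
  by apply/polyP => i; rewrite coef_map /= /ratr divq_num_den.
by move=> _ /eqP; rewrite mulf_eq0 oppr_eq0 (negbTE a0) (negbTE (denq_neq0 x)).
Qed.

(** * From forms to orders *)

Section FormOrder.
Variables (R : realType) (Q : bqf int).
Hypotheses (Q_primitive : bqf_primitive Q).
Hypotheses (r_neq0 : bqf_r Q != 0) (D_gt0 : 0 < bqf_disc Q).
Variables (f : bcf) (n : int).
Hypothesis fC : counted_form Q n f.

Let a_neq0 : bcf_a f != 0.
Proof.
have [_ _ an] := fC; apply/eqP => a0; have [] // := an 1 0.
by rewrite /bcf_eval a0; ring.
Qed.

Lemma form_cubic_field_embeddings (L : fieldExtType rat) (z : L) :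
  root (map_poly (in_alg L) (char_poly_form f)) z -> <<1; z>>%VS = fullv ->
  exists s : 'I_3 -> {rmorphism L -> R[i]},
    [/\ forall i j, s i =1 s j -> i = j, forall x, complex.Im (s 0 x) = 0 &
        forall i, i != 0 -> exists x, complex.Im (s i x) != 0].
Proof.
move=> pz Lgen; have [n0 fH an] := fC.
have p_irr := char_poly_form_irreducible a_neq0 an.
have [sg sgE] := cube_root_exists (cofactor1 R Q f).
have [tu tuE] := cube_root_exists (cofactor2 R Q f).
pose om := omega R; pose rt (j : 'I_3) := cubic_root f sg tu (om ^+ j).
have rtP j : root (map_poly ratr (char_poly_form f)) (rt j).
  have intC (m : int) : ((m%:~R : R)%:C)%C = m%:~R by rewrite rmorph_int.
  rewrite /root char_poly_form_eval -!intC.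
  have -> : (bcf_a f * bcf_c f)%:~R = (bcf_a f)%:~R * (bcf_c f)%:~R :> R by ring.
  have -> : (bcf_a f ^+ 2 * bcf_d f)%:~R = (bcf_a f)%:~R ^+ 2 * (bcf_d f)%:~R :> R by ring.
  rewrite (cubic_factor r_neq0 D_gt0 n0 fH sgE tuE).
  by elim/ord3P: j; rewrite /rt ?expr0 ?expr1 -?[nat_of_ord (1 + 1)]/2%N subrr ?mulr0 ?mul0r.
have sP j : exists s : {rmorphism L -> R[i]}, forall q,
    s (map_poly (in_alg L) q).[z] = (map_poly ratr q).[rt j].
  exact: (root_embedding p_irr pz Lgen (rtP j)).
pose s j := projT1 (cid (sP j)).
have sE j q : s j (map_poly (in_alg L) q).[z] = (map_poly ratr q).[rt j].
  exact: (projT2 (cid (sP j)) q).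
have sz j : s j z = rt j.
  have zE : z = (map_poly (in_alg L) 'X).[z] by rewrite map_polyX hornerX.
  by rewrite {1}zE sE map_polyX hornerX.
have im_neq0 := cubic_root_im_neq0 r_neq0 D_gt0 n0 fH a_neq0 sgE tuE.
set y := Num.sqrt 3 / 6 * _ in im_neq0.
have imE : complex.Im (rt 0) = 0 /\ complex.Im (rt 1) = y /\ complex.Im (rt (1 + 1)) = - y.
  have [] := cubic_root_im f sg tu.
  by rewrite /rt expr0 expr1 -[nat_of_ord (1 + 1)]/2%N.
have [im0 [im1 im2]] := imE.
exists s; split.
(* The three embeddings are told apart by the imaginary parts 0, y, -y of the images of z. *)
- have two0 : 2 != 0 :> R by [].
  have yNy : y <> - y.
    by move=> E; move/negP: im_neq0; apply; apply/eqP; lra.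
  move=> i j ij; have : complex.Im (rt i) = complex.Im (rt j).
    by rewrite -!sz ij.
  elim/ord3P: i {ij}; elim/ord3P: j; rewrite ?im0 ?im1 ?im2 // => E;
    exfalso; move/negP: im_neq0; apply; apply/eqP; lra.
- move=> x; have [q ->] := adjoin_poly_exists Lgen x; rewrite sE.
  have [x0 x0E] : exists x0 : R, rt 0 = (x0%:C)%C.
    by exists (complex.Re (rt 0)); move: im0; case: (rt 0) => u v /= ->.
  rewrite x0E.
  have -> : map_poly ratr q = map_poly (real_complex R) (map_poly ratr q).
    rewrite -map_poly_comp; apply: eq_map_poly => u /=.
    by rewrite fmorph_rat.
  by rewrite horner_map.
- move=> i i0; exists z; rewrite sz; move: i0.
  by elim/ord3P: i => // _; rewrite ?im1 ?im2 ?oppr_eq0.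
Qed.

Lemma form_order_exists : exists D : complex_cubic_order R (ring_of_form f),
  cc_basis D = triple 1 (cubic_w f) (cubic_h f).
Proof.
have [n0 fH an] := fC.
have p_irr := char_poly_form_irreducible a_neq0 an.
have [L dimL [z pz Lgen]] := irredp_FAdjoin p_irr.
rewrite size_char_poly_form in dimL.
have [s [s_inj s_re s_im]] := form_cubic_field_embeddings pz Lgen.
have intA (m : int) : (m%:~R)%:A = m%:~R :> L by rewrite scaler_int.
have aL : (bcf_a f)%:~R != 0 :> L by rewrite -intA scaler_eq0 oner_eq0 orbF intr_eq0.
have zE : z ^+ 3 = (bcf_b f)%:~R * z ^+ 2 - (bcf_a f * bcf_c f)%:~R * z
    + (bcf_a f ^+ 2 * bcf_d f)%:~R.
  have := eqP pz; rewrite char_poly_form_eval => E.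
  by apply/eqP; rewrite -subr_eq0 -[X in _ == X]E; apply/eqP; ring.
(* The relation w^2 = -ac + bw - ah with w = z leaves no other choice. *)
pose h : L := ((bcf_b f)%:~R * z - (bcf_a f * bcf_c f)%:~R - z ^+ 2) / (bcf_a f)%:~R.
have zh : z * h = (- (bcf_a f * bcf_d f))%:~R.
  have -> : z * h = ((bcf_b f)%:~R * z ^+ 2 - (bcf_a f * bcf_c f)%:~R * z - z ^+ 3) / (bcf_a f)%:~R.
    by rewrite /h; field.
  by rewrite zE; field.
have tb : table f z h.
  split => //; first by rewrite /lin /h; field.
  have -> : h * h = ((bcf_b f)%:~R * (z * h) - (bcf_a f * bcf_c f)%:~R * h - z * (z * h)) / (bcf_a f)%:~R.
    by rewrite {2}/h; field.
  by rewrite zh /lin; field.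
have lin_free x y u : lin z h x y u = 0 -> [/\ x = 0, y = 0 & u = 0].
  (* a times the combination is a polynomial of degree at most 2 in z; vanishing at z, it is
     divisible by an irreducible cubic, hence zero. *)
  move=> E; pose q : {poly rat} := (bcf_a f * x - bcf_a f * bcf_c f * u)%:~R%:P
    + (bcf_a f * y + bcf_b f * u)%:~R *: 'X - u%:~R *: 'X^2.
  have qz : root (map_poly (in_alg L) q) z.
    rewrite /root (_ : map_poly _ q = (bcf_a f * x - bcf_a f * bcf_c f * u)%:~R%:P
      + (bcf_a f * y + bcf_b f * u)%:~R *: 'X - u%:~R *: 'X^2); last first.
      by rewrite /q rmorphB rmorphD /= map_polyC !map_polyZ map_polyX map_polyXn /= !intA.
    rewrite !(hornerD, hornerN, hornerZ, hornerXn, hornerX, hornerC).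
    apply/eqP; transitivity ((bcf_a f)%:~R * lin z h x y u); last by rewrite E mulr0.
    by rewrite /lin /h; field.
  have pq := irreducible_root_dvdp p_irr pz qz.
  have q0 : q = 0.
    apply/eqP/negPn/negP => q0; have := dvdp_leq q0 pq.
    rewrite size_char_poly_form leqNgt => /negP; apply.
    rewrite /q; apply: leq_ltn_trans (size_polyD _ _) _; rewrite gtn_max size_polyN.
    apply/andP; split; last by rewrite (leq_ltn_trans (size_scale_leq _ _)) ?size_polyXn.
    apply: leq_ltn_trans (size_polyD _ _) _; rewrite gtn_max.
    rewrite (leq_ltn_trans (size_polyC_leq1 _)) //=.
    by rewrite (leq_ltn_trans (size_scale_leq _ _)) ?size_polyX.
  have coq i : q`_i = 0 by rewrite q0 coef0.
  have u0 : u = 0.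
    apply/eqP; rewrite -(intr_eq0 rat) -oppr_eq0; apply/eqP; rewrite -[RHS](coq 2%N).
    by rewrite /q !(coefB, coefD, coefZ, coefXn, coefX, coefC) /= !(mulr0, mulr1, addr0, add0r, subr0, sub0r).
  have y0 : y = 0.
    apply/eqP; rewrite -(inj_eq (mulfI a_neq0)) mulr0 -(intr_eq0 rat); apply/eqP.
    rewrite -[RHS](coq 1%N) /q u0.
    by rewrite !(coefB, coefD, coefZ, coefXn, coefX, coefC) /= !(mulr0, mulr1, addr0, add0r, subr0, sub0r).
  split=> //; apply/eqP; rewrite -(inj_eq (mulfI a_neq0)) mulr0 -(intr_eq0 rat); apply/eqP.
  rewrite -[RHS](coq 0%N) /q u0 y0.
  by rewrite !(coefB, coefD, coefZ, coefXn, coefX, coefC) /= !(mulr0, mulr1, addr0, add0r, subr0, sub0r).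
pose w' := cubic_w f; pose h' := cubic_h f.
have tb' : @table f (ring_of_form f) w' h' by exact: ring_of_form_table.
pose F (t : ring_of_form f) : L := lin z h t.1.1 t.1.2 t.2.
have FE x y u : F (lin w' h' x y u) = lin z h x y u by rewrite /F cubic_linE.
have S := @cubic_obasis_span f.
have FB : zmod_morphism F.
  move=> t1 t2; have [x [y [u ->]]] := S t1; have [x' [y' [u' ->]]] := S t2.
  by rewrite linB !FE linB.
have FM : monoid_morphism F.
  split; first by rewrite -(lin100 w' h') FE lin100.
  move=> t1 t2; have [x [y [u ->]]] := S t1; have [x' [y' [u' ->]]] := S t2.
  by rewrite (lin_mul _ _ _ _ _ _ tb') !FE (lin_mul _ _ _ _ _ _ tb).
pose FA := GRing.isZmodMorphism.Build (ring_of_form f) L F FB.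
pose FM' := GRing.isMonoidMorphism.Build (ring_of_form f) L F FM.
pose G : {rmorphism (ring_of_form f) -> L} := HB.pack F FA FM'.
have G_inj : injective G.
  apply: raddf_inj => t; have [x [y [u ->]]] := S t.
  by rewrite /= FE => /lin_free[-> -> ->]; rewrite /lin; ring.
have bZ : Zbasis (triple 1 w' h' : 'I_3 -> ring_of_form f).
  by apply/Zbasis_triple; split; [exact: cubic_obasis_span | exact: cubic_obasis_free].
have bo : orientation ((triple 1 w' h' : 'I_3 -> ring_of_form f) 0) (triple 1 w' h' 1)
  (triple 1 w' h' 2) = 1 by [].
by exists (Build_complex_cubic_order dimL G_inj s_inj s_re s_im bZ erefl bo).
Qed.

Lemma form_order : exists D : complex_cubic_order R (ring_of_form f),
  [/\ cc_trace_form D = Q, 3 * `|cc_disc D| = n ^+ 2 * bqf_disc Q &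
      cc_shape D = modular_class (gamma Q (form_time R Q f))].
Proof.
have [n0 fH an] := fC; have [D DE] := form_order_exists.
exists D.
have bZ := cc_basisP D; have b0 := cc_basis0 D.
have tb : table f (cc_basis D 1 - 0%:~R) (cc_basis D 2 - 0%:~R).
  by rewrite DE !subr0; exact: ring_of_form_table.
split.
- rewrite /cc_trace_form (trace_form_hessian bZ b0 tb) fH.
  rewrite -[RHS](primitive_part_scale (n := 6 * n)) ?mulr_gt0 //.
  by congr bqf_primitive_part; rewrite /bqf_scale /= !mulrA.
- have E := hessian_scale_disc fH.
  rewrite /cc_disc (ring_disc_form bZ b0 tb).
  by rewrite -[3]ger0_norm // -normrM E normrN ger0_norm // mulr_ge0 ?sqr_ge0 // ltW.
- by rewrite /cc_shape (cc_shape_time r_neq0 D_gt0 n0 fH tb).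
Qed.

End FormOrder.

(** * Reduction to counting forms *)

(** [num_classes] chooses some system of representatives. The first hypothesis, in place of an
    equivalence relation, is enough to inject any system into any other, whence equal sizes. *)
Lemma num_classes_eq (T : Type) (E : T -> T -> Prop) (P : T -> Prop) (n : nat)
    (s : 'I_n -> T) :
  (forall x x' y, P x -> P x' -> P y -> E x y -> E x' y -> E x x') ->
  (forall i, P (s i)) -> (forall i j, E (s i) (s j) -> i = j) ->
  (forall x, P x -> exists i, E x (s i)) -> num_classes E P = n.
Proof.
move=> EE sP sI sS; rewrite /num_classes; case: xgetP => [n' _|/(_ n)]; last first.
  by case; exists s.
move=> [s' [sP' sI' sS']].
have le n1 n2 (s1 : 'I_n1 -> T) (s2 : 'I_n2 -> T) : (forall i, P (s1 i)) ->
    (forall i, P (s2 i)) -> (forall i j, E (s1 i) (s1 j) -> i = j) ->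
    (forall x, P x -> exists i, E x (s2 i)) -> (n1 <= n2)%N.
  move=> P1 P2 I1 S2; pose F i := projT1 (cid (S2 _ (P1 i))).
  have FE i : E (s1 i) (s2 (F i)) by exact: projT2 (cid (S2 _ (P1 i))).
  have Finj : injective F.
    move=> i j Fij; apply: I1; apply: (EE _ _ (s2 (F i))) => //.
    by rewrite Fij.
  by have := leq_card F Finj; rewrite !card_ord.
by apply/eqP; rewrite eqn_leq !(le _ _ s' s, le _ _ s s').
Qed.

Section Reduction.
Variables (R : realType) (Q : bqf int).
Hypotheses (Q_primitive : bqf_primitive Q).
Hypotheses (r_neq0 : bqf_r Q != 0) (D_gt0 : 0 < bqf_disc Q).
Hypothesis Q_nonsquare : forall n : int, bqf_disc Q <> n ^+ 2.
Local Notation p0 := (gamma_period R Q).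

Lemma anisotropic_act f p q u v : p * v - q * u = 1 ->
  anisotropic f -> anisotropic (bcf_act f p q u v).
Proof.
move=> dt an x y; rewrite bcf_act_eval => /an[e1 e2]; split.
- transitivity (x * (p * v - q * u)); first by rewrite dt mulr1.
  transitivity ((x * p + y * u) * v - (x * q + y * v) * u); first by ring.
  by rewrite e1 e2 !mul0r subr0.
- transitivity (y * (p * v - q * u)); first by rewrite dt mulr1.
  transitivity ((x * q + y * v) * p - (x * p + y * u) * q); first by ring.
  by rewrite e1 e2 !mul0r subr0.
Qed.

Lemma counted_form_neg f n : counted_form Q n f ->
  counted_form Q n (bcf_act f (- 1) 0 0 (- 1)) /\
  form_time R Q (bcf_act f (- 1) 0 0 (- 1)) = form_time R Q f /\
  bcf_a (bcf_act f (- 1) 0 0 (- 1)) = - bcf_a f.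
Proof.
move=> [n0 fH an]; split; [split => //|split].
- by case: (f) fH => a b c d /= <-; congr BQF; ring.
- exact: anisotropic_act.
- have E1 : cofactor1 R Q (bcf_act f (- 1) 0 0 (- 1)) = - cofactor1 R Q f.
    by rewrite /cofactor1; case: (f) => a b c d /=; ring.
  have E2 : cofactor2 R Q (bcf_act f (- 1) 0 0 (- 1)) = - cofactor2 R Q f.
    by rewrite /cofactor2; case: (f) => a b c d /=; ring.
  by rewrite /form_time E1 E2 invrN mulrNN.
- by case: (f) => a b c d /=; ring.
Qed.

Lemma counted_form_period f n l : period Q l -> counted_form Q n f ->
  exists p q u v, [/\ p * v - q * u = 1, counted_form Q n (bcf_act f p q u v) &
    form_time R Q (bcf_act f p q u v) = form_time R Q f + l].
Proof.
move=> lP [n0 fH an]; have [p [q [u [v [dt fH' tE]]]]] := period_shift r_neq0 D_gt0 lP n0 fH.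
by exists p, q, u, v; split => //; split => //; exact: anisotropic_act.
Qed.

Lemma counted_form_period_nat f n l (m : nat) : period Q l -> counted_form Q n f ->
  exists p q u v, [/\ p * v - q * u = 1, counted_form Q n (bcf_act f p q u v) &
    form_time R Q (bcf_act f p q u v) = form_time R Q f + l *+ m].
Proof.
move=> lP fC; elim: m => [|m [p [q [u [v [dt fC' tE]]]]]].
  by exists 1, 0, 0, 1; rewrite bcf_act1 mulr0n addr0; split => //; ring.
have [p' [q' [u' [v' [dt' fC2 tE2]]]]] := counted_form_period lP fC'.
move: fC2 tE2; rewrite bcf_act_comp => fC2 tE2.
do 4 eexists; split; [|exact: fC2|by rewrite tE2 tE mulrSr addrA].
transitivity ((p' * v' - q' * u') * (p * v - q * u)); first by ring.
by rewrite dt dt' mulr1.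
Qed.

Lemma counted_form_domain f n : counted_form Q n f ->
  exists p q u v, [/\ p * v - q * u = 1, counted_form Q n (bcf_act f p q u v) &
    p0 <= form_time R Q (bcf_act f p q u v) < p0 + p0].
Proof.
move=> fC; have [p00 [p0P _]] := gamma_period_minimal R r_neq0 D_gt0 Q_nonsquare.
set t := form_time R Q f.
(* Subtracting 1 brings the time into [p0, 2 p0) instead of [0, p0). *)
pose k := Num.floor (t / p0) - 1.
have tk : p0 <= t - k%:~R * p0 < p0 + p0.
  have /andP[l u] := floor_itv (t / p0).
  rewrite ler_pdivlMr // in l; rewrite ltr_pdivrMr // rmorphD /= in u.
  by rewrite /k rmorphB /=; move: l u; lra.
have [k0|k0] := leP 0 k.
  have kE : `|k|%N%:R = k%:~R :> R by rewrite pmulrn gez0_abs.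
  have [p [q [u [v [dt fC' tE]]]]] := counted_form_period_nat `|k|%N (periodN p0P) fC.
  by exists p, q, u, v; split => //; rewrite tE mulNrn -mulr_natl kE.
have kE : `|k|%N%:R = - k%:~R :> R by rewrite pmulrn ltz0_abs // rmorphN.
have [p [q [u [v [dt fC' tE]]]]] := counted_form_period_nat `|k|%N p0P fC.
by exists p, q, u, v; split => //; rewrite tE -mulr_natl kE mulNr.
Qed.

(** The time gives |cf1 / cf2| and n gives the product cf1 cf2, so that the pair of cofactors is
    known up to a common sign, which the sign of a decides. *)
Lemma counted_form_inj f f' n : counted_form Q n f -> counted_form Q n f' ->
  0 < bcf_a f -> 0 < bcf_a f' -> form_time R Q f = form_time R Q f' -> f = f'.
Proof.
move=> [n0 fH an] [_ fH' an'] a0 a0' tE.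
have n0' : n != 0 by rewrite gt_eqF.
have P := cofactor_prod R r_neq0 D_gt0 n0' fH.
have P' := cofactor_prod R r_neq0 D_gt0 n0' fH'.
have nr0 : n%:~R * (bqf_r Q)%:~R != 0 :> R by rewrite mulf_neq0 ?intr_eq0.
have [aE bE cE dE] := apolar_coefs R r_neq0 D_gt0 (hessian_apolar n0' fH).
have [aE' bE' cE' dE'] := apolar_coefs R r_neq0 D_gt0 (hessian_apolar n0' fH').
move: P P' tE aE bE cE dE aE' bE' cE' dE'; rewrite /form_time.
set x := cofactor1 R Q f; set y := cofactor2 R Q f.
set x' := cofactor1 R Q f'; set y' := cofactor2 R Q f' => P P' tE aE bE cE dE aE' bE' cE' dE'.
have [x0 y0] : x != 0 /\ y != 0 by apply/andP; rewrite -negb_or -mulf_eq0 P.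
have [x0' y0'] : x' != 0 /\ y' != 0 by apply/andP; rewrite -negb_or -mulf_eq0 P'.
have xyE : `|x / y| = `|x' / y'|.
  apply: ln_inj; rewrite ?posrE ?normr_gt0 ?mulf_neq0 ?invr_neq0 //.
  by apply: (mulIf (_ : 3^-1 != 0)) => //; rewrite invr_neq0 // pnatr_eq0.
have xy2 : x ^+ 2 = x' ^+ 2.
  have E1 : `|x| ^+ 2 = `|x / y| * `|x * y|.
    by rewrite !normrM normfV; field; rewrite normr_eq0.
  have E2 : `|x'| ^+ 2 = `|x' / y'| * `|x' * y'|.
    by rewrite !normrM normfV; field; rewrite normr_eq0.
  by rewrite -(real_normK (num_real x)) -(real_normK (num_real x')) E1 E2 xyE P P'.
have th0 : 0 < bqf_root2 R Q - bqf_root1 R Q by rewrite subr_gt0 root_lt.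
move/eqP: xy2; rewrite eqf_sqr => /orP[] /eqP xE.
  have yE : y = y' by apply: (mulfI x0); rewrite P xE P'.
  case: (f) aE bE cE dE => a b c d /= aE bE cE dE.
  case: (f') aE' bE' cE' dE' => a' b' c' d' /= aE' bE' cE' dE'.
  by congr BCF; apply: (@intr_inj R);
    rewrite ?aE ?bE ?cE ?dE ?aE' ?bE' ?cE' ?dE' xE yE.
have yE : y = - y' by apply: (mulfI x0); rewrite P xE mulrNN P'.
have : (bcf_a f)%:~R = - (bcf_a f')%:~R :> R.
  by rewrite aE aE' xE yE; ring.
have : 0 < (bcf_a f)%:~R :> R by rewrite ltr0z.
have : 0 < (bcf_a f')%:~R :> R by rewrite ltr0z.
by move=> h1 + h3; rewrite h3 oppr_gt0 ltNge (ltW h1).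
Qed.

(* One form in each class: the unit group acts through translations of the time
   by multiples of the period and through f |-> - f. *)
Definition reduced_form (X : R) (W : set (modular_surface R)) (f : bcf) : Prop :=
  exists n, [/\ counted_form Q n f, (n ^+ 2 * bqf_disc Q)%:~R < 3 * X, 0 < bcf_a f,
    p0 <= form_time R Q f < p0 + p0 & W (modular_class (gamma Q (form_time R Q f)))].

(** The finite type is arbitrary so that a box of lattice points, larger than the set of reduced
    forms, can serve for the enumeration. *)
Lemma N_rings_card (X : R) (W : set (modular_surface R)) (T : finType)
    (P : pred T) (g : T -> bcf) :
  {in P &, injective g} ->
  (forall x, P x -> reduced_form X W (g x)) ->
  (forall f, reduced_form X W f -> exists2 x, P x & g x = f) ->
  N_rings Q X W = #|P|.
Proof.
move=> g_inj gP gS.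
have [p00 [p0P p0min]] := gamma_period_minimal R r_neq0 D_gt0 Q_nonsquare.
have discE (d n : int) : 3 * d = n ^+ 2 * bqf_disc Q ->
    (d%:~R < X) = ((n ^+ 2 * bqf_disc Q)%:~R < 3 * X).
  by move=> <-; rewrite rmorphM /= ltr_pM2l.
rewrite /N_rings; set PP := fun A => _.
have PPform A : PP A -> exists f, has_form A f.
  by move=> [D [DQ _ _]]; have [f [n [fA _ _ _]]] := order_form Q_primitive r_neq0 D_gt0 DQ; exists f.
apply: (num_classes_eq (s := fun i : 'I_#|P| => ring_of_form (g (enum_val i)))).
- move=> A A' B /PPform[f Af] /PPform[f' Af'] /PPform[h Bh] AB A'B.
  exact: (has_form_iso (iso_has_form_inv AB Af Bh) (iso_has_form_inv A'B Af' Bh)).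
- move=> i; have [n [fC nX a0 tI Wt]] := gP _ (enum_valP i).
  have [D [DQ Dd Ds]] := form_order R Q_primitive r_neq0 D_gt0 fC.
  exists D; split; [|by rewrite (discE _ _ Dd)|by rewrite Ds].
  by rewrite DQ; exists 1%:M; rewrite ?det1 // => v; rewrite mulmx1.
- move=> i j ij; have [n [fC nX a0 tI Wt]] := gP _ (enum_valP i).
  have [n' [fC' nX' a0' tI' Wt']] := gP _ (enum_valP j).
  have [p [q [u [v [dt fE]]]]] := has_form_equiv
    (iso_has_form ij (ring_of_form_has_form _)) (ring_of_form_has_form (g (enum_val j))).
  have [n0 fH _] := fC; have [n0' fH' _] := fC'.
  have [nn lP] := form_equiv_period R r_neq0 D_gt0 n0 n0' fH fH' dt fE.
  rewrite nn in fC'.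
  (* The difference is a period of absolute value less than the least positive one. *)
  have tE : form_time R Q (g (enum_val i)) = form_time R Q (g (enum_val j)).
    set t := form_time _ _ (g (enum_val i)) in tI lP *.
    set t' := form_time _ _ (g (enum_val j)) in tI' lP *.
    apply/eqP; rewrite eq_le !leNgt; apply/andP; split; apply/negP => tt.
      have : p0 <= - (t' - t) by apply: p0min (periodN lP); lra.
      by move: tI tI' => /andP[? ?] /andP[? ?]; lra.
    have : p0 <= t' - t by apply: p0min lP; lra.
    by move: tI tI' => /andP[? ?] /andP[? ?]; lra.
  apply: enum_val_inj; apply: g_inj; [exact: enum_valP | exact: enum_valP |].
  exact: (counted_form_inj fC fC' a0 a0' tE).
- move=> A [D [DQ Dd Ds]].
  have [f [n [Af fC Df Dsh]]] := order_form Q_primitive r_neq0 D_gt0 DQ.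
  have [p [q [u [v [dt fC1 tI]]]]] := counted_form_domain fC.
  set f1 := bcf_act f p q u v in fC1 tI.
  have Af1 : has_form A f1 by exact: has_form_bcf_act.
  have Wt1 : W (modular_class (gamma Q (form_time R Q f1))).
    suff : modular_class (gamma Q (form_time R Q f)) = modular_class (gamma Q (form_time R Q f1)).
      by move=> <-; rewrite -Dsh.
    have [n0 fH _] := fC; have [_ fH1 _] := fC1.
    have [_ lP] := form_equiv_period R r_neq0 D_gt0 n0 n0 fH fH1 dt erefl.
    rewrite -(modular_class_period r_neq0 D_gt0 (form_time R Q f) lP).
    by congr (modular_class (gamma Q _)); ring.
  suff [f2 [Af2 f2R]] : exists f2, has_form A f2 /\ reduced_form X W f2.
    have [x Px gx] := gS _ f2R.
    exists (enum_rank_in Px x); rewrite enum_rankK_in // gx.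
    exact: has_form_iso Af2 (ring_of_form_has_form _).
  have nX : (n ^+ 2 * bqf_disc Q)%:~R < 3 * X by rewrite -(discE _ _ Df).
  have a0 : bcf_a f1 != 0.
    have [_ _ an] := fC1; apply/eqP => a0; have [] // := an 1 0.
    by rewrite /bcf_eval a0; ring.
  have [lt|gt|/eqP] := ltgtP (bcf_a f1) 0; last by rewrite (negbTE a0).
    have [fC2 [tE2 aE2]] := counted_form_neg fC1.
    exists (bcf_act f1 (- 1) 0 0 (- 1)); split; first exact: has_form_bcf_act.
    by exists n; rewrite tE2 aE2 oppr_gt0; split.
  by exists f1; split => //; exists n; split.
Qed.

End Reduction.

(** * Lattice points in sectors *)

Lemma minimal_positive (L : int -> Prop) : (exists2 x, 0 < x & L x) ->
  exists m, [/\ 0 < m, L m & forall x, 0 < x -> L x -> m <= x].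
Proof.
move=> [x x0 Lx].
have ex : exists k : nat, `[< (0 < k)%N /\ L k%:Z >].
  by exists `|x|%N; apply/asboolP; rewrite absz_gt0 gt_eqF // gtz0_abs.
case: (ex_minnP ex) => k /asboolP[k0 Lk] kmin.
exists k%:Z; split=> // y y0 Ly.
rewrite -(gtz0_abs y0) lez_nat; apply: kmin.
by apply/asboolP; rewrite absz_gt0 gt_eqF // gtz0_abs.
Qed.

(** Hermite normal form: a0 is the least positive first coordinate, b1 the least positive b with (0,
    b) in L, and Euclidean division does the rest. The points (k, 0) and (0, k) ensure rank 2. *)
Lemma hermite_basis (L : int -> int -> Prop) (k : int) :
  (forall m x y x' y', L x y -> L x' y' -> L (m * x + x') (m * y + y')) ->
  0 < k -> L k 0 -> L 0 k ->
  exists a0 b0 b1, [/\ 0 < a0, 0 < b1 &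
    forall a b, L a b <-> exists i j, a = i * a0 /\ b = i * b0 + j * b1].
Proof.
move=> lc k0 Lk0 L0k.
have [a0 [a00 [b0 Lab] a0min]] := @minimal_positive (fun a => exists b, L a b)
  (ex_intro2 _ _ k k0 (ex_intro _ 0 Lk0)).
have [b1 [b10 L0b b1min]] := @minimal_positive (fun b => L 0 b) (ex_intro2 _ _ k k0 L0k).
exists a0, b0, b1; split => // a b; split=> [Lxy|[i [j [-> ->]]]]; last first.
  have L00 : L 0 0 by have := lc (- 1) 0 k 0 k L0k L0k; rewrite mulr0 addr0 mulN1r addNr.
  have := lc i _ _ _ _ Lab (lc j _ _ _ _ L0b L00).
  by rewrite mulr0 !addr0.
pose i := (a %/ a0)%Z; exists i.
have Lr : L (a - i * a0) (b - i * b0).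
  by rewrite addrC [b - _]addrC -!mulNr; exact: lc.
have aE : a = i * a0.
  apply/eqP; rewrite -subr_eq0; apply/negPn/negP => ne0.
  have rE : a - i * a0 = (a %% a0)%Z by [].
  have r0 : 0 < a - i * a0 by rewrite lt0r ne0 rE modz_ge0 // gt_eqF.
  have := a0min _ r0 (ex_intro _ _ Lr); rewrite leNgt => /negP; apply.
  by rewrite rE ltz_pmod.
rewrite aE subrr in Lr.
pose j := ((b - i * b0) %/ b1)%Z; exists j; split=> //.
have Lr2 : L 0 (b - i * b0 - j * b1).
  by rewrite addrC -mulNr -[0](addr0 0) -{1}(mulr0 (- j)); exact: lc.
apply/eqP; rewrite addrC -subr_eq -subr_eq0; apply/negPn/negP => ne0.
have rE : b - i * b0 - j * b1 = ((b - i * b0) %% b1)%Z by [].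
have r0 : 0 < b - i * b0 - j * b1 by rewrite lt0r ne0 rE modz_ge0 // gt_eqF.
have := b1min _ r0 Lr2; rewrite leNgt => /negP; apply.
by rewrite rE ltz_pmod.
Qed.

Lemma apolar_basis (Q : bqf int) : bqf_r Q != 0 ->
  exists a0 b0 b1 (g : int -> int -> bcf), [/\ 0 < a0, 0 < b1,
    forall i j, [/\ apolar Q (g i j), bcf_a (g i j) = i * a0 &
                    bcf_b (g i j) = i * b0 + j * b1] &
    forall f, apolar Q f -> exists i j, g i j = f].
Proof.
move=> r0; pose L a b := exists c d, apolar Q (BCF a b c d).
have [a0 [b0 [b1 [a00 b10 LE]]]] : exists a0 b0 b1, [/\ 0 < a0, 0 < b1 &
    forall a b, L a b <-> exists i j, a = i * a0 /\ b = i * b0 + j * b1].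
  (* The lattice is projected to the coordinates (a, b), which determine c and d. The multiple 3 r^2
     clears the denominators in solving [apolar] for c and then for d. *)
  apply: (@hermite_basis L (3 * bqf_r Q ^+ 2)).
  - move=> m x y x' y' [c [d [/= e1 e2]]] [c' [d' [/= e1' e2']]].
    exists (m * c + c'), (m * d + d'); split => /=.
      have -> : bqf_r Q * (m * c + c') = m * (bqf_r Q * c) + bqf_r Q * c' by ring.
      by rewrite e1 e1'; ring.
    have -> : 3 * bqf_r Q * (m * d + d') = m * (3 * bqf_r Q * d) + 3 * bqf_r Q * d' by ring.
    by rewrite e2 e2'; ring.
  - by rewrite mulr_gt0 // exprn_even_gt0.
  - by exists (- 9 * bqf_t Q * bqf_r Q), (- 3 * bqf_s Q * bqf_t Q); split => /=; ring.
  - exists (3 * bqf_r Q * bqf_s Q), (bqf_s Q ^+ 2 - bqf_r Q * bqf_t Q).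
    by split => /=; ring.
have Lij i j : exists cd : int * int, apolar Q (BCF (i * a0) (i * b0 + j * b1) cd.1 cd.2).
  have /LE[c [d ap]] : exists i' j', i * a0 = i' * a0 /\ i * b0 + j * b1 = i' * b0 + j' * b1.
    by exists i, j.
  by exists (c, d).
have [cd cdP] : exists cd : int -> int -> int * int,
    forall i j, apolar Q (BCF (i * a0) (i * b0 + j * b1) (cd i j).1 (cd i j).2).
  exists (fun i j => projT1 (cid (Lij i j))) => i j.
  exact: projT2 (cid (Lij i j)).
exists a0, b0, b1, (fun i j => BCF (i * a0) (i * b0 + j * b1) (cd i j).1 (cd i j).2).
split => // f fap.
case: f fap => a b c d fap.
have [i [j [aE bE]]] : exists i j, a = i * a0 /\ b = i * b0 + j * b1.
  by apply/LE; exists c, d.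
exists i, j; have [e1 e2] := fap; have [/= e1' e2'] := cdP i j.
rewrite -aE -bE in e1' e2' *.
have cE : (cd i j).1 = c by apply: (mulfI r0); rewrite e1' e1.
congr BCF => //; apply: (mulfI (_ : 3 * bqf_r Q != 0)); first by rewrite mulf_neq0.
by rewrite e2' cE e2.
Qed.

(** * Integers in intervals and lattice points in triangles *)

Section IntervalCount.
Variable R : realType.
Implicit Types x y : R.

Let clamp (lo hi z : R) := Num.max lo (Num.min hi z).

Let clampP lo hi z : lo <= hi ->
  [\/ z <= lo /\ clamp lo hi z = lo, lo <= z <= hi /\ clamp lo hi z = z
    | hi <= z /\ clamp lo hi z = hi].
Proof.
move=> lh; rewrite /clamp; have [hz|zh] := leP hi z.
  by constructor 3; rewrite max_r.
by have [lz|zl] := leP lo z; [constructor 2|constructor 1; rewrite ltW]; rewrite ?lz ?ltW.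
Qed.

(** A counted point owns the unit step to its right, inside [x, y + 1]. So each term is at most the
    increment of the position clamped to that interval, and increments telescope. The lower bound
    clamps to [x + 1, y] instead. *)
Lemma count_interval_le (N : nat) (x y z : R) : x <= y + 1 ->
  \sum_(j < N) (x <= j%:R + z <= y)%R%:R <= y - x + 1.
Proof.
move=> xy; pose c (k : nat) := clamp x (y + 1) (k%:R + z).
apply: (@le_trans _ _ (\sum_(0 <= k < N) (c k.+1 - c k))).
  rewrite big_mkord ler_sum // => k _; rewrite /c -[k.+1%:R]natr1.
  have := clampP (k%:R + z) xy; have := clampP (k%:R + 1 + z) xy.
  move: (clamp _ _ _) (clamp _ _ _) => u v.
  by case: (boolP (x <= _ <= y)) => [/andP[? ?]|_] => -[[? ->]|[/andP[? ?] ->]|[? ->]]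
    [[? ->]|[/andP[? ?] ->]|[? ->]]; rewrite /= ?mulr1n ?mulr0n; lra.
rewrite telescope_sumr // /c.
have := clampP (N%:R + z) xy; have := clampP (0%:R + z) xy.
by move=> -[[? ->]|[/andP[? ?] ->]|[? ->]] [[? ->]|[/andP[? ?] ->]|[? ->]]; lra.
Qed.

Lemma count_interval_ge (N : nat) (x y z : R) :
  z <= x + 1 -> y <= N%:R + z ->
  y - x - 1 <= \sum_(j < N) (x < j%:R + z < y)%R%:R.
Proof.
move=> zx yN.
have [xy|xy] := leP (x + 1) y; last first.
  apply: (@le_trans _ _ 0); first by lra.
  by apply: sumr_ge0 => k _; rewrite ler0n.
pose c (k : nat) := clamp (x + 1) y (k%:R + z).
apply: (@le_trans _ _ (\sum_(0 <= k < N) (c k.+1 - c k))).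
  rewrite telescope_sumr // /c.
  have := clampP (N%:R + z) xy; have := clampP (0%:R + z) xy.
  by move=> -[[? ->]|[/andP[? ?] ->]|[? ->]] [[? ->]|[/andP[? ?] ->]|[? ->]]; lra.
rewrite big_mkord ler_sum // => k _; rewrite /c -[k.+1%:R]natr1.
have := clampP (k%:R + z) xy; have := clampP (k%:R + 1 + z) xy.
move: (clamp _ _ _) (clamp _ _ _) => u v.
case: (boolP (x < _ < y)) => [/andP[? ?]|].
  by move=> -[[? ->]|[/andP[? ?] ->]|[? ->]] [[? ->]|[/andP[? ?] ->]|[? ->]];
    rewrite /= ?mulr1n ?mulr0n; lra.
rewrite negb_and -!leNgt => /orP[] ?;
  by move=> -[[? ->]|[/andP[? ?] ->]|[? ->]] [[? ->]|[/andP[? ?] ->]|[? ->]];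
    rewrite /= ?mulr1n ?mulr0n; lra.
Qed.

End IntervalCount.

Section LatticeCount.
Variable R : realType.

(** The box is [1, B] x [-B, B], rows starting at 1 because forms are normalized by a > 0. As a real
    sum of indicators, the count turns covers and packings into inequalities between sums. *)
Definition lattice_count (B : nat) (P : int -> int -> Prop) : R :=
  \sum_(i < B) \sum_(j < (2 * B).+1) `[< P i.+1%:Z (j%:Z - B%:Z) >]%:R.

Lemma lattice_count_le B (P P' : int -> int -> Prop) :
  (forall i j, 0 < i -> P i j -> P' i j) -> lattice_count B P <= lattice_count B P'.
Proof.
move=> PP; apply: ler_sum => i _; apply: ler_sum => j _; rewrite ler_nat.
by case: asboolP => // Pij; rewrite asboolT //; exact: PP.
Qed.

Lemma lattice_count_ge0 B P : 0 <= lattice_count B P.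
Proof. by apply: sumr_ge0 => i _; apply: sumr_ge0 => j _; rewrite ler0n. Qed.

Lemma lattice_count_cover (I : finType) B P (PI : I -> int -> int -> Prop) :
  (forall i j, 0 < i -> P i j -> exists k, PI k i j) ->
  lattice_count B P <= \sum_k lattice_count B (PI k).
Proof.
move=> PS; rewrite /lattice_count [leRHS]exchange_big /=; apply: ler_sum => i _.
rewrite [leRHS]exchange_big /=; apply: ler_sum => j _.
case: asboolP => [Pij|_]; last by apply: sumr_ge0 => k _; rewrite ler0n.
have [k PIk] := PS i.+1%:Z _ isT Pij; rewrite (bigD1 k) //= (asboolT PIk) lerDl.
by apply: sumr_ge0 => k2 _; rewrite ler0n.
Qed.

Lemma lattice_count_packing (I : finType) B P (PI : I -> int -> int -> Prop) :
  (forall i j k k', PI k i j -> PI k' i j -> k = k') ->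
  (forall i j k, 0 < i -> PI k i j -> P i j) ->
  \sum_k lattice_count B (PI k) <= lattice_count B P.
Proof.
move=> dis PS; rewrite /lattice_count [leLHS]exchange_big /=; apply: ler_sum => i _.
rewrite [leLHS]exchange_big /=; apply: ler_sum => j _.
have [[k PIk]|no] := pselect (exists k, PI k i.+1%:Z (j%:Z - B%:Z)).
  rewrite (asboolT (PS i.+1%:Z _ _ isT PIk)) (bigD1 k) //= (asboolT PIk).
  rewrite big1 ?addr0 // => k' k'k; rewrite asboolF // => PIk'.
  by move/eqP: k'k; apply; exact: dis PIk' PIk.
rewrite big1 ?ler0n // => k _; rewrite asboolF // => PIk.
by apply: no; exists k.
Qed.

(** In the triangle with vertex 0 between the slopes al and be, row i has at most (be - al) i + 1
    points. [G] is the discrete primitive of this bound, evaluated at min (i, x) so that the sum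
    telescopes to its value at x at most. *)
Lemma lattice_count_upper B (P : int -> int -> Prop) (al be x : R) :
  al <= be -> 0 <= x ->
  (forall i j : int, 0 < i -> P i j ->
     i%:~R <= x /\ al * i%:~R <= j%:~R <= be * i%:~R) ->
  lattice_count B P <= (be - al) * (x * (x + 1) / 2) + x.
Proof.
move=> ab x0 PI; set ga := be - al; have ga0 : 0 <= ga by rewrite subr_ge0.
pose G (z : R) := ga * (z * (z + 1) / 2) + z.
have G_mono u v : 0 <= u -> u <= v -> G u <= G v.
  move=> u0 uv; rewrite /G lerD // ler_wpM2l // ler_pM2r ?invr_gt0 //.
  by rewrite ler_pM // ?addr_ge0 ?lerD2r.
pose c (k : nat) := Num.min k%:R x.
have row (i : 'I_B) : \sum_(j < (2 * B).+1) `[< P i.+1%:Z (j%:Z - B%:Z) >]%:R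
    <= G (c i.+1) - G (c i).
  have [ix|xi] := leP (i.+1%:R) x; last first.
    rewrite big1 => [|j _].
      rewrite subr_ge0 G_mono // /c ?le_min ?ler0n //.
      by rewrite ge_min ler_nat leqnSn /= ge_min lexx orbT.
    by rewrite asboolF // => /(PI i.+1%:Z _ isT)[]; rewrite -pmulrn leNgt xi.
  have ix' : i%:R <= x by apply: le_trans ix; rewrite ler_nat leqnSn.
  rewrite /c (min_l ix) (min_l ix') /G.
  apply: (@le_trans _ _ (be * i.+1%:R - al * i.+1%:R + 1)); last first.
    by rewrite -[i.+1%:R]natr1 /ga; lra.
  have aibi : al * i.+1%:R <= be * i.+1%:R + 1.
    by apply: (@le_trans _ _ (be * i.+1%:R)); rewrite ?ler_wpM2r // lerDl.
  apply: le_trans (count_interval_le (2 * B).+1 (- B%:R) aibi).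
  apply: ler_sum => j _; rewrite ler_nat; case: asboolP => // /(PI i.+1%:Z _ isT)[_].
  by rewrite rmorphB /= -!pmulrn => ->.
apply: (@le_trans _ _ (\sum_(i < B) (G (c i.+1) - G (c i)))); first exact: ler_sum.
rewrite -(big_mkord xpredT (fun i => G (c i.+1) - G (c i))) telescope_sumr //.
have G0 : G (c 0%N) = 0 by rewrite /c min_l // /G !mul0r mulr0 addr0.
rewrite G0 subr0; apply: G_mono; first by rewrite /c le_min ler0n.
by rewrite /c ge_min lexx orbT.
Qed.

Lemma lattice_count_lower B (P : int -> int -> Prop) (al be x : R) :
  al <= be -> 0 <= x -> x <= B%:R -> `|al| * x <= B%:R -> `|be| * x <= B%:R ->
  (forall i j : int, 0 < i -> i%:~R < x -> al * i%:~R < j%:~R < be * i%:~R -> P i j) ->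
  (be - al) * ((x - 1) * x / 2) - x <= lattice_count B P.
Proof.
move=> ab x0 xB aB bB PI; set ga := be - al; have ga0 : 0 <= ga by rewrite subr_ge0.
(* m counts the integers i > 0 with i < x, that is ceil x - 1; the case x = 0 is apart because this
   would be -1. *)
have [m [mx xm]] : exists m : nat, m%:R <= x /\ x <= m%:R + 1 /\ forall i : nat, (i < m)%N -> i.+1%:R < x.
  have [x00|xn0] := eqVneq x 0.
    by exists 0%N; rewrite x00; split => //; split => //; rewrite add0r.
  pose k := `|Num.ceil x|%N.
  have xp : 0 < x by rewrite lt0r xn0.
  have k0 : (0 < Num.ceil x)%R by rewrite ceil_gt0.
  have kE : k%:R = (Num.ceil x)%:~R :> R by rewrite /k pmulrn gtz0_abs.
  have /andP[l u] := ceil_itv x.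
  have k1 : (0 < k)%N by rewrite /k absz_gt0 gt_eqF.
  rewrite rmorphB /= -kE in l; rewrite -kE in u.
  have km : k.-1%:R = k%:R - 1 :> R by rewrite -{2}(prednK k1) -natr1 addrK.
  exists k.-1; rewrite km; split; [exact: ltW|split; first by rewrite subrK].
  move=> i ik; apply: le_lt_trans l; rewrite -km ler_nat; exact: ik.
have [xm1 im] := xm; have mB : (m <= B)%N by rewrite -(ler_nat R) (le_trans mx).
apply: (@le_trans _ _ (\sum_(0 <= i < m) (ga * i.+1%:R - 1))).
  have -> : \sum_(0 <= i < m) (ga * i.+1%:R - 1) = ga * (m%:R * (m%:R + 1) / 2) - m%:R.
    elim: m {mx xm xm1 im mB} => [|k IHk]; first by rewrite big_geq // !mul0r mulr0 subr0.
    by rewrite big_nat_recr //= IHk -natr1; field.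
  rewrite lerD ?lerN2 // ler_wpM2l // ler_pM2r ?invr_gt0 //.
  have m0 : 0 <= m%:R :> R by rewrite ler0n.
  by nra.
rewrite /lattice_count -(big_mkord xpredT
  (fun i => \sum_(j < (2 * B).+1) `[< P i.+1%:Z (j%:Z - B%:Z) >]%:R)).
rewrite [leRHS](big_cat_nat _ mB) //= -[leLHS]addr0 lerD //; last first.
  by apply: sumr_ge0 => i _; apply: sumr_ge0 => j _; rewrite ler0n.
rewrite big_nat [leRHS]big_nat; apply: ler_sum => i /andP[_ lim].
have ix := im i lim.
have bnd (e : R) : `|e| * x <= B%:R -> - B%:R <= e * i.+1%:R <= B%:R.
  move=> eB; rewrite -ler_norml normrM [`|i.+1%:R|]ger0_norm //.
  by apply: le_trans eB; rewrite ler_wpM2l // ltW.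
have /andP[al1 _] := bnd al aB; have /andP[_ be1] := bnd be bB.
have z1 : - B%:R <= al * i.+1%:R + 1 by lra.
have y1 : be * i.+1%:R <= ((2 * B).+1)%:R - B%:R :> R.
  by rewrite -[X in _ <= X - _]natr1 natrM; lra.
have := count_interval_ge z1 y1.
rewrite -mulrBl -/ga => /le_trans; apply; apply: ler_sum => j _; rewrite ler_nat.
case: (boolP (_ < _ < _)) => // H; rewrite asboolT //; apply: PI => //.
by rewrite rmorphB /= -!pmulrn.
Qed.

End LatticeCount.

(** The sign of B is left open because it will be the sign of r: slopes increase or decrease with
    time accordingly, and min and max absorb the two cases. *)
Lemma affine_interval (R : realType) (A B u v y : R) : B != 0 -> u <= v ->
  (Num.min (A + B * u) (A + B * v) < y < Num.max (A + B * u) (A + B * v) ->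
   u < (y - A) / B < v) /\
  (u <= (y - A) / B <= v ->
   Num.min (A + B * u) (A + B * v) <= y <= Num.max (A + B * u) (A + B * v)) /\
  Num.max (A + B * u) (A + B * v) - Num.min (A + B * u) (A + B * v) = `|B| * (v - u).
Proof.
move=> B0 uv; have [Bn|Bp|/eqP] := ltgtP B 0; last by rewrite (negbTE B0).
  have AB : A + B * v <= A + B * u by rewrite lerD2l ler_wnM2l // ltW.
  rewrite (min_r AB) (max_l AB) (ltr0_norm Bn).
  rewrite ltr_ndivlMr // ltr_ndivrMr // ler_ndivlMr // ler_ndivrMr //.
  by split => [/andP[? ?]|]; [|split => [/andP[? ?]|]]; [apply/andP; split; lra|apply/andP; split; lra|lra].
have AB : A + B * u <= A + B * v by rewrite lerD2l ler_wpM2l // ltW.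
rewrite (min_l AB) (max_r AB) (gtr0_norm Bp).
rewrite ltr_pdivlMr // ltr_pdivrMr // ler_pdivlMr // ler_pdivrMr //.
by split => [/andP[? ?]|]; [|split => [/andP[? ?]|]]; [apply/andP; split; lra|apply/andP; split; lra|lra].
Qed.

(** * Sectors, their slopes and their density *)

Section Sector.
Variables (R : realType) (Q : bqf int).
Hypotheses (Q_primitive : bqf_primitive Q).
Hypotheses (r_neq0 : bqf_r Q != 0) (D_gt0 : 0 < bqf_disc Q).
Local Notation r := ((bqf_r Q)%:~R : R).
Local Notation th1 := (bqf_root1 R Q).
Local Notation th2 := (bqf_root2 R Q).
Local Notation cf1 := (cofactor1 R Q).
Local Notation cf2 := (cofactor2 R Q).
Local Notation time := (form_time R Q).
Local Notation del := (th2 - th1).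
Local Notation e := (Num.sg r).

Let rR : r != 0. Proof. by rewrite intr_eq0. Qed.
Let del_gt0 : 0 < del. Proof. by rewrite subr_gt0 root_lt. Qed.
Let e2 : e ^+ 2 = 1. Proof. by rewrite sqr_sg rR. Qed.
Let e_le1 : e <= 1. Proof. by case: sgrP => //; lra. Qed.
Let e_neq0 : e != 0. Proof. by rewrite sgr_eq0. Qed.

(* [form_value f] is the multiplier n with hessian f = n Q. *)
Definition form_value (f : bcf) : R := cf1 f * cf2 f / r.

(** For n > 0 the sign of cf1 / cf2 is e, so that cf1 = e exp(3t) cf2; with cf1 - cf2 = 3 a del this
    gives cf2 = 3 a del e [inv_gap t]. For t > 0 the gap is positive since e <= 1. *)
Definition inv_gap (t : R) : R := (expR (3 * t) - e)^-1.

(** The ratio n / a^2 for a form of time t, that is cf1 cf2 / (r a^2). *)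
Definition value_factor (t : R) : R :=
  9 * del ^+ 2 / `|r| * (expR (3 * t) * inv_gap t ^+ 2).

Lemma expR3_gt1 (t : R) : 0 < t -> 1 < expR (3 * t).
Proof. by move=> t0; rewrite -expR0 ltr_expR mulr_gt0. Qed.

Lemma inv_gap_gt0 t : 0 < t -> 0 < inv_gap t.
Proof. by move=> t0; rewrite invr_gt0 subr_gt0 (le_lt_trans e_le1 (expR3_gt1 t0)). Qed.

Lemma inv_gap_mono t1 t2 : 0 < t1 -> t1 <= t2 -> inv_gap t2 <= inv_gap t1.
Proof.
move=> t10 t12; have t20 : 0 < t2 by lra.
have Ee t : 0 < t -> 0 < expR (3 * t) - e.
  by move=> t0; rewrite subr_gt0 (le_lt_trans e_le1 (expR3_gt1 t0)).
by rewrite /inv_gap lef_pV2 ?posrE ?Ee // lerD2r ler_expR; lra.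
Qed.

(** Forms of a given time lie on a ray of the (a, b)-plane. The time alone leaves the sign of cf1 /
    cf2 open; positivity of n fixes it as e. *)
Lemma form_value_time f (t : R) : apolar Q f -> 0 < bcf_a f -> 0 < t ->
  (0 < form_value f /\ time f = t) <->
  (bcf_b f)%:~R = (bcf_a f)%:~R * (3 * th2 + 3 * del * e * inv_gap t) :> R.
Proof.
move=> ap a0 t0; have aR : 0 < (bcf_a f)%:~R :> R by rewrite ltr0z.
have cf12 : cf1 f = cf2 f + 3 * (bcf_a f)%:~R * del by rewrite /cofactor1 /cofactor2; ring.
have bE : (bcf_b f)%:~R = cf2 f + 3 * (bcf_a f)%:~R * th2 by rewrite /cofactor2; ring.
have E1 := expR3_gt1 t0; set E := expR (3 * t) in E1.
have Ee : E - e != 0 by rewrite subr_eq0 gt_eqF // (le_lt_trans e_le1 E1).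
have w0 := inv_gap_gt0 t0.
have wE : inv_gap t * (E - e) = 1 by rewrite /inv_gap mulVf.
split=> [[n0 tE]|].
  have c12 : cf1 f * cf2 f != 0.
    by apply/eqP => c0; move: n0; rewrite /form_value c0 mul0r ltxx.
  have [c1 c2] : cf1 f != 0 /\ cf2 f != 0 by apply/andP; rewrite -negb_or -mulf_eq0.
  have nE : `|cf1 f / cf2 f| = E.
    have tE' : 3 * t = ln `|cf1 f / cf2 f| by rewrite -tE /form_time; field.
    by rewrite /E tE' lnK // posrE normr_gt0 mulf_neq0 ?invr_neq0.
  have sE : Num.sg (cf1 f / cf2 f) = e.
    have -> : cf1 f / cf2 f = form_value f * (r * (cf2 f ^+ 2)^-1).
      by rewrite /form_value; field; rewrite c2 rR.
    rewrite sgrM (gtr0_sg n0) mul1r sgrM [X in _ * X]gtr0_sg ?mulr1 //.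
    by rewrite invr_gt0 exprn_even_gt0.
  have rho : cf1 f = e * E * cf2 f.
    by rewrite -[LHS](divfK c2) [cf1 f / cf2 f]numEsg sE nE.
  have c2E : cf2 f * (e * E - 1) = 3 * (bcf_a f)%:~R * del by rewrite mulrBr mulr1; lra.
  have -> : (bcf_b f)%:~R = cf2 f * (e * (e * (inv_gap t * (E - e)))) + 3 * (bcf_a f)%:~R * th2.
    by rewrite wE mulr1 -expr2 e2 mulr1.
  have -> : cf2 f * (e * (e * (inv_gap t * (E - e)))) = cf2 f * (e * E - e ^+ 2) * (e * inv_gap t) by ring.
  by rewrite e2 c2E; ring.
move=> bE'; have c2E : cf2 f = 3 * (bcf_a f)%:~R * del * e * inv_gap t by move: bE'; rewrite bE; lra.
have c1E : cf1 f = 3 * (bcf_a f)%:~R * del * E * inv_gap t.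
  transitivity (cf2 f + 3 * (bcf_a f)%:~R * del * (inv_gap t * (E - e))); first by rewrite wE mulr1.
  by rewrite c2E; ring.
have ad0 : 0 < 3 * (bcf_a f)%:~R * del by rewrite !mulr_gt0.
split.
  rewrite /form_value c1E c2E.
  have -> : 3 * (bcf_a f)%:~R * del * E * inv_gap t * (3 * (bcf_a f)%:~R * del * e * inv_gap t) / r
    = (3 * (bcf_a f)%:~R * del * inv_gap t) ^+ 2 * E * (e / r) by ring.
  have er : 0 < e / r by rewrite [X in e / X]numEsg invfM mulrA divff // mul1r invr_gt0 normr_gt0.
  apply: mulr_gt0 => //; apply: mulr_gt0; last exact: lt_trans ltr01 E1.
  by rewrite exprn_gt0 // mulr_gt0.
rewrite /form_time c1E c2E.
have -> : 3 * (bcf_a f)%:~R * del * E * inv_gap t / (3 * (bcf_a f)%:~R * del * e * inv_gap t) = E / e.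
  by field; rewrite e_neq0 !gt_eqF.
have -> : `|E / e| = E.
  by rewrite normrM normfV normr_sg rR /= invr1 mulr1 gtr0_norm // (lt_trans ltr01 E1).
by rewrite /E expRK; field.
Qed.

Lemma form_value_factor f (t : R) : apolar Q f -> 0 < t ->
  (bcf_b f)%:~R = (bcf_a f)%:~R * (3 * th2 + 3 * del * e * inv_gap t) :> R ->
  form_value f = (bcf_a f)%:~R ^+ 2 * value_factor t.
Proof.
move=> ap t0 bE.
have cf12 : cf1 f = cf2 f + 3 * (bcf_a f)%:~R * del by rewrite /cofactor1 /cofactor2; ring.
have c2E : cf2 f = 3 * (bcf_a f)%:~R * del * e * inv_gap t by rewrite /cofactor2 bE; ring.
set E := expR (3 * t).
have Ee : E - e != 0 by rewrite subr_eq0 gt_eqF // (le_lt_trans e_le1 (expR3_gt1 t0)).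
have wE : inv_gap t * (E - e) = 1 by rewrite /inv_gap mulVf.
have c1E : cf1 f = 3 * (bcf_a f)%:~R * del * E * inv_gap t.
  transitivity (cf2 f + 3 * (bcf_a f)%:~R * del * (inv_gap t * (E - e))); first by rewrite wE mulr1.
  by rewrite c2E; ring.
have er : e / r = `|r|^-1 by rewrite [X in e / X]numEsg invfM mulrA divff // mul1r.
rewrite /form_value c1E c2E /value_factor -/E -er; ring.
Qed.

Lemma value_factor_gt0 t : 0 < t -> 0 < value_factor t.
Proof.
move=> t0; rewrite /value_factor; apply: mulr_gt0; last first.
  by rewrite mulr_gt0 ?expR_gt0 // exprn_gt0 // inv_gap_gt0.
by rewrite divr_gt0 ?normr_gt0 // mulr_gt0 // exprn_gt0.
Qed.

Lemma value_factor_mono t1 t2 : 0 < t1 -> t1 <= t2 -> value_factor t2 <= value_factor t1.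
Proof.
move=> t10 t12; have t20 : 0 < t2 by lra.
have E1 := expR3_gt1 t10; have E2 := expR3_gt1 t20.
have E12 : expR (3 * t1) <= expR (3 * t2) by rewrite ler_expR; lra.
have c0 : 0 <= 9 * del ^+ 2 / `|r|.
  by apply: divr_ge0; rewrite ?normr_ge0 // mulr_ge0 ?sqr_ge0.
rewrite /value_factor /inv_gap; apply: (ler_wpM2l c0).
set x := expR (3 * t1) in E1 E12 *; set y := expR (3 * t2) in E2 E12 *.
have e1 := e_le1.
have x0 : 0 < x - e by lra.
have y0 : 0 < y - e by lra.
rewrite -subr_ge0.
have -> : x * (x - e)^-1 ^+ 2 - y * (y - e)^-1 ^+ 2 =
   ((y - x) * (x * y - e ^+ 2)) / ((x - e) ^+ 2 * (y - e) ^+ 2).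
  by field; rewrite !gt_eqF.
rewrite e2; apply: divr_ge0; apply: mulr_ge0; rewrite ?sqr_ge0 ?subr_ge0 //.
by rewrite -[leLHS]mulr1; apply: ler_pM; rewrite // ltW.
Qed.

Variables (a0 b0 b1 : int) (g : int -> int -> bcf).
Hypotheses (a0_gt0 : 0 < a0) (b1_gt0 : 0 < b1).
Hypothesis gP : forall i j, [/\ apolar Q (g i j), bcf_a (g i j) = i * a0 &
                    bcf_b (g i j) = i * b0 + j * b1].

(* The slope j / i at which g i j has time t. *)
Definition slope_shift : R := (a0%:~R * (3 * th2) - b0%:~R) / b1%:~R.
Definition slope_scale : R := a0%:~R * (3 * del * e) / b1%:~R.
Definition slope (t : R) : R := slope_shift + slope_scale * inv_gap t.

Definition sector (t1 t2 Y : R) (i j : int) : Prop :=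
  [/\ 0 < form_value (g i j), form_value (g i j) < Y & t1 <= time (g i j) < t2].

Let a0R : 0 < a0%:~R :> R. Proof. by rewrite ltr0z. Qed.
Let b1R : 0 < b1%:~R :> R. Proof. by rewrite ltr0z. Qed.

Lemma slope_scale_neq0 : slope_scale != 0.
Proof.
rewrite /slope_scale; apply: mulf_neq0; last by rewrite invr_neq0 // gt_eqF.
apply: mulf_neq0; first by rewrite gt_eqF.
by apply: mulf_neq0 => //; rewrite gt_eqF // mulr_gt0.
Qed.

Lemma slope_scale_norm : `|slope_scale| = 3 * del * a0%:~R / b1%:~R.
Proof.
rewrite /slope_scale !normrM normr_sg rR normfV (gtr0_norm a0R) (gtr0_norm b1R).
by rewrite (gtr0_norm del_gt0) ger0_norm //=; ring.
Qed.

Lemma sector_slope i j (t : R) : 0 < i -> 0 < t ->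
  (0 < form_value (g i j) /\ time (g i j) = t) <-> j%:~R = slope t * i%:~R :> R.
Proof.
move=> i0 t0; have [ap aE bE] := gP i j.
have ag0 : 0 < bcf_a (g i j) by rewrite aE mulr_gt0.
rewrite (form_value_time ap ag0 t0) aE bE rmorphD !rmorphM /=.
rewrite /slope /slope_shift /slope_scale; set w := inv_gap t.
split=> E.
  apply: (mulfI (lt0r_neq0 b1R)); transitivity
    (i%:~R * a0%:~R * (3 * th2 + 3 * del * e * w) - i%:~R * b0%:~R : R).
    by rewrite -E; ring.
  by field; rewrite gt_eqF.
by rewrite E; field; rewrite gt_eqF.
Qed.

Lemma sector_value i j (t : R) : 0 < i -> 0 < t -> j%:~R = slope t * i%:~R :> R ->
  form_value (g i j) = i%:~R ^+ 2 * (a0%:~R ^+ 2 * value_factor t).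
Proof.
move=> i0 t0 E; have [ap aE bE] := gP i j.
have ag0 : 0 < bcf_a (g i j) by rewrite aE mulr_gt0.
have /(form_value_time ap ag0 t0) bE' := (sector_slope j i0 t0).2 E.
by rewrite (form_value_factor ap t0 bE') aE rmorphM /=; ring.
Qed.

(** The abscissa i at which the ray of time t reaches the value 1, the value on that ray being i^2
    a0^2 [value_factor t]. *)
Definition sector_radius (t : R) : R := (a0%:~R * Num.sqrt (value_factor t))^-1.

Lemma sector_radius_gt0 t : 0 < t -> 0 < sector_radius t.
Proof. by move=> t0; rewrite invr_gt0 mulr_gt0 // sqrtr_gt0 value_factor_gt0. Qed.

Lemma sector_radiusP t (x Y : R) : 0 < t -> 0 <= x -> 0 <= Y ->
  (x ^+ 2 * (a0%:~R ^+ 2 * value_factor t) < Y) = (x < sector_radius t * Num.sqrt Y).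
Proof.
move=> t0 x0 Y0; have v0 := value_factor_gt0 t0.
have -> : x ^+ 2 * (a0%:~R ^+ 2 * value_factor t) = (x / sector_radius t) ^+ 2.
  rewrite /sector_radius invrK !exprMn sqr_sqrtr ?(ltW v0) //; ring.
rewrite -{1}(sqr_sqrtr Y0) ltr_pXn2r // ?nnegrE ?sqrtr_ge0 ?divr_ge0 // ?(ltW (sector_radius_gt0 t0)) //.
by rewrite ltr_pdivrMr ?sector_radius_gt0 // mulrC.
Qed.

Definition slope_min t1 t2 : R := Num.min (slope t1) (slope t2).
Definition slope_max t1 t2 : R := Num.max (slope t1) (slope t2).

Lemma slope_width t1 t2 : 0 < t1 -> t1 <= t2 ->
  slope_max t1 t2 - slope_min t1 t2 = 3 * del * a0%:~R / b1%:~R * (inv_gap t1 - inv_gap t2).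
Proof.
move=> t10 t12; have w12 := inv_gap_mono t10 t12.
have [_ [_]] := affine_interval slope_shift 0 slope_scale_neq0 w12.
by rewrite slope_scale_norm maxC minC.
Qed.

(** The value factor decreases with the time, so the radius increases: between the two rays, cutting
    at the radius of t2 gives a triangle containing the sector, and cutting at the radius of t1 one
    whose interior is contained in it. *)
Lemma sector_sub t1 t2 Y i j : 0 < i -> 0 < t1 -> t1 <= t2 -> 0 <= Y ->
  sector t1 t2 Y i j -> i%:~R <= sector_radius t2 * Num.sqrt Y /\
    slope_min t1 t2 * i%:~R <= j%:~R <= slope_max t1 t2 * i%:~R.
Proof.
move=> i0 t10 t12 Y0 [n0 nY /andP[t1t tt2]].
have t0 : 0 < time (g i j) by lra.
have iR : 0 < i%:~R :> R by rewrite ltr0z.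
have jE := (sector_slope j i0 t0).1 (conj n0 erefl).
rewrite (sector_value i0 t0 jE) in nY; set t := time _ in t1t tt2 t0 jE nY.
split.
  apply: ltW; rewrite -(sector_radiusP _ _ Y0) ?ltW //; last by lra.
  apply: le_lt_trans nY; rewrite ler_wpM2l ?sqr_ge0 // ler_wpM2l ?sqr_ge0 //.
  by rewrite value_factor_mono // ltW.
rewrite -(ler_pdivlMr _ _ iR) -(ler_pdivrMr _ _ iR).
have sE : j%:~R / i%:~R = slope t by rewrite jE mulfK // gt_eqF.
have w12 := inv_gap_mono t10 t12.
have [_ [+ _]] := affine_interval slope_shift (j%:~R / i%:~R) slope_scale_neq0 w12.
rewrite /slope_min /slope_max minC maxC; apply.
rewrite sE /slope [X in X - _]addrC addrK [X in X / _]mulrC mulfK ?slope_scale_neq0 //.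
by rewrite !inv_gap_mono // ltW.
Qed.

Lemma sector_sup t1 t2 Y i j : 0 < i -> 0 < t1 -> t1 <= t2 -> 0 <= Y ->
  i%:~R < sector_radius t1 * Num.sqrt Y ->
  slope_min t1 t2 * i%:~R < j%:~R < slope_max t1 t2 * i%:~R -> sector t1 t2 Y i j.
Proof.
move=> i0 t10 t12 Y0 ix; have iR : 0 < i%:~R :> R by rewrite ltr0z.
rewrite -(ltr_pdivlMr _ _ iR) -(ltr_pdivrMr _ _ iR) => sI.
have w12 := inv_gap_mono t10 t12.
have [+ _] := affine_interval slope_shift (j%:~R / i%:~R) slope_scale_neq0 w12.
rewrite minC maxC => /(_ sI); set y := _ / slope_scale => /andP[y2 y1].
have t20 : 0 < t2 by lra.
have y0 : 0 < y by apply: lt_trans y2; exact: inv_gap_gt0.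
have eE t : 0 < t -> expR (3 * t) = e + (inv_gap t)^-1 by move=> t0; rewrite /inv_gap invrK; ring.
(* This solves [inv_gap t = y], so that (i, j) lies on the ray of time t. *)
pose E := e + y^-1; pose t := ln E / 3.
have E1 : expR (3 * t1) < E.
  by rewrite eE // /E ltrD2l ltf_pV2 ?posrE ?inv_gap_gt0.
have E2 : E < expR (3 * t2).
  by rewrite eE // /E ltrD2l ltf_pV2 ?posrE ?inv_gap_gt0.
have E0 : 0 < E by apply: lt_trans E1; exact: expR_gt0.
have tE : expR (3 * t) = E by rewrite /t mulrC divfK ?pnatr_eq0 // lnK.
have t1t : t1 < t by move: E1; rewrite -tE ltr_expR; lra.
have tt2 : t < t2 by move: E2; rewrite -tE ltr_expR; lra.
have t0 : 0 < t by lra.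
have wE : inv_gap t = y by rewrite /inv_gap tE /E [e + _]addrC addrK invrK.
have jE : j%:~R = slope t * i%:~R :> R.
  rewrite /slope wE /y [slope_scale * _]mulrC divfK ?slope_scale_neq0 //.
  by rewrite addrC subrK divfK // gt_eqF.
have [n0 timeE] := (sector_slope j i0 t0).2 jE.
split => //; last by rewrite timeE tt2 ltW.
rewrite (sector_value i0 t0 jE).
apply: (@le_lt_trans _ _ (i%:~R ^+ 2 * (a0%:~R ^+ 2 * value_factor t1))).
  by rewrite ler_wpM2l ?sqr_ge0 // ler_wpM2l ?sqr_ge0 // value_factor_mono // ltW.
by rewrite sector_radiusP // ltW.
Qed.

(** The area, in the coordinates (i, j), of the sector of values below 1 is 3 [density] per unit of
    time: in the product of the derivative of the slope with half the square of the radius, exp(3t)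
    and [inv_gap t] cancel. *)
Definition density : R := `|r| / (6 * a0%:~R * b1%:~R * del).

Lemma density_gt0 : 0 < density.
Proof. by rewrite divr_gt0 ?normr_gt0 // !mulr_gt0. Qed.

Lemma sector_radius_sqr t : 0 < t -> sector_radius t ^+ 2 = (a0%:~R ^+ 2 * value_factor t)^-1.
Proof. by move=> t0; rewrite exprVn exprMn sqr_sqrtr // ltW // value_factor_gt0. Qed.

(** A bound for [inv_gap t1 / inv_gap (t1 + h)] uniform in t1 >= p, which tends to 1 with h. It
    comes from 1 + E (F - 1) / (E - e), with E = exp(3 t1) and F = exp(3h), by E / (E - e) <= E0 /
    (E0 - 1) for E >= E0 = exp(3p) > 1. *)
Definition distortion (p h : R) : R :=
  1 + expR (3 * p) / (expR (3 * p) - 1) * (expR (3 * h) - 1).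

Lemma distortion_ge1 p h : 0 < p -> 0 <= h -> 1 <= distortion p h.
Proof.
move=> p0 h0; rewrite lerDl mulr_ge0 //; last first.
  by rewrite subr_ge0 -expR0 ler_expR mulr_ge0.
by rewrite divr_ge0 ?expR_ge0 // subr_ge0 ltW // expR3_gt1.
Qed.

Lemma inv_gap_ratio p t1 h : 0 < p -> p <= t1 -> 0 <= h ->
  inv_gap t1 <= distortion p h * inv_gap (t1 + h).
Proof.
move=> p0 pt h0; have t10 : 0 < t1 by lra.
have t20 : 0 < t1 + h by lra.
have pos t : 0 < t -> 0 < expR (3 * t) - e.
  by move=> t0; rewrite subr_gt0 (le_lt_trans e_le1 (expR3_gt1 t0)).
rewrite /inv_gap ler_pdivlMr ?pos // mulrC ler_pdivrMr ?pos //.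
have -> : expR (3 * (t1 + h)) = expR (3 * t1) * expR (3 * h) by rewrite -expRD mulrDr.
have E1 := expR3_gt1 p0.
have Ept : expR (3 * p) <= expR (3 * t1) by rewrite ler_expR; lra.
have F1 : 1 <= expR (3 * h) by rewrite -expR0 ler_expR mulr_ge0.
rewrite /distortion; move: (expR (3 * h)) (expR (3 * t1)) (expR (3 * p)) F1 Ept E1 => F E E0 F1 Ept E1.
have e1 := e_le1.
have key : E <= E0 / (E0 - 1) * (E - e).
  rewrite mulrAC ler_pdivlMr ?subr_gt0 //.
  have : 0 <= E0 * (1 - e) by rewrite mulr_ge0; lra.
  by lra.
have : E * (F - 1) <= E0 / (E0 - 1) * (E - e) * (F - 1) by rewrite ler_wpM2r // subr_ge0.
by lra.
Qed.

Let inv_gap_diff t1 t2 : 0 < t1 -> 0 < t2 -> inv_gap t1 - inv_gap t2 =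
  (expR (3 * t2) - expR (3 * t1)) * (inv_gap t1 * inv_gap t2).
Proof.
move=> t10 t20; have w1 := inv_gap_gt0 t10; have w2 := inv_gap_gt0 t20.
have wE t : expR (3 * t) = e + (inv_gap t)^-1 by rewrite /inv_gap invrK; ring.
by rewrite !wE //; field; rewrite !gt_eqF.
Qed.

(** The left side is exactly [density] times (1 - exp(-3h)) times a ratio of gaps, and 1 - exp(-3h)
    <= 3h. The lower bound has exp(3h) - 1 >= 3h and the inverse ratio. *)
Lemma sector_density_upper p t1 h : 0 < p -> p <= t1 -> 0 <= h ->
  (slope_max t1 (t1 + h) - slope_min t1 (t1 + h)) * sector_radius (t1 + h) ^+ 2 / 2
    <= 3 * density * h * distortion p h.
Proof.
move=> p0 pt h0; have t10 : 0 < t1 by lra.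
have t20 : 0 < t1 + h by lra.
have t12 : t1 <= t1 + h by lra.
rewrite slope_width // sector_radius_sqr // /value_factor inv_gap_diff //.
have w1 := inv_gap_gt0 t10; have w2 := inv_gap_gt0 t20.
have wr := inv_gap_ratio p0 pt h0.
have E2 : 0 < expR (3 * (t1 + h)) by exact: expR_gt0.
have E12 : expR (3 * t1) / expR (3 * (t1 + h)) = expR (- (3 * h)).
  by rewrite -expRN -expRD; congr expR; ring.
have n0 : 0 < `|r| by rewrite normr_gt0.
apply: (@le_trans _ _ (density * ((1 - expR (3 * t1) / expR (3 * (t1 + h)))
    * (inv_gap t1 / inv_gap (t1 + h))))).
  by rewrite le_eqVlt; apply/orP; left; apply/eqP; rewrite /density; field; rewrite !gt_eqF.
have -> : 3 * density * h * distortion p h = density * (3 * h * distortion p h) by ring.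
rewrite ler_wpM2l ?(ltW density_gt0) // E12.
apply: ler_pM; rewrite ?divr_ge0 ?(ltW w1) ?(ltW w2) // ?subr_ge0.
- by rewrite expR_le1 oppr_le0 mulr_ge0.
- by have := expR_ge1Dx (- (3 * h)); lra.
- by rewrite ler_pdivrMr.
Qed.

Lemma sector_density_lower p t1 h : 0 < p -> p <= t1 -> 0 <= h ->
  3 * density * h / distortion p h <=
  (slope_max t1 (t1 + h) - slope_min t1 (t1 + h)) * sector_radius t1 ^+ 2 / 2.
Proof.
move=> p0 pt h0; have t10 : 0 < t1 by lra.
have t20 : 0 < t1 + h by lra.
have t12 : t1 <= t1 + h by lra.
rewrite slope_width // sector_radius_sqr // /value_factor inv_gap_diff //.
have w1 := inv_gap_gt0 t10; have w2 := inv_gap_gt0 t20.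
have wr := inv_gap_ratio p0 pt h0.
have rho := distortion_ge1 p0 h0.
have E1 : 0 < expR (3 * t1) by exact: expR_gt0.
have E12 : expR (3 * (t1 + h)) / expR (3 * t1) = expR (3 * h).
  by rewrite -expRN -expRD; congr expR; ring.
have n0 : 0 < `|r| by rewrite normr_gt0.
apply: (@le_trans _ _ (density * ((expR (3 * (t1 + h)) / expR (3 * t1) - 1)
    * (inv_gap (t1 + h) / inv_gap t1)))); last first.
  by rewrite le_eqVlt; apply/orP; left; apply/eqP; rewrite /density; field; rewrite !gt_eqF.
have -> : 3 * density * h / distortion p h = density * (3 * h / distortion p h) by ring.
rewrite ler_wpM2l ?(ltW density_gt0) // E12.
have rho0 : 0 < distortion p h by lra.
apply: ler_pM; rewrite ?invr_ge0 ?(ltW rho0) ?mulr_ge0 //.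
- by have := expR_ge1Dx (3 * h); lra.
- by rewrite ler_pdivlMr // mulrC ler_pdivrMr // mulrC.
Qed.

End Sector.

(** * Counting forms by their time *)

Section PieceCount.
Variables (R : realType) (Q : bqf int).
Hypotheses (r_neq0 : bqf_r Q != 0) (D_gt0 : 0 < bqf_disc Q).
Variables (a0 b0 b1 : int) (g : int -> int -> bcf).
Hypotheses (a0_gt0 : 0 < a0) (b1_gt0 : 0 < b1).
Hypothesis gP : forall i j, [/\ apolar Q (g i j), bcf_a (g i j) = i * a0 &
                    bcf_b (g i j) = i * b0 + j * b1].
Variables (p : R).
Hypothesis p_gt0 : 0 < p.

Local Notation sector := (sector Q g).
Local Notation sector_radius := (sector_radius Q a0).
Local Notation slope := (slope Q a0 b0 b1).
Local Notation slope_min := (slope_min Q a0 b0 b1).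
Local Notation slope_max := (slope_max Q a0 b0 b1).
Local Notation density := (density R Q a0 b1).
Local Notation time := (form_time R Q).

(* B >= box_factor * sqrt Y ensures that [1, B] x [-B, B] contains all forms of
   value < Y with time in [p, 2 p]. *)
Definition box_factor : R :=
  sector_radius (p + p) * (1 + `|slope p| + `|slope (p + p)|).

Lemma sector_count_upper t1 h : p <= t1 -> 0 <= h -> exists2 C, 0 <= C &
  forall Y B, 0 <= Y -> lattice_count R B (sector t1 (t1 + h) Y) <=
    3 * density * h * distortion p h * Y + C * Num.sqrt Y.
Proof.
move=> pt h0; have t10 : 0 < t1 := lt_le_trans p_gt0 pt.
have t20 : 0 < t1 + h by lra.
have t12 : t1 <= t1 + h by lra.
set W := slope_max t1 (t1 + h) - slope_min t1 (t1 + h).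
have W0 : 0 <= W by rewrite subr_ge0 /slope_max /slope_min le_max ge_min lexx.
have rd := sector_radius_gt0 r_neq0 D_gt0 a0_gt0 t20.
exists (W * sector_radius (t1 + h) / 2 + sector_radius (t1 + h)).
  by apply: addr_ge0; rewrite ?(ltW rd) //; apply: divr_ge0 => //; apply: mulr_ge0 => //; exact: ltW.
move=> Y B Y0; set x := sector_radius (t1 + h) * Num.sqrt Y.
have x0 : 0 <= x by rewrite mulr_ge0 ?sqrtr_ge0 // ltW.
have upp : lattice_count R B (sector t1 (t1 + h) Y) <= W * (x * (x + 1) / 2) + x.
  apply: lattice_count_upper => //; first by rewrite -subr_ge0.
  by move=> i j i0; exact: sector_sub.
apply: (le_trans upp).
have dens := sector_density_upper r_neq0 D_gt0 b0 a0_gt0 b1_gt0 p_gt0 pt h0.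
have xE : x ^+ 2 = sector_radius (t1 + h) ^+ 2 * Y by rewrite exprMn sqr_sqrtr.
have -> : W * (x * (x + 1) / 2) + x = W * sector_radius (t1 + h) ^+ 2 / 2 * Y
   + (W * sector_radius (t1 + h) / 2 + sector_radius (t1 + h)) * Num.sqrt Y.
  have -> : W * (x * (x + 1) / 2) + x = W / 2 * x ^+ 2 + (W / 2 + 1) * x by field.
  by rewrite xE /x; field.
by rewrite lerD2r ler_wpM2r.
Qed.

Lemma slope_bound t : p <= t <= p + p -> `|slope t| <= `|slope p| + `|slope (p + p)|.
Proof.
move=> /andP[pt tp].
have w1 := inv_gap_mono Q p_gt0 pt.
have w2 := inv_gap_mono Q (lt_le_trans p_gt0 pt) tp.
have B0 := slope_scale_neq0 R r_neq0 D_gt0 a0_gt0 b1_gt0.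
have [_ [+ _]] := affine_interval (slope_shift R Q a0 b0 b1) (slope t) B0 (le_trans w2 w1).
rewrite {1}/slope [X in X - _]addrC addrK [X in X / _]mulrC mulfK // w1 w2 => /(_ isT).
rewrite -/(slope p) -/(slope (p + p)); move: (slope t) (slope p) (slope (p + p)) => x y z.
rewrite ge_min le_max => /andP[]; rewrite -!(rwP orP) => h1 h2; rewrite ler_norml.
have ny := ler_norm y; have nz := ler_norm z.
have ny' := ler_norm (- y); have nz' := ler_norm (- z).
rewrite normrN in ny'; rewrite normrN in nz'.
have y0 := normr_ge0 y; have z0 := normr_ge0 z.
by case: h1 => h1; case: h2 => h2; apply/andP; split; lra.
Qed.

Lemma sector_count_lower t1 h : p <= t1 -> 0 <= h -> t1 + h <= p + p -> exists2 C, 0 <= C &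
  forall Y (B : nat), 0 <= Y -> box_factor * Num.sqrt Y <= B%:R ->
  3 * density * h / distortion p h * Y - C * Num.sqrt Y <=
  lattice_count R B (sector t1 (t1 + h) Y).
Proof.
move=> pt h0 tp; have t10 : 0 < t1 := lt_le_trans p_gt0 pt.
have t20 : 0 < t1 + h by lra.
have t12 : t1 <= t1 + h by lra.
set W := slope_max t1 (t1 + h) - slope_min t1 (t1 + h).
have W0 : 0 <= W by rewrite subr_ge0 /slope_max /slope_min le_max ge_min lexx.
have rd := sector_radius_gt0 r_neq0 D_gt0 a0_gt0 t10.
exists (W * sector_radius t1 / 2 + sector_radius t1).
  by apply: addr_ge0; rewrite ?(ltW rd) //; apply: divr_ge0 => //; apply: mulr_ge0 => //; exact: ltW.
move=> Y B Y0 YB; set x := sector_radius t1 * Num.sqrt Y.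
have x0 : 0 <= x by rewrite mulr_ge0 ?sqrtr_ge0 // ltW.
have rmono : sector_radius t1 <= sector_radius (p + p).
  have a0R : 0 < a0%:~R :> R by rewrite ltr0z.
  have pp0 : 0 < p + p := addr_gt0 p_gt0 p_gt0.
  have v1 := value_factor_gt0 r_neq0 D_gt0 t10; have v2 := value_factor_gt0 r_neq0 D_gt0 pp0.
  rewrite lef_pV2 ?posrE ?mulr_gt0 ?sqrtr_gt0 // ler_wpM2l ?ler_wsqrtr ?(ltW a0R) //.
  by apply: value_factor_mono => //; lra.
set M := 1 + `|slope p| + `|slope (p + p)|.
have xM c : 0 <= c -> c <= M -> c * x <= B%:R.
  move=> c0 cM; apply: le_trans YB; rewrite /box_factor -/M /x mulrCA mulrA.
  rewrite ler_wpM2r ?sqrtr_ge0 //; apply: ler_pM => //; exact: ltW.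
have sl t : p <= t <= p + p -> `|slope t| <= M.
  by move=> tI; have := slope_bound tI; rewrite /M; lra.
have s1 : `|slope t1| <= M by apply: sl; apply/andP; split; lra.
have s2 : `|slope (t1 + h)| <= M by apply: sl; apply/andP; split; lra.
have M1 : 1 <= M by rewrite /M -addrA lerDl addr_ge0.
have xB : x <= B%:R by rewrite -[x]mul1r xM.
have smin : `|slope_min t1 (t1 + h)| * x <= B%:R.
  by rewrite xM // /slope_min /Num.min; case: ifP.
have smax : `|slope_max t1 (t1 + h)| * x <= B%:R.
  by rewrite xM // /slope_max /Num.max; case: ifP.
have low : W * ((x - 1) * x / 2) - x <= lattice_count R B (sector t1 (t1 + h) Y).
  apply: lattice_count_lower => //; first by rewrite -subr_ge0.
  by move=> i j i0 ix; exact: sector_sup.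
apply: le_trans low.
have dens := sector_density_lower r_neq0 D_gt0 b0 a0_gt0 b1_gt0 p_gt0 pt h0.
have xE : x ^+ 2 = sector_radius t1 ^+ 2 * Y by rewrite exprMn sqr_sqrtr.
have -> : W * ((x - 1) * x / 2) - x = W * sector_radius t1 ^+ 2 / 2 * Y
   - (W * sector_radius t1 / 2 + sector_radius t1) * Num.sqrt Y.
  have -> : W * ((x - 1) * x / 2) - x = W / 2 * x ^+ 2 - (W / 2 + 1) * x by field.
  by rewrite xE /x; field.
by rewrite lerD2r ler_wpM2r.
Qed.

Variable S : R -> Prop.

Definition timed_sector (Y : R) (i j : int) : Prop :=
  sector p (p + p) Y i j /\ S (time (g i j)).

Definition piece (N k : nat) (t : R) : Prop :=
  p + p / N%:R * k%:R <= t < p + p / N%:R * k%:R + p / N%:R.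

(** Multiplied by p / N, this and [inner_pieces] are the outer and inner Jordan sums of S on [p,
    2p). *)
Definition meeting_pieces (N : nat) : R :=
  \sum_(k < N) `[< exists2 t, piece N k t & S t >]%:R.

Definition inner_pieces (N : nat) : R :=
  \sum_(k < N) `[< forall t, piece N k t -> S t >]%:R.

Lemma piece_exists N t : (0 < N)%N -> p <= t < p + p -> exists k : 'I_N, piece N k t.
Proof.
move=> N0 /andP[pt tp]; have NR : 0 < N%:R :> R by rewrite ltr0n.
set h := p / N%:R; have h0 : 0 < h by rewrite divr_gt0.
have u0 : 0 <= (t - p) / h by rewrite divr_ge0 ?subr_ge0 // ltW.
have kE : `|Num.floor ((t - p) / h)|%N%:R = (Num.floor ((t - p) / h))%:~R :> R.
  by rewrite pmulrn gez0_abs // floor_ge0.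
have /andP[l u] := floor_itv ((t - p) / h); rewrite rmorphD /= -kE in u; rewrite -kE in l.
have kN : (`|Num.floor ((t - p) / h)| < N)%N.
  rewrite -(ltr_nat R); apply: le_lt_trans l _; rewrite ltr_pdivrMr //.
  by rewrite /h mulrC divfK ?gt_eqF //; lra.
exists (Ordinal kN); rewrite /piece /= -/h.
rewrite ler_pdivlMr // in l; rewrite ltr_pdivrMr // in u.
by apply/andP; split; lra.
Qed.

Lemma piece_inj N (k k' : 'I_N) t : (0 < N)%N -> piece N k t -> piece N k' t -> k = k'.
Proof.
move=> N0; have NR : 0 < N%:R :> R by rewrite ltr0n.
rewrite /piece; set h := p / N%:R; have h0 : 0 < h by rewrite divr_gt0.
have lek (m m' : nat) : p + h * m%:R <= t -> t < p + h * m'%:R + h -> (m <= m')%N.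
  move=> l u; rewrite -ltnS -(ltr_nat R) -natr1 -(ltr_pM2l h0); lra.
move=> /andP[l u] /andP[l' u']; apply/val_inj/eqP; rewrite eqn_leq.
by rewrite (lek _ _ l u') (lek _ _ l' u).
Qed.

(** C adds up the errors of N sectors and depends on N but not on Y; hence N has to be chosen before
    Y tends to infinity. *)
Lemma timed_count_upper N : (0 < N)%N -> exists2 C, 0 <= C & forall Y B, 0 <= Y ->
  lattice_count R B (timed_sector Y) <=
  3 * density * (p / N%:R * meeting_pieces N) * distortion p (p / N%:R) * Y + C * Num.sqrt Y.
Proof.
move=> N0; have NR : 0 < N%:R :> R by rewrite ltr0n.
set h := p / N%:R; have h0 : 0 < h by rewrite divr_gt0.
have pk (k : 'I_N) : p <= p + h * k%:R by rewrite lerDl mulr_ge0 ?ler0n // ltW.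
have /choice[C CP] : forall k : 'I_N, exists C, 0 <= C /\ forall Y B, 0 <= Y ->
    lattice_count R B (sector (p + h * k%:R) (p + h * k%:R + h) Y) <=
    3 * density * h * distortion p h * Y + C * Num.sqrt Y.
  by move=> k; have [C C0 CP] := sector_count_upper (pk k) (ltW h0); exists C.
exists (\sum_k C k); first by apply: sumr_ge0 => k _; have [] := CP k.
move=> Y B Y0; pose meet (k : 'I_N) := exists2 t, piece N k t & S t.
apply: (@le_trans _ _ (\sum_(k < N) lattice_count R B
    (fun i j => meet k /\ sector (p + h * k%:R) (p + h * k%:R + h) Y i j))).
  apply: lattice_count_cover => i j i0 [[n0 nY tI] St].
  have [k kt] := piece_exists N0 tI.
  by exists k; split; [exists (time (g i j)) | split].
rewrite /meeting_pieces !mulr_sumr !mulr_suml -big_split /=; apply: ler_sum => k _.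
have [Ck0 CkP] := CP k; rewrite -/(meet k).
case: asboolP => mk /=.
  rewrite mulr1; apply: le_trans (CkP Y B Y0); apply: lattice_count_le => i j i0; tauto.
rewrite !mulr0 !mul0r add0r; apply: (@le_trans _ _ 0); last by rewrite mulr_ge0 ?sqrtr_ge0.
rewrite /lattice_count big1 // => i _; rewrite big1 // => j _.
by rewrite asboolF // => -[].
Qed.

Lemma timed_count_lower N : (0 < N)%N -> exists2 C, 0 <= C & forall Y (B : nat), 0 <= Y ->
  box_factor * Num.sqrt Y <= B%:R ->
  3 * density * (p / N%:R * inner_pieces N) / distortion p (p / N%:R) * Y - C * Num.sqrt Y
  <= lattice_count R B (timed_sector Y).
Proof.
move=> N0; have NR : 0 < N%:R :> R by rewrite ltr0n.
set h := p / N%:R; have h0 : 0 < h by rewrite divr_gt0.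
have hN : h * N%:R = p by rewrite /h divfK // gt_eqF.
have pk (k : 'I_N) : p <= p + h * k%:R by rewrite lerDl mulr_ge0 ?ler0n // ltW.
have pk2 (k : 'I_N) : p + h * k%:R + h <= p + p.
  rewrite -addrA lerD2l -[X in _ <= X]hN -{2}[h]mulr1 -mulrDr natr1 ler_wpM2l ?ler_nat //.
  exact: ltW.
have /choice[C CP] : forall k : 'I_N, exists C, 0 <= C /\ forall Y (B : nat), 0 <= Y ->
    box_factor * Num.sqrt Y <= B%:R ->
    3 * density * h / distortion p h * Y - C * Num.sqrt Y <=
    lattice_count R B (sector (p + h * k%:R) (p + h * k%:R + h) Y).
  by move=> k; have [C C0 CP] := sector_count_lower (pk k) (ltW h0) (pk2 k); exists C.
exists (\sum_k C k); first by apply: sumr_ge0 => k _; have [] := CP k.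
move=> Y B Y0 YB; pose inn (k : 'I_N) := forall t, piece N k t -> S t.
apply: (@le_trans _ _ (\sum_(k < N) lattice_count R B
    (fun i j => inn k /\ sector (p + h * k%:R) (p + h * k%:R + h) Y i j))); last first.
  apply: lattice_count_packing => [i j k k' [_ [_ _ tk]] [_ [_ _ tk']]|i j k i0 [ik [n0 nY tk]]].
    exact: (piece_inj N0 tk tk').
  split; last exact: ik.
  split=> //; have := pk k; have := pk2 k; move: tk => /andP[? ?] ? ?.
  by apply/andP; split; lra.
rewrite /inner_pieces !mulr_sumr !mulr_suml -sumrB /=; apply: ler_sum => k _.
have [Ck0 CkP] := CP k; rewrite -/(inn k).
case: asboolP => mk /=.
  rewrite mulr1; apply: le_trans (CkP Y B Y0 YB) _; apply: lattice_count_le => i j i0; tauto.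
rewrite !mulr0 !mul0r sub0r; apply: (@le_trans _ _ 0); last exact: lattice_count_ge0.
by rewrite oppr_le0 mulr_ge0 ?sqrtr_ge0.
Qed.

End PieceCount.

(** * Reducible forms *)

Lemma primitive_zero f : ~ anisotropic f ->
  exists u v x y, x * u + y * v = 1 /\ bcf_eval f u v = 0.
Proof.
move=> /existsNP[u] /existsNP[v] /not_implyP[fuv uv0].
set g := gcdz u v; have g0 : g != 0.
  by apply/eqP => /eqP; rewrite gcdz_eq0 => /andP[/eqP ? /eqP ?]; apply: uv0.
have [x [y xy]] := Bezoutz u v; rewrite -/g in xy.
have /dvdzP[u' uE] : (g %| u)%Z by exact: dvdz_gcdl.
have /dvdzP[v' vE] : (g %| v)%Z by exact: dvdz_gcdr.
exists u', v', x, y; split.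
  by apply: (mulfI g0); rewrite mulr1 -[RHS]xy uE vE; ring.
have g3 : g ^+ 3 != 0 by rewrite expf_neq0.
apply: (mulfI g3); rewrite mulr0; transitivity (bcf_eval f (u' * g) (v' * g)).
  by rewrite /bcf_eval; ring.
by rewrite -uE -vE.
Qed.

(* Move the zero to (1, 0): then f = (0, b, c, d), and b^2 = n r, b c = n s,
   c^2 - 3 b d = n t imply D^2 b = 3 r^2 (D d - 3 t (d r - b t)). *)
Lemma zero_value_bound (Q : bqf int) f (n u v x y : int) :
  (forall k : int, bqf_disc Q <> k ^+ 2) -> 0 < n -> hessian f = bqf_scale n Q ->
  x * u + y * v = 1 -> bcf_eval f u v = 0 ->
  `|bqf_ev Q u v| ^+ 3 <= bqf_disc Q ^+ 4 * n.
Proof.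
move=> sqD n0 fH xy fuv; have dt : u * x - v * (- y) = 1 by rewrite -xy; ring.
pose f' := bcf_act f u v (- y) x.
pose q z w := bqf_ev Q (z * u + w * (- y)) (z * v + w * x).
pose r := q 1 0; pose t := q 0 1; pose s := q 1 1 - r - t.
have qE z w : q z w = r * z ^+ 2 + s * z * w + t * w ^+ 2.
  by rewrite /s /r /t /q /bqf_ev; ring.
have f'H : hessian f' = BQF (n * r) (n * s) (n * t).
  apply: bqf_ext => z w; rewrite hessian_act // fH.
  transitivity (n * q z w); first by rewrite /q /bqf_ev /=; ring.
  by rewrite qE /bqf_ev /=; ring.
have DE : s ^+ 2 - 4 * r * t = bqf_disc Q.
  transitivity (bqf_disc Q * (u * x - v * (- y)) ^+ 2); last by rewrite dt expr1n mulr1.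
  by rewrite /s /r /t /q /bqf_ev /bqf_disc; ring.
have a0 : bcf_a f' = 0.
  rewrite -[RHS]fuv /f'; case: (f) => ? ? ? ?; rewrite /bcf_eval /=; ring.
have rE : bqf_ev Q u v = r by rewrite /r /q; congr bqf_ev; ring.
rewrite rE; case: f' f'H a0 => a b c d /= [e1 e2 e3] a0; subst a.
have {e1} e1 : n * r = b ^+ 2 by rewrite -e1; ring.
have {e2} e2 : n * s = b * c by rewrite -e2; ring.
have n0' : n != 0 by rewrite gt_eqF.
have r0 : r != 0.
  apply/eqP => r0; apply: (sqD s); rewrite -DE r0; ring.
have b0 : b != 0.
  by apply/eqP => b0; move/eqP: e1; rewrite b0 expr0n mulf_eq0 (negbTE n0') (negbTE r0).
have e4 : b * s = c * r.
  apply: (mulfI n0'); rewrite mulrCA e2 [n * (c * r)]mulrCA e1; ring.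
have e5 : 3 * d * r = c * s - b * t.
  apply: (mulfI b0); apply: (mulfI n0').
  have -> : n * (b * (3 * d * r)) = 3 * b * d * (n * r) by ring.
  have -> : n * (b * (c * s - b * t)) = b * c * (n * s) - b ^+ 2 * (n * t) by ring.
  by rewrite e1 e2 -e3; ring.
pose D := bqf_disc Q.
have e6 : D * b = 3 * r * (d * r - b * t).
  rewrite /D -DE; have -> : (s ^+ 2 - 4 * r * t) * b = s * (b * s) - 4 * r * t * b by ring.
  rewrite e4; have -> : 3 * r * (d * r - b * t) = r * (3 * d * r) - 3 * r * t * b by ring.
  by rewrite e5; ring.
have e7 : D ^+ 2 * b = r ^+ 2 * (3 * (D * d - 3 * t * (d * r - b * t))).
  have -> : D ^+ 2 * b = D * (D * b) by ring.
  rewrite e6; have -> : D * (3 * r * (d * r - b * t)) = 3 * r * (D * d * r - t * (D * b)) by ring.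
  by rewrite e6; ring.
have D0 : D != 0.
  by apply/eqP => D0; apply: (sqD 0); rewrite -/D D0 expr0n.
set w := 3 * _ in e7.
have w0 : w != 0.
  apply/eqP => w0; move/eqP: e7; rewrite w0 mulr0 mulf_eq0 expf_eq0 /=.
  by rewrite (negbTE D0) (negbTE b0).
(* By [e7], r^2 divides the nonzero integer D^2 b. Squaring and using b^2 = n r then leaves the
   bound for |r|^3. *)
have rr : `|r| ^+ 2 <= D ^+ 2 * `|b|.
  have -> : D ^+ 2 * `|b| = `|r| ^+ 2 * `|w|.
    by rewrite -normrX -normrM -e7 normrM [`|D ^+ 2|]ger0_norm // sqr_ge0.
  by rewrite ler_peMr ?exprn_ge0 // -gtz0_ge1 normr_gt0.
have r0n : 0 < `|r| by rewrite normr_gt0.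
rewrite -(ler_pM2r r0n) -exprSr.
have -> : `|r| ^+ 4 = (`|r| ^+ 2) ^+ 2 by rewrite -exprM.
have -> : bqf_disc Q ^+ 4 * n * `|r| = (D ^+ 2 * `|b|) ^+ 2.
  rewrite exprMn -[`|b| ^+ 2]normrX -e1 normrM (gtr0_norm n0) /D; ring.
by rewrite lerXn2r // nnegrE ?exprn_ge0 // mulr_ge0 ?sqr_ge0.
Qed.

Section ReducibleForms.
Variables (R : realType) (Q : bqf int).
Hypotheses (Q_primitive : bqf_primitive Q).
Hypotheses (r_neq0 : bqf_r Q != 0) (D_gt0 : 0 < bqf_disc Q).
Hypothesis Q_nonsquare : forall n : int, bqf_disc Q <> n ^+ 2.
Local Notation th1 := (bqf_root1 R Q).
Local Notation th2 := (bqf_root2 R Q).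
Local Notation cf1 := (cofactor1 R Q).
Local Notation cf2 := (cofactor2 R Q).
Local Notation time := (form_time R Q).
Local Notation lin1 u v := (u%:~R + th1 * v%:~R).
Local Notation lin2 u v := (u%:~R + th2 * v%:~R).

Lemma apolar_eval f (u v : int) : apolar Q f -> 3 * (th2 - th1) * (bcf_eval f u v)%:~R =
  cf1 f * lin2 u v ^+ 3 - cf2 f * lin1 u v ^+ 3.
Proof.
move=> ap; have [aE bE cE dE] := apolar_coefs R r_neq0 D_gt0 ap.
have dth : th2 - th1 != 0 by rewrite subr_eq0 gt_eqF // root_lt.
have -> : (bcf_eval f u v)%:~R = (bcf_a f)%:~R * u%:~R ^+ 3 + (bcf_b f)%:~R * u%:~R ^+ 2 * v%:~R
   + (bcf_c f)%:~R * u%:~R * v%:~R ^+ 2 + (bcf_d f)%:~R * v%:~R ^+ 3 :> R.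
  by rewrite /bcf_eval; ring.
by rewrite aE bE cE dE; field.
Qed.

(** In the coordinates l1 = u + th1 v and l2 = u + th2 v a zero satisfies cf1 l2^3 = cf2 l1^3, so
    that the time of the form determines |l1 / l2|. *)
Lemma zero_ratio f (u v : int) : apolar Q f -> 0 < form_value R Q f ->
  bcf_eval f u v = 0 -> (u, v) <> (0, 0) ->
  `|lin1 u v| ^+ 3 = expR (3 * time f) * `|lin2 u v| ^+ 3 /\ lin2 u v != 0.
Proof.
move=> ap n0 fuv uv0; have E := apolar_eval u v ap.
rewrite fuv mulr0 in E.
have c12 : cf1 f * cf2 f != 0.
  by apply/eqP => c0; move: n0; rewrite /form_value c0 mul0r ltxx.
have [c1 c2] : cf1 f != 0 /\ cf2 f != 0 by apply/andP; rewrite -negb_or -mulf_eq0.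
have tE : expR (3 * time f) = `|cf1 f| / `|cf2 f|.
  have -> : 3 * time f = ln `|cf1 f / cf2 f| by rewrite /form_time; field.
  by rewrite lnK ?normrM ?normfV // posrE divr_gt0 ?normr_gt0.
have E' : cf2 f * lin1 u v ^+ 3 = cf1 f * lin2 u v ^+ 3 by lra.
have En : `|cf2 f| * `|lin1 u v| ^+ 3 = `|cf1 f| * `|lin2 u v| ^+ 3.
  by rewrite -!normrX -!normrM E'.
split.
  rewrite tE; have c2n : `|cf2 f| != 0 by rewrite normr_eq0.
  by apply: (mulfI c2n); rewrite En; field.
apply/eqP => l20; move/eqP: E'; rewrite l20 expr0n mulr0 mulf_eq0 (negbTE c2) expf_eq0 /=.
move=> /eqP l10; apply: uv0.
have dth : th2 - th1 != 0 by rewrite subr_eq0 gt_eqF // root_lt.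
have : (th2 - th1) * v%:~R = 0 by rewrite mulrBl; lra.
move/eqP; rewrite mulf_eq0 (negbTE dth) intr_eq0 => /eqP v0.
by move/eqP: l10; rewrite v0 mulr0 addr0 intr_eq0 => /eqP ->.
Qed.

(** z stands for the sixth root of the bound on n. For times in [p, 2p), l1 and l2 are comparable,
    so that l1^2 is at most a constant times |Q(u, v)|, whose cube is at most D^4 n < D^4 z^6. *)
Lemma zero_bound (p : R) : 0 < p -> exists2 c, 0 < c & forall f (u v x y : int) (z : R),
  apolar Q f -> 0 < form_value R Q f -> form_value R Q f < z ^+ 6 -> 0 < z ->
  p <= time f < p + p -> x * u + y * v = 1 -> bcf_eval f u v = 0 ->
  `|u%:~R| <= c * z /\ `|v%:~R| <= c * z.
Proof.
move=> p0; pose F := expR (p + p); pose G : R := F ^+ 3 * (bqf_disc Q)%:~R ^+ 4.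
have F1 : 1 <= F by rewrite /F -expR0 ler_expR addr_ge0 // ltW.
have G0 : 0 <= G by rewrite mulr_ge0 ?exprn_ge0 // ?ler0z ltW // (lt_le_trans ltr01 F1).
have dth : 0 < th2 - th1 by rewrite subr_gt0 root_lt.
(* [c1] bounds the passage from (l1, l2) back to (u, v); [c2] replaces the sixth root of G, as G <=
   c2 <= c2^6. *)
pose c1 := (2 + `|th1| + `|th2|) / (th2 - th1); pose c2 := 1 + G.
have c10 : 0 < c1 by rewrite divr_gt0 // -addrA ltr_pwDl.
have c21 : 1 <= c2 by rewrite lerDl.
exists (c1 * c2); first by rewrite mulr_gt0 // (lt_le_trans ltr01 c21).
move=> f u v x y z ap n0 nz z0 /andP[pt tp] xy fuv.
have [n fH] := apolar_hessian Q_primitive r_neq0 ap.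
have nE : form_value R Q f = n%:~R.
  by rewrite /form_value (apolar_cofactor_prod R r_neq0 D_gt0 ap fH) mulfK // intr_eq0.
rewrite nE in n0 nz; rewrite ltr0z in n0.
have qb := zero_value_bound Q_nonsquare n0 fH xy fuv.
have uv0 : (u, v) <> (0, 0).
  by case=> u0 v0; move/eqP: xy; rewrite u0 v0 !mulr0 addr0 eq_sym oner_eq0.
have n0R : 0 < form_value R Q f by rewrite nE ltr0z.
have [E l20] := zero_ratio ap n0R fuv uv0.
set l1 := lin1 u v in E *; set l2 := lin2 u v in E l20 *.
have l2p : 0 < `|l2| by rewrite normr_gt0.
have E1 : 1 <= expR (3 * time f) by rewrite -[leLHS]expR0 ler_expR; lra.
have E2 : expR (3 * time f) <= F ^+ 3 by rewrite /F -expRM_natl ler_expR; lra.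
have l21 : `|l2| <= `|l1|.
  by rewrite -(@ler_pXn2r _ 3) ?nnegrE // E ler_peMl // exprn_ge0.
have l1F : `|l1| <= F * `|l2|.
  have F0 : 0 <= F by apply: le_trans F1.
  rewrite -(@ler_pXn2r _ 3) ?nnegrE ?mulr_ge0 // E exprMn.
  by rewrite ler_wpM2r // exprn_ge0.
have qE : `|(bqf_ev Q u v)%:~R| = `|(bqf_r Q)%:~R| * (`|l1| * `|l2|) :> R.
  by rewrite (bqf_ev_factor R r_neq0 D_gt0) !normrM mulrA.
have r1 : 1 <= `|(bqf_r Q)%:~R| :> R.
  by rewrite -intr_norm ler1z -gtz0_ge1 normr_gt0.
have l1q : `|l1| ^+ 2 <= F * `|(bqf_ev Q u v)%:~R|.
  apply: (@le_trans _ _ (F * (`|l1| * `|l2|))).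
    by rewrite expr2 mulrCA ler_wpM2l.
  have F0 : 0 <= F by apply: le_trans F1.
  by rewrite ler_wpM2l // qE ler_peMl // mulr_ge0.
have l16 : `|l1| ^+ 6 <= (c2 * z) ^+ 6.
  apply: (@le_trans _ _ (G * z ^+ 6)).
    have -> : `|l1| ^+ 6 = (`|l1| ^+ 2) ^+ 3 by rewrite -exprM.
    apply: (@le_trans _ _ ((F * `|(bqf_ev Q u v)%:~R|) ^+ 3)).
      by rewrite lerXn2r // nnegrE ?exprn_ge0 // mulr_ge0 // (le_trans _ F1).
    rewrite exprMn /G -mulrA ler_wpM2l ?exprn_ge0 ?(le_trans _ F1) //.
    have : `|(bqf_ev Q u v)%:~R| ^+ 3 <= (bqf_disc Q)%:~R ^+ 4 * n%:~R :> R.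
      by rewrite -intr_norm -!rmorphXn -rmorphM ler_int.
    move=> /le_trans; apply; rewrite ler_wpM2l ?exprn_ge0 ?ler0z ?(ltW D_gt0) //.
    exact: ltW.
  rewrite exprMn ler_wpM2r ?exprn_ge0 ?(ltW z0) //.
  apply: (@le_trans _ _ c2); first by rewrite lerDr.
  by rewrite -[leLHS]expr1 ler_weXn2l.
have l1b : `|l1| <= c2 * z.
  by rewrite -(@ler_pXn2r _ 6) ?nnegrE // mulr_ge0 ?(ltW z0) // (le_trans _ c21).
have vE : (th2 - th1) * v%:~R = l2 - l1 by rewrite /l1 /l2; ring.
have uE : (th2 - th1) * u%:~R = th2 * l1 - th1 * l2 by rewrite /l1 /l2; ring.
have fin (w : R) : `|(th2 - th1) * w| <= (2 + `|th1| + `|th2|) * `|l1| -> `|w| <= c1 * c2 * z.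
  move=> wE; apply: (@le_trans _ _ (c1 * `|l1|)); last first.
    by rewrite -mulrA ler_wpM2l // ltW.
  by rewrite /c1 mulrAC ler_pdivlMr // mulrC -{1}(gtr0_norm dth) -normrM.
have l10 := normr_ge0 l1.
have t1l : 0 <= `|th1| * `|l1| by rewrite mulr_ge0.
have t2l : 0 <= `|th2| * `|l1| by rewrite mulr_ge0.
split; apply: fin.
  rewrite uE; apply: le_trans (ler_normB _ _) _; rewrite !normrM.
  have : `|th1| * `|l2| <= `|th1| * `|l1| by rewrite ler_wpM2l.
  by lra.
rewrite vE; apply: le_trans (ler_normB _ _) _; lra.
Qed.

End ReducibleForms.

Section LatticeGraphCount.
Variable R : realType.

Lemma lattice_count_graph B (P : int -> int -> Prop) (x : R) : 0 <= x ->
  (forall i j j', 0 < i -> P i j -> P i j' -> j = j') ->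
  (forall i j, 0 < i -> P i j -> i%:~R <= x) ->
  lattice_count R B P <= x.
Proof.
move=> x0 Pu Px.
apply: (@le_trans _ _ (\sum_(i < B) (0 <= i%:R + 0 <= x - 1)%R%:R)); last first.
  by apply: le_trans (count_interval_le _ _ _) _; lra.
apply: ler_sum => i _; rewrite addr0 ler0n /=.
have [[j0 Pj0]|no] := pselect (exists j : 'I_(2 * B).+1, P i.+1%:Z (j%:Z - B%:Z)).
  rewrite (bigD1 j0) //= (asboolT Pj0) big1 => [|j jj0].
    have := Px i.+1%:Z _ isT Pj0; rewrite -pmulrn -natr1 addr0 => ix.
    by rewrite (_ : (i%:R <= x - 1)) //; lra.
  rewrite asboolF // => Pj; move/eqP: jj0; apply; apply/val_inj.
  have /eqP := Pu i.+1%:Z _ _ isT Pj Pj0.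
  by rewrite (inj_eq (addIr _)) eqz_nat => /eqP.
rewrite big1 ?ler0n // => j _; rewrite asboolF // => Pj.
by apply: no; exists j.
Qed.

End LatticeGraphCount.

Lemma box_index (m : nat) (w : int) : `|w| <= m%:Z ->
  exists k : 'I_(2 * m).+1, (k : nat)%:Z - m%:Z = w.
Proof.
move=> wm; have lt : (`|(w + m%:Z)%R| < (2 * m).+1)%N by lia.
by exists (Ordinal lt) => /=; lia.
Qed.

Section ReducibleCount.
Variables (R : realType) (Q : bqf int).
Hypotheses (Q_primitive : bqf_primitive Q).
Hypotheses (r_neq0 : bqf_r Q != 0) (D_gt0 : 0 < bqf_disc Q).
Hypothesis Q_nonsquare : forall n : int, bqf_disc Q <> n ^+ 2.
Variables (a0 b0 b1 : int) (g : int -> int -> bcf).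
Hypotheses (a0_gt0 : 0 < a0) (b1_gt0 : 0 < b1).
Hypothesis gP : forall i j, [/\ apolar Q (g i j), bcf_a (g i j) = i * a0 &
                    bcf_b (g i j) = i * b0 + j * b1].
Variables (p : R).
Hypothesis p_gt0 : 0 < p.
Local Notation th1 := (bqf_root1 R Q).
Local Notation th2 := (bqf_root2 R Q).

(** In a row, where a is fixed, vanishing at (u, v) is a linear equation in j with leading
    coefficient b1 (l2^3 - l1^3), and |l1| > |l2| at positive times. *)
Lemma zero_determines i j j' (u v : int) : 0 < i -> (u, v) <> (0, 0) ->
  0 < form_value R Q (g i j) -> 0 < form_value R Q (g i j') ->
  0 < form_time R Q (g i j) ->
  bcf_eval (g i j) u v = 0 -> bcf_eval (g i j') u v = 0 -> j = j'.
Proof.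
move=> i0 uv0 n0 n0' t0 z z'.
have [ap aE bE] := gP i j; have [ap' aE' bE'] := gP i j'.
have [rat l20] := zero_ratio r_neq0 D_gt0 ap n0 z uv0.
have E := apolar_eval R r_neq0 D_gt0 u v ap; have E' := apolar_eval R r_neq0 D_gt0 u v ap'.
move: E E'; rewrite z z' !mulr0 /cofactor1 /cofactor2 aE aE' bE bE'.
set l1 := (u%:~R + th1 * v%:~R) in rat *; set l2 := (u%:~R + th2 * v%:~R) in rat l20 *.
move=> E E'.
have l12 : l2 ^+ 3 - l1 ^+ 3 != 0.
  rewrite subr_eq0; apply/eqP => l12.
  have l2p : 0 < `|l2| ^+ 3 by rewrite exprn_gt0 // normr_gt0.
  have : `|l1| ^+ 3 = `|l2| ^+ 3 by rewrite -!normrX l12.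
  rewrite rat => /eqP; rewrite -[X in _ == X]mul1r (inj_eq (mulIf (lt0r_neq0 l2p))).
  by rewrite gt_eqF // expR3_gt1.
have b1R : b1%:~R != 0 :> R by rewrite intr_eq0 gt_eqF.
apply: (@intr_inj R); apply: (mulfI b1R); apply: (mulIf l12).
move: E E'; rewrite !rmorphD !rmorphM /=; lra.
Qed.

Lemma reducible_count (eps : R) : 0 < eps -> exists2 Y0, 0 < Y0 & forall Y B, Y0 <= Y ->
  lattice_count R B (fun i j => sector Q g p (p + p) Y i j /\ ~ anisotropic (g i j))
  <= eps * Y.
Proof.
move=> eps0; have [c c0 cP] := zero_bound Q_primitive r_neq0 D_gt0 Q_nonsquare p_gt0.
have pp0 : 0 < p + p by exact: addr_gt0.
set rd := sector_radius Q a0 (p + p).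
have rd0 : 0 < rd by exact: sector_radius_gt0.
(* Chosen to make (2c + 3)^2 rd z^5 <= eps z^6 for z >= z0, where z^6 = Y. *)
pose z0 := 1 + (2 * c + 3) ^+ 2 * rd / eps.
have z01 : 1 <= z0.
  by rewrite lerDl; apply: divr_ge0; [apply: mulr_ge0; rewrite ?sqr_ge0 // ltW|exact: ltW].
exists (z0 ^+ 6); first by rewrite exprn_gt0 // (lt_le_trans ltr01 z01).
move=> Y B YY0; have Y0 : 0 <= Y by apply: le_trans YY0; rewrite exprn_ge0 // (le_trans ler01 z01).
have [z zE] := cube_root_exists (Num.sqrt Y).
have z00 : 0 <= z.
  have : 0 <= z ^+ 3 by rewrite zE sqrtr_ge0.
  by rewrite exprn_odd_ge0.
have z6 : z ^+ 6 = Y by rewrite (exprM z 3 2) zE sqr_sqrtr.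
have zz0 : z0 <= z.
  by rewrite -(@ler_pXn2r _ 6) ?nnegrE ?z6 // (le_trans ler01 z01).
have z1 : 1 <= z by apply: le_trans zz0.
pose m := `|Num.ceil (c * z)|%N.
have mE : m%:R = (Num.ceil (c * z))%:~R :> R.
  by rewrite /m pmulrn gez0_abs // ceil_ge0 (lt_le_trans (ltrN10 R)) // mulr_ge0 // ltW.
have /andP[ml mu] := ceil_itv (c * z); rewrite rmorphB /= -mE in ml; rewrite -mE in mu.
pose T := ('I_(2 * m).+1 * 'I_(2 * m).+1)%type.
pose pu (ab : T) : int := (ab.1 : nat)%:Z - m%:Z; pose pv (ab : T) : int := (ab.2 : nat)%:Z - m%:Z.
pose PI (ab : T) i j := sector Q g p (p + p) Y i j /\
   (pu ab, pv ab) <> (0, 0) /\ bcf_eval (g i j) (pu ab) (pv ab) = 0.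
have ordE (w : int) : `|w%:~R| <= c * z -> exists k : 'I_(2 * m).+1, (k : nat)%:Z - m%:Z = w.
  move=> wc; have : `|w| <= m%:Z.
    by rewrite -(ler_int R) intr_norm -pmulrn; apply: le_trans wc mu.
  exact: box_index.
apply: (@le_trans _ _ (\sum_(ab : T) lattice_count R B (PI ab))).
  apply: lattice_count_cover => i j i0 [sec /primitive_zero[u [v [x [y [xy fuv]]]]]].
  have [n0 nY tI] := sec; have [ap _ _] := gP i j.
  rewrite -z6 in nY; have [ub vb] := cP _ _ _ _ _ _ ap n0 nY (lt_le_trans ltr01 z1) tI xy fuv.
  have [k1 k1E] := ordE u ub; have [k2 k2E] := ordE v vb.
  exists (k1, k2); split => //; rewrite /pu /pv /= k1E k2E; split => //.
  by case=> u0 v0; move/eqP: xy; rewrite u0 v0 !mulr0 addr0 eq_sym oner_eq0.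
(* Each candidate zero accounts for at most one form in each of the rd z^3 rows, and there are (2m +
   1)^2 <= ((2c + 3) z)^2 candidates. *)
apply: (@le_trans _ _ (\sum_(ab : T) (rd * z ^+ 3))).
  apply: ler_sum => ab _; apply: lattice_count_graph.
  - by rewrite mulr_ge0 ?exprn_ge0 // ltW.
  - move=> i j j' i0 [[n0 _ /andP[pt _]] [uv0 e1]] [[n0' _ _] [_ e2]].
    by apply: (zero_determines i0 uv0 n0 n0' _ e1 e2); exact: lt_le_trans p_gt0 pt.
  - move=> i j i0 [sec _]; rewrite zE.
    have pp : p <= p + p by rewrite lerDl ltW.
    by have [] := sector_sub r_neq0 D_gt0 a0_gt0 b1_gt0 gP i0 p_gt0 pp Y0 sec.
rewrite sumr_const cardT -cardE card_prod card_ord -mulr_natr natrM.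
have M : ((2 * m).+1)%:R <= (2 * c + 3) * z :> R.
  rewrite -natr1 natrM; have : 1 * 1 <= z by rewrite mul1r.
  by lra.
have M0 : 0 <= ((2 * m).+1)%:R :> R by rewrite ler0n.
apply: (@le_trans _ _ (rd * z ^+ 3 * (((2 * c + 3) * z) * ((2 * c + 3) * z)))).
  rewrite ler_wpM2l ?mulr_ge0 ?exprn_ge0 ?(ltW rd0) //.
  by apply: ler_pM.
have -> : rd * z ^+ 3 * (((2 * c + 3) * z) * ((2 * c + 3) * z)) =
  ((2 * c + 3) ^+ 2 * rd) * z ^+ 5 by ring.
have -> : eps * Y = eps * z * z ^+ 5 by rewrite -z6; ring.
rewrite ler_wpM2r ?exprn_ge0 //.
rewrite [leRHS]mulrC -ler_pdivrMr //; apply: le_trans zz0.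
by rewrite /z0 lerDr.
Qed.

End ReducibleCount.

(** * Jordan content and arc length *)

Section Cells.
Variables (R : realType) (p : R).
Hypothesis p_gt0 : 0 < p.
Local Notation leb := (@lebesgue_measure R).

Definition cell (N k : nat) : set R :=
  `[p / N%:R * k%:R, p / N%:R * k%:R + p / N%:R[%classic.

Let width_gt0 N : (0 < N)%N -> 0 < p / N%:R.
Proof. by move=> N0; rewrite divr_gt0 // ltr0n. Qed.

Lemma cell_inj N k l t : (0 < N)%N -> cell N k t -> cell N l t -> k = l.
Proof.
move=> N0; have h0 := width_gt0 N0.
rewrite /cell /= !in_itv /=; set h := p / N%:R in h0 *.
have aux a b : h * a%:R <= t -> t < h * b%:R + h -> (a <= b)%N.
  move=> ta tb; rewrite -ltnS -(ltr_nat R) -(ltr_pM2l h0) (le_lt_trans ta) //.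
  by rewrite -natr1 mulrDr mulr1.
by move=> /andP[k1 k2] /andP[l1 l2]; apply/eqP; rewrite eqn_leq !aux.
Qed.

Lemma measure_cells N (P : pred nat) : (0 < N)%N ->
  leb (\big[setU/set0]_(k < N | P k) cell N k) =
  (p / N%:R * \sum_(k < N) (P k)%:R)%:E.
Proof.
move=> N0; have h0 := width_gt0 N0.
rewrite (@measure_bigsetU_ord_cond _ R _ leb _ (fun k : 'I_N => P k) (fun k : 'I_N => cell N k)).
- rewrite (eq_bigr (fun=> (p / N%:R)%:E)); last first.
    move=> k _; transitivity (leb (cell N k)) => //.
    by rewrite /cell lebesgue_measure_itv /= lte_fin ltrDl h0 -EFinD addrC addrA addNr add0r.
  rewrite sumEFin mulr_sumr big_mkcond /=; congr _%:E.
  by apply: eq_bigr => k _; case: (P k); rewrite ?mulr1 ?mulr0.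
- by move=> k _; exact: measurable_itv.
- by move=> k l _ _ [t [tk tl]]; apply/val_inj; exact: cell_inj tk tl.
Qed.

Lemma cell_cover N t : (0 < N)%N -> 0 <= t < p -> exists k : 'I_N, cell N k t.
Proof.
move=> N0 /andP[t0 tp]; have h0 := width_gt0 N0; have NR : N%:R != 0 :> R by rewrite pnatr_eq0 -lt0n.
pose k := Num.trunc (t / (p / N%:R)).
have /andP[k1 k2] : k%:R <= t / (p / N%:R) < k.+1%:R by rewrite truncn_itv // divr_ge0 // ltW.
rewrite ler_pdivlMr // in k1; rewrite ltr_pdivrMr // in k2.
have kN : (k < N)%N.
  rewrite -(ltr_nat R) -(ltr_pM2r h0) (le_lt_trans k1) //.
  by rewrite mulrCA divff // mulr1.
exists (Ordinal kN); rewrite /cell /= in_itv /=.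
by rewrite [_ * k%:R]mulrC k1 /= (lt_le_trans k2) // -natr1 mulrDl mul1r.
Qed.

Lemma cell_sub N k t : (k < N)%N -> cell N k t -> 0 <= t < p.
Proof.
move=> kN; have N0 : (0 < N)%N := leq_ltn_trans (leq0n _) kN.
have h0 := width_gt0 N0; have NR : N%:R != 0 :> R by rewrite pnatr_eq0 -lt0n.
rewrite /cell /= in_itv /= => /andP[t1 t2].
apply/andP; split; first by apply: le_trans t1; rewrite mulr_ge0 // ltW.
apply: (lt_le_trans t2).
have -> : p / N%:R * k%:R + p / N%:R = p / N%:R * k.+1%:R by rewrite -natr1 mulrDr mulr1.
by rewrite -[leRHS](divfK NR) ler_wpM2l ?(ltW h0) // ler_nat.
Qed.

Variable S : set R.

Definition common_boundary : set R := `[0, p]%classic `&` (closure S `&` closure (~` S)).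

(** The segment is covered by the closures of S and of its complement; were these disjoint on it,
    the first would be open and closed there, and connectedness would put y in both. *)
Lemma boundary_between x y : S x -> ~ S y -> 0 <= Num.min x y -> Num.max x y <= p ->
  exists2 z, common_boundary z & Num.min x y <= z <= Num.max x y.
Proof.
move=> Sx Sy m0 Mp; set I := `[Num.min x y, Num.max x y]%classic.
have xI : I x by rewrite /I /= in_itv /= ge_min le_max !lexx.
have yI : I y by rewrite /I /= in_itv /= ge_min le_max !lexx !orbT.
apply: contrapT => nz.
have dis z : I z -> closure S z -> closure (~` S) z -> False.
  move=> zI c1 c2; apply: nz; exists z; last by move: zI; rewrite /I /= in_itv.
  split=> //; move: zI; rewrite /I /= !in_itv /= => /andP[z1 z2].
  by rewrite (le_trans m0 z1) (le_trans z2 Mp).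
have cl z : S z \/ ~ S z by exact: EM.
have: I `&` closure S = I.
  apply: (@segment_connected R (Num.min x y) (Num.max x y)).
  - by exists x; split => //; exact: subset_closure.
  - exists (~` closure (~` S)); first by rewrite openC; exact: closed_closure.
    apply/seteqP; split=> z [zI zS]; split=> //; first by move=> /dis; apply.
    apply: subset_closure; apply: contrapT => nS; apply: zS; exact: subset_closure.
  - by exists (closure S) => //; exact: closed_closure.
move=> /seteqP[_ /(_ y yI)] [_ cy]; apply: (dis y yI cy); exact: subset_closure.
Qed.

(** As K is closed, its 1/n-neighborhoods decrease to K; they are bounded, so that their measures
    tend to that of K by continuity from above. *)
Lemma thin_neighborhood (K : set R) (eps : R) : closed K -> K `<=` `[0, p]%classic ->
  leb K = 0%E -> 0 < eps -> exists2 d, 0 < d &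
  exists U : set R, [/\ measurable (U : set (measurableTypeR R)), (leb U <= eps%:E)%E &
                forall z t, K z -> `|t - z| < d -> U t].
Proof.
move=> Kc Kp K0 e0.
pose U n := \bigcup_(z in K) (ball z n.+1%:R^-1 : set R).
have Uo n : open (U n).
  by apply: bigcup_open => z _; apply: ball_open; rewrite invr_gt0 ltr0n.
have mU n : measurable (U n) := open_measurable (Uo n).
have capU : \bigcap_n U n = K.
  apply/seteqP; split=> [t tU|t Kt n _]; last first.
    by exists t => //; apply: ballxx; rewrite invr_gt0 ltr0n.
  apply: Kc => A /nbhs_ballP [d /= d0 dA].
  have [n _ dn] := near_infty_natSinv_lt (PosNum d0).
  have [z Kz zt] := tU n I.
  exists z; split => //; apply: dA; apply: ball_sym; apply: le_ball zt.
  exact: ltW (dn n (leqnn n)).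
have dU : nonincreasing_seq U.
  move=> m n mn; apply/subsetPset => t [z Kz zt]; exists z => //.
  by apply: le_ball zt; rewrite lef_pV2 ?posrE ?ltr0n // ler_nat ltnS.
have U0 : (leb (U 0%N) < +oo)%E.
  apply: (@le_lt_trans _ _ (leb (`[-1, p + 1]%classic))).
    apply: (le_measure leb); rewrite ?inE; [exact: mU|exact: measurable_itv|].
    move=> t [z Kz]; move: (Kp z Kz); rewrite /ball /= !in_itv /= invr1 ltr_norml => /andP[z0 zp] /andP[z1 z2].
    by apply/andP; split; lra.
  by rewrite lebesgue_measure_itv /=; case: ifP => _; rewrite ?ltry // -EFinB ltry.
have mK : measurable (\bigcap_n U n) by apply: bigcapT_measurable.
have: leb \o U @ \oo --> leb (\bigcap_n U n) := nonincreasing_cvg_mu U0 mU mK dU.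
rewrite capU K0.
move=> /fine_cvgP [fU fc].
have [n _ Hn] : \forall n \near \oo, leb (U n) \is a fin_num /\ fine (leb (U n)) < eps.
  by apply: filterI; [exact: fU|exact: (cvgr_lt _ fc)].
have [fn en] := Hn n (leqnn n).
exists n.+1%:R^-1; first by rewrite invr_gt0 ltr0n.
exists (U n); split; [exact: mU|by move: en => /ltW; rewrite -lee_fin fineK|].
by move=> z t Kz zt; exists z; rewrite // /ball /= distrC.
Qed.

Hypothesis measurable_S : measurable (`[0, p[%classic `&` S : set (measurableTypeR R)).
Hypothesis null_boundary : leb common_boundary = 0%E.

(** A cell that meets S without being inside S contains a boundary point between two of its points;
    once cells are shorter than d, it lies in the thin neighborhood of the boundary. *)
Lemma jordan_cells (eps : R) : 0 < eps -> exists N0 : nat, forall N, (N0 <= N)%N -> (0 < N)%N ->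
  let l := fine (leb (`[0, p[%classic `&` S)) in
  p / N%:R * \sum_(k < N) `[<exists2 t, cell N k t & S t>]%:R <= l + eps /\
  l - eps <= p / N%:R * \sum_(k < N) `[<forall t, cell N k t -> S t>]%:R.
Proof.
move=> e0.
have Kc : closed common_boundary.
  apply: closedI; first exact: itv_closed.
  by apply: closedI; exact: closed_closure.
have Kp : common_boundary `<=` `[0, p]%classic by move=> t [].
have [d d0 [U [mU Ue Ud]]] := thin_neighborhood Kc Kp null_boundary e0.
exists (Num.trunc (p / d)).+1 => N N0 Npos; have h0 := width_gt0 Npos.
have NR : 0 < N%:R :> R by rewrite ltr0n.
have hd : p / N%:R < d.
  rewrite ltr_pdivrMr // mulrC -ltr_pdivrMr //.
  by apply: lt_le_trans (_ : (Num.trunc (p / d)).+1%:R <= _); rewrite ?truncnS_gt ?ler_nat.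
set A := `[0, p[%classic `&` S => l.
pose meets k := `[<exists2 t, cell N k t & S t>].
pose inside k := `[<forall t, cell N k t -> S t>].
set M := \big[setU/set0]_(k < N | meets k) cell N k.
set J := \big[setU/set0]_(k < N | inside k) cell N k.
have mM : leb M = (p / N%:R * \sum_(k < N) (meets k)%:R)%:E by exact: measure_cells.
have mJ : leb J = (p / N%:R * \sum_(k < N) (inside k)%:R)%:E by exact: measure_cells.
have mcell (P : pred nat) : measurable (\big[setU/set0]_(k < N | P k) cell N k : set (measurableTypeR R)).
  by apply: bigsetU_measurable => k _; exact: measurable_itv.
have inP (P : pred nat) t : (\big[setU/set0]_(k < N | P k) cell N k) t <->
    exists k : 'I_N, P k /\ cell N k t.
  rewrite big_mkcond -(bigcup_mkord N (fun k => if P k then cell N k else set0)).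
  split=> [[k /= kN]|[k [Pk kt]]]; last by exists k => //=; rewrite Pk.
  by case: (boolP (P k)) => // Pk kt; exists (Ordinal kN).
have JA : (leb J <= leb A)%E.
  apply: (le_measure leb); rewrite ?inE; [exact: mcell|exact: measurable_S|].
  move=> t /inP [k [/asboolP kS kt]]; split; last exact: kS.
  by rewrite /= in_itv; exact: cell_sub kt.
have AM : (leb A <= leb M)%E.
  apply: (le_measure leb); rewrite ?inE; [exact: measurable_S|exact: mcell|].
  move=> t [+ St]; rewrite /= in_itv => /(cell_cover Npos) [k kt].
  by apply/inP; exists k; split=> //; apply/asboolP; exists t.
have MJ : (leb M <= leb J + eps%:E)%E.
  apply: (@le_trans _ _ (leb (J `|` U))).
    apply: (le_measure leb); rewrite ?inE; [exact: mcell|exact: measurableU (mcell _) mU|].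
    move=> t /inP [k [/asboolP [x kx Sx] kt]].
    have [ki|] := boolP (inside k); first by left; apply/inP; exists k.
    move=> /asboolPn /existsNP [y /not_implyP [ky Sy]]; right.
    have /andP[x0 xp] := cell_sub (ltn_ord k) kx; have /andP[y0 yp] := cell_sub (ltn_ord k) ky.
    have [||z Kz zI] := boundary_between Sx Sy.
    - by rewrite le_min x0 y0.
    - by rewrite ge_max !ltW.
    apply: Ud Kz _; apply: le_lt_trans hd.
    move: kx ky kt zI; rewrite /cell /= !in_itv /= => /andP[x1 x2] /andP[y1 y2] /andP[t1 t2].
    rewrite ge_min le_max => /andP[/orP z1 /orP z2]; rewrite ler_norml; apply/andP.
    by case: z1 => z1; case: z2 => z2; split; lra.
  have JU : (leb (J `|` U) <= leb J + leb U)%E by apply: (measureU2 leb); [exact: mcell|exact: mU].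
  by apply: (le_trans JU); exact: leeD2l.
have Afin : leb A \is a fin_num.
  rewrite ge0_fin_numE //; apply: (le_lt_trans AM); by rewrite mM ltry.
have lE : leb A = l%:E by rewrite fineK.
rewrite lE mM mJ -?EFinD !lee_fin in JA AM MJ.
by split; rewrite -/meets -/inside; lra.
Qed.
End Cells.

Lemma continuous_complex (R : realType) (u v : R -> R) : continuous u -> continuous v ->
  continuous (fun t => Complex (u t) (v t) : R[i]^o).
Proof.
move=> cu cv t; apply/cvgrPdist_lt => e e0.
have [e1 [eE e10]] : exists e1 : R, e = e1%:C%C /\ 0 < e1.
  by move: e0; case: e => x y; rewrite ltcE /= => /andP[/eqP -> x0]; exists x.
rewrite eE; have e20 : 0 < e1 / 2 by rewrite divr_gt0.
have cu' := cu t; have cv' := cv t.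
move/cvgrPdist_lt: cu' => /(_ _ e20) hu.
move/cvgrPdist_lt: cv' => /(_ _ e20) hv.
apply: filterS2 hu hv => x hu hv.
rewrite [`|_|]normc_def ltcR /=.
have e1E : Num.sqrt (e1 ^+ 2) = e1 by rewrite sqrtr_sqr gtr0_norm.
rewrite -[ltRHS]e1E ltr_sqrt ?exprn_gt0 //.
move: hu hv; move: (u t) (u x) (v t) (v x) => a b c d hu hv.
have sq y : `|y| < e1 / 2 -> y ^+ 2 < (e1 / 2) ^+ 2.
  by move=> ye; rewrite -real_normK ?num_real // ltrXn2r.
have := sq _ hu; have := sq _ hv; have := mulr_gt0 e10 e10.
have -> : (e1 / 2) ^+ 2 = e1 * e1 / 4 by field.
by move=> *; rewrite [ltRHS]expr2; lra.
Qed.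

(** * Pulling sets back from the modular surface to the line of times *)

Section GammaContinuity.
Variables (R : realType) (Q : bqf int).
Hypotheses (r_neq0 : bqf_r Q != 0) (D_gt0 : 0 < bqf_disc Q).

Lemma gamma_continuous : continuous (fun t : R => gamma Q t : R[i]^o).
Proof.
have -> : (fun t => gamma Q t) = (fun t => geodesic (bqf_root1 R Q) (bqf_root2 R Q) t).
  by apply/funext => t; rewrite gammaE.
under eq_fun do rewrite geodesicE.
have cE : continuous (@expR R) by exact: continuous_expR.
have E0 (t : R) : 1 + expR t ^+ 2 != 0 by rewrite gt_eqF // ltr_wpDr ?sqr_ge0.
have cE2 : continuous (fun t : R => expR t ^+ 2).
  by move=> t; exact: (cvgM (cE t) (cE t)).
have cV : continuous (fun t : R => (1 + expR t ^+ 2)^-1).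
  by move=> t; apply: cvgV; [exact: E0|apply: cvgD; [exact: cvg_cst|exact: cE2]].
apply: continuous_complex => t.
  apply: cvgM; last exact: cV.
  by apply: cvgD; [exact: cvg_cst|apply: cvgM; [exact: cvg_cst|exact: cE2]].
apply: cvgM; last exact: cV.
by apply: cvgM; [exact: cvg_cst|exact: cE].
Qed.

Lemma modular_class_gamma_continuous :
  continuous (fun t : R => modular_class (gamma Q t) : modular_surface R).
Proof.
(* Lifting the curve to the subtype removes the default value of [insubd], whose continuity would
   not be visible. *)
pose psi (t : R) : set_type (half_plane R) := SigSub (mem_set (@gamma_half_plane R Q r_neq0 D_gt0 t)).
have -> : (fun t => modular_class (gamma Q t)) =
    (\pi_(quotient_topology {eq_quot (modular_equiv R)}))%qT \o psi.
  apply/funext => t /=; rewrite /modular_class; congr (\pi_ _)%qT.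
  by apply/val_inj; rewrite insubdK //=; exact/mem_set/gamma_half_plane.
have cpsi : continuous psi.
  apply: continuous_comp_initial; exact: gamma_continuous.
by move=> t; apply: continuous_comp; [exact: cpsi|exact: pi_continuous].
Qed.

Local Notation phi := (fun t : R => modular_class (gamma Q t)).
Local Notation p := (gamma_period R Q).

Lemma muE W : mu Q W = lebesgue_measure (`[0, p[%classic `&` phi @^-1` W).
Proof. by congr lebesgue_measure; apply/seteqP; split=> t /=; rewrite in_itv. Qed.

Lemma measurable_modular_class_gamma (W : set (modular_surface R)) :
  <<s [set U | open U] >> W -> measurable (phi @^-1` W : set (measurableTypeR R)).
Proof.
pose V := [set W | measurable (phi @^-1` W : set (measurableTypeR R))].
suff: <<s [set U | open U] >> `<=` V by apply.
apply: smallest_sub => [|U oU].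
  split => [|A mA|F mF]; rewrite /V /=.
  - by rewrite preimage_set0; exact: measurable0.
  - by rewrite setTD preimage_setC; exact: measurableC.
  - by rewrite preimage_bigcup; exact: bigcupT_measurable.
apply: open_measurable; apply: open_comp oU => t _.
exact: modular_class_gamma_continuous.
Qed.

(** Continuity sends closures into closures, so that a boundary time in [0, p) lies over the
    relative boundary of W. [mu] sees only [0, p); the endpoint p adds one null point. *)
Lemma null_common_boundary (W : set (modular_surface R)) :
  mu Q (rel_boundary (gamma_class R Q) W) = 0%E ->
  lebesgue_measure (common_boundary p (phi @^-1` W)) = 0%E.
Proof.
rewrite muE => bd0; set S := phi @^-1` W.
have cphi := modular_class_gamma_continuous.
have cl A B : (forall t, A t -> B (phi t)) -> forall t : R, closure A t -> closure B (phi t).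
  move=> AB t At N Nt; have [x [Ax Nx]] := At _ (cphi t _ Nt).
  by exists (phi x); split=> //; exact: AB.
have mK : measurable (common_boundary p S : set (measurableTypeR R)).
  apply: closed_measurable; apply: closedI; first exact: itv_closed.
  by apply: closedI; exact: closed_closure.
apply/eqP; rewrite eq_le measure_ge0 andbT.
pose B := `[0, p[%classic `&` phi @^-1` rel_boundary (gamma_class R Q) W.
have mB : measurable (B : set (measurableTypeR R)).
  apply: measurableI; first exact: measurable_itv.
  have -> : phi @^-1` rel_boundary (gamma_class R Q) W =
      phi @^-1` closure W `&` phi @^-1` closure (gamma_class R Q `\` W).
    by apply/seteqP; split=> t; [move=> [[? ?] _]; split|move=> [? ?]; split; [split|exists t]].
  by apply: measurableI; apply: closed_measurable; apply: closed_comp => [t _|];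
    [exact: cphi|exact: closed_closure|exact: cphi|exact: closed_closure].
have KB : common_boundary p S `<=` B `|` [set p].
  move=> t [tp [t1 t2]]; have [->|tnp] := eqVneq t p; [by right|left; split].
    by move: tp; rewrite /= !in_itv /= => /andP[-> tp]; rewrite lt_neqAle tnp.
  split; last by exists t.
  split; first exact: cl t1.
  by apply: cl t2 => x nx; split => //; exists x.
apply: (@le_trans _ _ (lebesgue_measure (B `|` [set p]))).
  by apply: (le_measure (@lebesgue_measure R)); rewrite ?inE //; exact: measurableU mB (measurable_set1 p).
have BU : (lebesgue_measure (B `|` [set p]) <= lebesgue_measure B + lebesgue_measure [set p])%E.
  by apply: (measureU2 (@lebesgue_measure R)).
by apply: (le_trans BU); rewrite lebesgue_measure_set1 bd0 adde0.
Qed.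
End GammaContinuity.

(** * Asymptotics *)

Section RingCount.
Variables (R : realType) (Q : bqf int).
Hypotheses (Q_primitive : bqf_primitive Q).
Hypotheses (r_neq0 : bqf_r Q != 0) (D_gt0 : 0 < bqf_disc Q).
Hypothesis Q_nonsquare : forall n : int, bqf_disc Q <> n ^+ 2.
Variables (a0 b0 b1 : int) (g : int -> int -> bcf).
Hypotheses (a0_gt0 : 0 < a0) (b1_gt0 : 0 < b1).
Hypothesis gP : forall i j, [/\ apolar Q (g i j), bcf_a (g i j) = i * a0 &
                    bcf_b (g i j) = i * b0 + j * b1].
Hypothesis g_surj : forall f, apolar Q f -> exists i j, g i j = f.

Local Notation p := (gamma_period R Q).
Local Notation phi := (fun t : R => modular_class (gamma Q t)).
Local Notation time := (form_time R Q).
Let p_gt0 : 0 < p := (gamma_period_minimal R r_neq0 D_gt0 Q_nonsquare).1.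

(* A form with Hessian n Q has discriminant - n^2 D / 3, so that the bound X on
   discriminants is the bound value_bound X on n. *)
Definition value_bound (X : R) : R := Num.sqrt (3 * X / (bqf_disc Q)%:~R).

Lemma value_boundP (X : R) (n : int) : 0 < X -> 0 < n ->
  ((n ^+ 2 * bqf_disc Q)%:~R < 3 * X) = (n%:~R < value_bound X).
Proof.
move=> X0 n0; have DR : 0 < (bqf_disc Q)%:~R :> R by rewrite ltr0z.
have nR : 0 < n%:~R :> R by rewrite ltr0z.
have nE : n%:~R = Num.sqrt (n%:~R ^+ 2) :> R by rewrite sqrtr_sqr gtr0_norm.
rewrite [X in _ = (X < _)]nE ltr_sqrt ?divr_gt0 ?mulr_gt0 //.
by rewrite ltr_pdivlMr // rmorphM /= rmorphXn.
Qed.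

Lemma reduced_formP (X : R) W f : 0 < X -> reduced_form Q X W f <->
  [/\ apolar Q f, anisotropic f & 0 < bcf_a f] /\
  [/\ 0 < form_value R Q f, form_value R Q f < value_bound X,
      p <= time f < p + p & W (phi (time f))].
Proof.
move=> X0; have rR : (bqf_r Q)%:~R != 0 :> R by rewrite intr_eq0.
have vE n : apolar Q f -> hessian f = bqf_scale n Q -> form_value R Q f = n%:~R.
  by move=> ap fH; rewrite /form_value (apolar_cofactor_prod R r_neq0 D_gt0 ap fH) mulfK.
split=> [[n [[n0 fH an] nX a0' tI Wt]]|[[ap an a0'] [v0 vX tI Wt]]].
  have n0' : n != 0 by rewrite gt_eqF.
  have ap := hessian_apolar n0' fH.
  by rewrite (vE n) // ltr0z -value_boundP.
have [n fH] := apolar_hessian Q_primitive r_neq0 ap.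
rewrite (vE n) // ltr0z in v0 vX.
by exists n; split=> //; rewrite value_boundP.
Qed.

Lemma N_rings_lattice_count (X : R) W (B : nat) : 0 < X ->
  box_factor Q a0 b0 b1 p * Num.sqrt (value_bound X) <= B%:R ->
  (N_rings Q X W)%:R = lattice_count R B (fun i j =>
    timed_sector Q g p (fun t => W (phi t)) (value_bound X) i j /\ anisotropic (g i j)).
Proof.
move=> X0 YB; set Y := value_bound X in YB *.
set PP := fun i j : int => _.
pose P (x : 'I_B * 'I_(2 * B).+1) := `[< PP x.1.+1%:Z (x.2%:Z - B%:Z) >].
pose gg (x : 'I_B * 'I_(2 * B).+1) := g x.1.+1%:Z (x.2%:Z - B%:Z).
have Y0 : 0 <= Y by exact: sqrtr_ge0.
rewrite (@N_rings_card R Q Q_primitive r_neq0 D_gt0 Q_nonsquare X W _ P gg).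
- rewrite -sum1_card natr_sum big_mkcond /= /lattice_count pair_big /=.
  by apply: eq_bigr => x _; rewrite unfold_in /P; case: (asboolP (PP _ _)).
- move=> [i j] [i' j'] _ _; rewrite /gg /= => gE.
  have [_ aE bE] := gP i.+1%:Z (j%:Z - B%:Z).
  have [_ aE' bE'] := gP i'.+1%:Z (j'%:Z - B%:Z).
  have a0' : a0 != 0 by rewrite gt_eqF.
  have b1' : b1 != 0 by rewrite gt_eqF.
  have iE : i.+1%:Z = i'.+1%:Z by apply: (mulIf a0'); rewrite -aE -aE' gE.
  have jE : j%:Z - B%:Z = j'%:Z - B%:Z.
    by apply: (mulIf b1'); apply: (addrI (i.+1%:Z * b0)); rewrite -bE gE bE' iE.
  have iE' : i = i' by apply/val_inj => /=; lia.
  have jE' : j = j' by apply/val_inj => /=; lia.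
  by rewrite iE' jE'.
- move=> [i j] /asboolP [[[v0 vY tI] Wt] an]; apply/reduced_formP => //.
  have [ap aE _] := gP i.+1%:Z (j%:Z - B%:Z).
  by split; split => //; rewrite /gg /= aE mulr_gt0.
move=> f /(reduced_formP _ _ X0) [[ap an af] [v0 vY tI Wt]].
have [i [j gE]] := g_surj ap; have [_ aE _] := gP i j.
have i0 : 0 < i by move: af; rewrite -gE aE pmulr_lgt0.
have sec : sector Q g p (p + p) Y i j by rewrite /sector gE.
have pp : p <= p + p by rewrite lerDl ltW.
have [ir /andP[jl jr]] := sector_sub r_neq0 D_gt0 a0_gt0 b1_gt0 gP i0 p_gt0 pp Y0 sec.
have iR : 0 < i%:~R :> R by rewrite ltr0z.
pose s := @slope R Q a0 b0 b1.
have M1 : 0 <= `|s p| + `|s (p + p)| by rewrite addr_ge0.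
have iB : i%:~R * (1 + `|s p| + `|s (p + p)|) <= B%:R :> R.
  apply: le_trans YB; rewrite /box_factor -/s mulrAC; apply: ler_wpM2r => //.
have iM : i%:~R * (1 + `|s p| + `|s (p + p)|) =
    i%:~R + i%:~R * `|s p| + i%:~R * `|s (p + p)| :> R by ring.
have is1 : 0 <= i%:~R * `|s p| by rewrite mulr_ge0 // ltW.
have is2 : 0 <= i%:~R * `|s (p + p)| by rewrite mulr_ge0 // ltW.
have jB : `|j%:~R| <= B%:R :> R.
  rewrite ler_norml; apply/andP; split.
    apply: le_trans jl; rewrite /slope_min -/s lerNl -mulNr mulrC.
    have : - Num.min (s p) (s (p + p)) <= `|s p| + `|s (p + p)|.
      by rewrite /Num.min; case: ifP => _; [have := ler_norm (- s p)|have := ler_norm (- s (p + p))];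
        rewrite normrN; have := normr_ge0 (s p); have := normr_ge0 (s (p + p)); lra.
    move=> /(ler_wpM2l (ltW iR)) /le_trans; apply; rewrite mulrDr; lra.
  apply: (le_trans jr); rewrite /slope_max -/s mulrC.
  have : Num.max (s p) (s (p + p)) <= `|s p| + `|s (p + p)|.
    by rewrite /Num.max; case: ifP => _; [have := ler_norm (s (p + p))|have := ler_norm (s p)];
      have := normr_ge0 (s p); have := normr_ge0 (s (p + p)); lra.
  move=> /(ler_wpM2l (ltW iR)) /le_trans; apply; rewrite mulrDr; lra.
have iBZ : i <= B%:Z by rewrite -(ler_int R) -pmulrn; lra.
have jBZ : `|j| <= B%:Z by rewrite -(ler_int R) -pmulrn intr_norm.
have [j' jE] := box_index jBZ.
(* Row index k stands for i = k + 1, whence the predecessor. *)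
have iN : (`|i|.-1 < B)%N by clear - i0 iBZ; lia.
have iE : (`|i|.-1).+1%:Z = i by clear - i0; lia.
exists (Ordinal iN, j'); rewrite ?/P ?/gg /= iE jE //.
by apply/asboolP; rewrite /PP /timed_sector gE.
Qed.
End RingCount.

Lemma distortion_cvg1 (R : realType) (p eta : R) : 0 < p -> 0 < eta ->
  exists N0 : nat, forall N, (N0 < N)%N -> distortion p (p / N%:R) <= 1 + eta.
Proof.
move=> p0 e0; have E1 := expR3_gt1 p0; set E := expR (3 * p) in E1.
set K := E / (E - 1).
have K0 : 0 < K by rewrite divr_gt0 ?subr_gt0 // (lt_trans _ E1).
have eK : 0 < eta / K by rewrite divr_gt0.
have c0 : expR x @[x --> (0 : R)] --> expR 0 := @continuous_expR R 0.
move/cvgrPdist_lt: c0 => /(_ _ eK) /nbhs_ballP [d /= d0 dP].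
exists (Num.trunc (3 * p / d)).+1 => N N0.
have NR : 0 < N%:R :> R by rewrite ltr0n; lia.
have hd : 3 * (p / N%:R) < d.
  rewrite mulrA ltr_pdivrMr // [ltRHS]mulrC -ltr_pdivrMr //.
  have := truncnS_gt (3 * p / d); move: N0; rewrite -(ltr_nat R); lra.
have h0 : 0 < 3 * (p / N%:R) by rewrite mulr_gt0 // divr_gt0.
have := dP (3 * (p / N%:R)); rewrite /ball /= sub0r normrN gtr0_norm // => /(_ hd).
rewrite expR0 ltr_norml => /andP[lo _].
rewrite /distortion -/E -/K lerD2l -ler_pdivlMl // [leRHS]mulrC; lra.
Qed.

Lemma sqrt_le_linear (R : realType) (C e : R) : 0 <= C -> 0 < e ->
  exists2 Y0, 0 < Y0 & forall Y, Y0 <= Y -> C * Num.sqrt Y <= e * Y.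
Proof.
move=> C0 e0; exists ((C / e) ^+ 2 + 1) => [|Y YY]; first by have := sqr_ge0 (C / e); lra.
have Y0 : 0 <= Y by apply: le_trans YY; have := sqr_ge0 (C / e); lra.
have -> : e * Y = e * Num.sqrt Y * Num.sqrt Y by rewrite -mulrA -expr2 sqr_sqrtr.
apply: ler_wpM2r; first exact: sqrtr_ge0.
have Ce : C / e = Num.sqrt ((C / e) ^+ 2) by rewrite sqrtr_sqr ger0_norm // divr_ge0 // ltW.
by rewrite [leRHS]mulrC -ler_pdivrMr // Ce ler_wsqrtr //; lra.
Qed.

Section RingAsymptotics.
Variables (R : realType) (Q : bqf int).
Hypotheses (Q_primitive : bqf_primitive Q).
Hypotheses (r_neq0 : bqf_r Q != 0) (D_gt0 : 0 < bqf_disc Q).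
Hypothesis Q_nonsquare : forall n : int, bqf_disc Q <> n ^+ 2.
Variables (a0 b0 b1 : int) (g : int -> int -> bcf).
Hypotheses (a0_gt0 : 0 < a0) (b1_gt0 : 0 < b1).
Hypothesis gP : forall i j, [/\ apolar Q (g i j), bcf_a (g i j) = i * a0 &
                    bcf_b (g i j) = i * b0 + j * b1].
Hypothesis g_surj : forall f, apolar Q f -> exists i j, g i j = f.

Local Notation p := (gamma_period R Q).
Local Notation phi := (fun t : R => modular_class (gamma Q t)).
Let p_gt0 : 0 < p := (gamma_period_minimal R r_neq0 D_gt0 Q_nonsquare).1.

Variable W : set (modular_surface R).
Hypothesis mW : measurable (phi @^-1` W : set (measurableTypeR R)).
Hypothesis bW : lebesgue_measure (common_boundary p (phi @^-1` W)) = 0%E.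

Local Notation S := (fun t : R => W (phi t)).
Local Notation l := (fine (mu Q W)).

(** [mu] measures times in [0, p) whereas forms are counted on [p, 2p); as S is invariant under
    translation by p, the Jordan sums agree. *)
Lemma jordan_pieces (eps : R) : 0 < eps -> exists N0 : nat, forall N, (N0 < N)%N ->
  p / N%:R * meeting_pieces p S N <= l + eps /\ l - eps <= p / N%:R * inner_pieces p S N.
Proof.
move=> e0; have mS : measurable (`[0, p[%classic `&` phi @^-1` W : set (measurableTypeR R)).
  by apply: measurableI => //; exact: measurable_itv.
have [N0 N0P] := jordan_cells p_gt0 mS bW e0; exists N0 => N NN.
have {}N0P := N0P N (ltnW NN) (leq_ltn_trans (leq0n _) NN).
have pP := (gamma_period_minimal R r_neq0 D_gt0 Q_nonsquare).2.1.
have Sp t : S (t + p) = S t by rewrite (modular_class_period r_neq0 D_gt0 _ pP).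
have Sm t : S (t - p) = S t by rewrite -(Sp (t - p)) subrK.
have pc k t : cell p N k t <-> piece p N k (t + p).
  by rewrite /cell /piece /= in_itv /=; split=> /andP[? ?]; apply/andP; split; lra.
have pc' k t : piece p N k t <-> cell p N k (t - p) by rewrite pc subrK.
have mE : \sum_(k < N) `[< exists2 t, cell p N k t & (phi @^-1` W) t >]%:R = meeting_pieces p S N.
  apply: eq_bigr => k _; congr (nat_of_bool _)%:R; apply/asbool_equiv_eq; split=> -[t kt St].
    by exists (t + p); [exact: (pc k t).1 kt|rewrite (Sp t)].
  by exists (t - p); [exact: (pc' k t).1 kt|rewrite /preimage /= (Sm t)].
have iE : \sum_(k < N) `[< forall t, cell p N k t -> (phi @^-1` W) t >]%:R = inner_pieces p S N.
  apply: eq_bigr => k _; congr (nat_of_bool _)%:R; apply/asbool_equiv_eq; split=> kS t kt.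
    by rewrite -(Sm t); exact: kS _ ((pc' k t).1 kt).
  by have := kS _ ((pc k t).1 kt); rewrite (Sp t).
by rewrite muE -mE -iE.
Qed.

Lemma mu_fine_ge0 : 0 <= l.
Proof. by rewrite fine_ge0 // muE measure_ge0. Qed.

Local Notation kappa := (3 * density R Q a0 b1).

Let kappa_gt0 : 0 < kappa.
Proof. by rewrite mulr_gt0 // density_gt0. Qed.

Lemma timed_count_asymptotic (eps : R) : 0 < eps -> exists2 Y0, 0 < Y0 & forall Y B, Y0 <= Y ->
  box_factor Q a0 b0 b1 p * Num.sqrt Y <= B%:R ->
  `|lattice_count R B (fun i j => timed_sector Q g p S Y i j /\ anisotropic (g i j))
    - kappa * l * Y| <= eps * Y.
Proof.
move=> eps0; have l0 := mu_fine_ge0; have k0 := kappa_gt0.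
(* A quarter of eps goes to the Jordan and distortion errors; others go to the O(sqrt Y) terms and
   to the reducible forms. *)
pose d := eps / (4 * kappa); have d0 : 0 < d by rewrite divr_gt0 // mulr_gt0.
have dE : kappa * d = eps / 4 by rewrite /d; move: kappa k0 => K K0; field; rewrite gt_eqF.
have ld0 : 0 < l + d by lra.
(* From (l + d) eta = d / 2 one gets (l + d / 2) (1 + eta) <= l + d and (l - d) (1 + eta) <= l - d /
   2. *)
pose eta := d / 2 / (l + d).
have eta0 : 0 < eta by apply: divr_gt0 => //; exact: divr_gt0.
have [N1 N1P] := jordan_pieces (divr_gt0 d0 (ltr0Sn R 1)).
have [N2 N2P] := distortion_cvg1 p_gt0 eta0.
pose N := (maxn N1 N2).+1.
have N0 : (0 < N)%N by [].
have [mN iN] : p / N%:R * meeting_pieces p S N <= l + d / 2 /\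
    l - d / 2 <= p / N%:R * inner_pieces p S N by apply: N1P; rewrite ltnS leq_maxl.
have rN : distortion p (p / N%:R) <= 1 + eta by apply: N2P; rewrite ltnS leq_maxr.
have h0 : 0 < p / N%:R by rewrite divr_gt0.
have r1 := distortion_ge1 p_gt0 (ltW h0).
have [C1 C10 upp] := timed_count_upper r_neq0 D_gt0 a0_gt0 b1_gt0 gP p_gt0 S N0.
have [C2 C20 low] := timed_count_lower r_neq0 D_gt0 a0_gt0 b1_gt0 gP p_gt0 S N0.
set rho := distortion p (p / N%:R) in rN r1 upp low.
set xm := p / N%:R * meeting_pieces p S N in mN upp.
set xi := p / N%:R * inner_pieces p S N in iN low.
have xi0 : 0 <= xi by rewrite mulr_ge0 ?(ltW h0) // sumr_ge0 // => k _; rewrite ler0n.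
have xm0 : 0 <= xm by rewrite mulr_ge0 ?(ltW h0) // sumr_ge0 // => k _; rewrite ler0n.
have etaE : (l + d) * eta = d / 2 by rewrite /eta; field; rewrite gt_eqF.
have upr : xm * rho <= l + d.
  have : xm * rho <= (l + d / 2) * (1 + eta) by apply: ler_pM => //; lra.
  have : d / 2 * eta >= 0 by rewrite mulr_ge0 //; lra.
  by move: etaE; rewrite !mulrDl !mulrDr !mulr1; lra.
have lor : l - d <= xi / rho.
  have rho0 : 0 < rho by lra.
  rewrite ler_pdivlMr //; have [ld|ld] := leP l d.
    by apply: le_trans xi0; rewrite mulr_le0_ge0 //; lra.
  have : (l - d) * rho <= (l - d) * (1 + eta) by apply: ler_wpM2l => //; lra.
  have : d * eta >= 0 by rewrite mulr_ge0 //; lra.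
  by move: etaE; rewrite !mulrDl !mulrDr !mulr1 !mulNr; lra.
have e4 : 0 < eps / 4 by rewrite divr_gt0.
have [Y1 Y10 Y1P] := sqrt_le_linear C10 e4.
have [Y2 Y20 Y2P] := sqrt_le_linear C20 e4.
have [Y3 Y30 Y3P] := reducible_count Q_primitive r_neq0 D_gt0 Q_nonsquare a0_gt0 b1_gt0 gP p_gt0 e4.
exists (Y1 + Y2 + Y3) => [|Y B YY YB]; first by lra.
have Y0 : 0 <= Y by lra.
have {upp} upp := upp Y B Y0; have {low} low := low Y B Y0 YB.
have {Y1P} s1 : C1 * Num.sqrt Y <= eps / 4 * Y by apply: Y1P; lra.
have {Y2P} s2 : C2 * Num.sqrt Y <= eps / 4 * Y by apply: Y2P; lra.
have {Y3P} s3 := Y3P Y B ltac:(lra).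
set cnt := lattice_count R B (fun i j => _ /\ anisotropic _).
have cu : cnt <= lattice_count R B (timed_sector Q g p S Y).
  by apply: lattice_count_le => i j _ [].
have cl : lattice_count R B (timed_sector Q g p S Y) <= cnt +
    lattice_count R B (fun i j => sector Q g p (p + p) Y i j /\ ~ anisotropic (g i j)).
  pose PI (b : bool) i j := if b then timed_sector Q g p S Y i j /\ anisotropic (g i j)
    else sector Q g p (p + p) Y i j /\ ~ anisotropic (g i j).
  have := @lattice_count_cover R bool B (timed_sector Q g p S Y) PI.
  rewrite big_bool /=; apply => i j _ ts.
  have [an|an] := pselect (anisotropic (g i j)); first by exists true.
  by exists false; split => //; case: ts.
have kY : 0 <= kappa * Y by rewrite mulr_ge0 // ltW.
have u1 : kappa * xm * rho * Y <= kappa * l * Y + eps / 4 * Y.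
  rewrite -dE; have -> : kappa * xm * rho * Y = kappa * Y * (xm * rho) by ring.
  have -> : kappa * l * Y + kappa * d * Y = kappa * Y * (l + d) by ring.
  exact: ler_wpM2l.
have l1 : kappa * l * Y - eps / 4 * Y <= kappa * xi / rho * Y.
  rewrite -dE; have -> : kappa * xi / rho * Y = kappa * Y * (xi / rho) by ring.
  have -> : kappa * l * Y - kappa * d * Y = kappa * Y * (l - d) by ring.
  exact: ler_wpM2l.
have eY : 0 <= eps * Y by rewrite mulr_ge0 // ltW.
rewrite ler_norml; apply/andP.
have e4Y : eps / 4 * Y = eps * Y / 4 by field.
rewrite e4Y in s1 s2 s3 u1 l1.
move: upp low s1 s2 s3 cu cl u1 l1 eY; clear.
move: (lattice_count _ _ _) (lattice_count _ _ _) (kappa * xm * rho * Y) (kappa * xi / rho * Y).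
move=> t s x y; move: (C1 * _) (C2 * _) (kappa * l * Y) (eps * Y) => c1 c2 z e.
by move=> *; split; lra.
Qed.

Lemma N_rings_asymptotic :
  (N_rings Q X W)%:R / value_bound Q X @[X --> +oo] --> kappa * l.
Proof.
apply/cvgrPdist_le => eps eps0.
have [Y0 Y00 YP] := timed_count_asymptotic eps0.
have DR : 0 < (bqf_disc Q)%:~R :> R by rewrite ltr0z.
exists (Y0 ^+ 2 * (bqf_disc Q)%:~R / 3); split; first exact: num_real.
move=> X XM.
have X0 : 0 < X by apply: lt_trans XM; rewrite divr_gt0 // mulr_gt0 // exprn_gt0.
have Y0X : Y0 <= value_bound Q X.
  have YE : Y0 = Num.sqrt (Y0 ^+ 2) by rewrite sqrtr_sqr gtr0_norm.
  rewrite YE; apply: ler_wsqrtr; rewrite ler_pdivlMr // mulrC; move: XM.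
  by rewrite ltr_pdivrMr // => XM; apply: ltW; rewrite mulrC [ltRHS]mulrC.
have Y0' : 0 < value_bound Q X := lt_le_trans Y00 Y0X.
set Y := value_bound Q X in Y0X Y0' *.
set c := box_factor Q a0 b0 b1 p * Num.sqrt Y.
have cB : c <= (Num.trunc c).+1%:R by apply: ltW; exact: truncnS_gt.
rewrite (N_rings_lattice_count Q_primitive r_neq0 D_gt0 Q_nonsquare a0_gt0 b1_gt0 gP g_surj W X0 cB).
have := YP Y _ Y0X cB; set cnt := lattice_count _ _ _ => cntP.
have -> : kappa * l - cnt / Y = - (cnt - kappa * l * Y) / Y by field; rewrite gt_eqF.
by rewrite normrM normrN normfV (gtr0_norm Y0') ler_pdivrMr.
Qed.
End RingAsymptotics.

Theorem theorem7p10 (R : realType) (Q : bqf int)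
    (Q_primitive : bqf_primitive Q)
    (Q_indefinite : bqf_indefinite Q)
    (Q_nonsquare : forall n : int, bqf_disc Q <> n ^+ 2)
    (W : set (modular_surface R))
    (W_continuity : continuity_set Q W) :
  (N_rings Q X W)%:R / (N_rings Q X (gamma_class R Q))%:R @[X --> +oo]
    --> fine (mu Q W) / fine (mu Q (gamma_class R Q)).

Proof.
have r_neq0 := nonsquare_lead_neq0 Q_nonsquare.
have D_gt0 := indefinite_disc_gt0 Q_indefinite r_neq0.
have [a0 [b0 [b1 [g [a0_gt0 b1_gt0 gP gS]]]]] := apolar_basis r_neq0.
have p_gt0 := (gamma_period_minimal R r_neq0 D_gt0 Q_nonsquare).1.
have [_ /(measurable_modular_class_gamma r_neq0 D_gt0) mW] := W_continuity.
move=> /(null_common_boundary r_neq0 D_gt0) bW.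
pose phi (t : R) := modular_class (gamma Q t).
(* The denominator is the same asymptotic count for the whole line of times, which is measurable
   with empty boundary. *)
have phiG : phi @^-1` gamma_class R Q = setT by apply/seteqP; split=> // t _; exists t.
have mG : measurable (phi @^-1` gamma_class R Q : set (measurableTypeR R)).
  by rewrite phiG; exact: measurableT.
have bG : lebesgue_measure (common_boundary (gamma_period R Q) (phi @^-1` gamma_class R Q)) = 0%E.
  by rewrite phiG /common_boundary setCT closure0 !setI0 measure0.
have lG : fine (mu Q (gamma_class R Q)) = gamma_period R Q.
  by rewrite muE phiG setIT lebesgue_measure_itv /= lte_fin p_gt0 -EFinB subr0.
have cW := N_rings_asymptotic Q_primitive r_neq0 D_gt0 Q_nonsquare a0_gt0 b1_gt0 gP gS mW bW.
have cG := N_rings_asymptotic Q_primitive r_neq0 D_gt0 Q_nonsquare a0_gt0 b1_gt0 gP gS mG bG.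
have k_gt0 : 0 < 3 * density R Q a0 b1 by rewrite mulr_gt0 // density_gt0.
rewrite lG in cG *; move: (3 * _) k_gt0 cW cG => k k_gt0 cW cG.
have kp0 : k * gamma_period R Q != 0 by rewrite gt_eqF // mulr_gt0.
have c := cvgM cW (cvgV kp0 cG).
have F : Filter (pinfty_nbhs R) by exact: _.
have {c} := c F F.
have -> : k * fine (mu Q W) * (k * gamma_period R Q)^-1 = fine (mu Q W) / gamma_period R Q.
  by field; rewrite !gt_eqF.
(* The normalization by [value_bound Q X] cancels in the quotient where it is nonzero, hence for all
   X > 0. *)
apply: cvg_trans; apply: near_eq_cvg.
exists 0; split; first exact: num_real.
move=> X X0 /=.
have Y0 : value_bound Q X != 0.
  by rewrite gt_eqF // sqrtr_gt0 divr_gt0 ?mulr_gt0 // ltr0z.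
by rewrite invf_div mulrA divfK.
Qed.
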